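(* Let $n\ge 2$, $1\le k\le n-1$, $1\le p\le\infty$, $1/p+1/p'=1$, let $\mu\in\mathbb{R}$ satisfy $\mu<(n-k)/p'$, and put $\nu=\mu-k/p$. Then the dual $k$-plane transform $R_k^*$ is a linear bounded operator from $L^p_\mu(\Pi_{n,k})$ to $L^p_\nu(\mathbb{R}^n)$ with operator norm $$\|R_k^*\|=\pi^{k/2}\left(\frac{\sigma_{n-k-1}}{\sigma_{n-1}}\right)^{1/p'}\frac{\Gamma\big(((n-k)/p'-\mu)/2\big)}{\Gamma\big((n/p'+k/p-\mu)/2\big)}.$$
   Context: $G_{n,k}$ is the Grassmann manifold of $k$-dimensional linear subspaces $\xi$ of $\mathbb{R}^n$, with its $O(n)$-invariant probability measure $d\xi$. $\Pi_{n,k}$ is the manifold of all non-oriented affine $k$-planes $\tau$ in $\mathbb{R}^n$; each $\tau$ is parameterized by a pair $(\xi,u)$ with $\xi\in G_{n,k}$, $u\in\xi^\perp$ (so $\tau=\xi+u$), and $\Pi_{n,k}$ carries the measure $d\tau=d\xi\,du$, where $du$ is Lebesgue measure on $\xi^\perp$. $|\tau|=|u|$ is the Euclidean distance from $\tau$ to the origin. $L^p_\mu(\Pi_{n,k})$ is the space of measurable functions $\varphi$ with $\|\varphi\|_{p,\mu}=\|\,|\tau|^\mu\varphi\,\|_{L^p(\Pi_{n,k},d\tau)}<\infty$. Likewise $L^p_\nu(\mathbb{R}^n)$ is the space of measurable $f$ with $\|f\|_{p,\nu}=\|\,|x|^\nu f\,\|_{L^p(\mathbb{R}^n)}<\infty$.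 With $\mathbb{R}^k=\mathbb{R}e_1\oplus\cdots\oplus\mathbb{R}e_k\subset\mathbb{R}^n$ ($e_i$ the coordinate unit vectors), the dual $k$-plane transform of a function $\varphi$ on $\Pi_{n,k}$ is $$(R_k^*\varphi)(x)=\int_{O(n)}\varphi(\gamma\mathbb{R}^k+x)\,d\gamma,\qquad x\in\mathbb{R}^n,$$ where $d\gamma$ is the invariant probability measure on $O(n)$. $\sigma_{m-1}=2\pi^{m/2}/\Gamma(m/2)$ is the area of the unit sphere $S^{m-1}$ in $\mathbb{R}^m$ ($\sigma_0=2$). Convention: $1/\infty=0$. *)

(* Defs.v *)
From HB Require Import structures.
From mathcomp Require Import all_boot all_order all_algebra.
From mathcomp Require Import all_classical all_reals all_analysis.
From mathcomp Require Import measurable_realfun.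

Set Implicit Arguments.
Unset Strict Implicit.
Unset Printing Implicit Defensive.

Import Order.TTheory GRing.Theory Num.Theory.
Import numFieldNormedType.Exports.

Local Open Scope classical_set_scope.
Local Open Scope ring_scope.

Definition mx_display : measure_display. Proof. exact. Qed.

Section measurable_matrix.
Context {R : realType} {m n : nat}.

(* The product sigma-algebra of R^(m x n), i.e. its Borel sigma-algebra. *)
Definition mx_measurable : set (set 'M[R]_(m, n)) :=
  <<s \bigcup_(ij in [set: 'I_m * 'I_n])
        preimage_set_system setT (fun M : 'M[R]_(m, n) => M ij.1 ij.2)
          measurable >>.

Let mx0 : mx_measurable set0.
Proof. exact: sigma_algebra0. Qed.

Let mxC A : mx_measurable A -> mx_measurable (~` A).
Proof. exact: sigma_algebraC. Qed.

Let mxU (F : (set 'M[R]_(m, n))^nat) : (forall i, mx_measurable (F i)) ->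
  mx_measurable (\bigcup_i (F i)).
Proof. exact: sigma_algebra_bigcup. Qed.

HB.instance Definition _ := @isMeasurable.Build mx_display
  'M[R]_(m, n) mx_measurable mx0 mxC mxU.

Lemma measurable_mx_entry i j :
  measurable_fun setT (fun M : 'M[R]_(m, n) => M i j).
Proof.
move=> _ Y mY; rewrite setTI; apply: sub_sigma_algebra.
by exists (i, j) => //=; exists Y => //; rewrite setTI.
Qed.

Lemma measurable_fun_mxP d (T : measurableType d) (f : T -> 'M[R]_(m, n)) :
  measurable_fun setT f <->
  forall i j, measurable_fun setT (fun t => f t i j).
Proof.
split=> [mf i j|mf].
  by apply: (measurableT_comp (measurable_mx_entry i j)).
have mf' (S : set 'M[R]_(m, n)) : measurable S -> measurable (f @^-1` S).
  pose C : set (set 'M[R]_(m, n)) := [set S | measurable (f @^-1` S)].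
  have sC : sigma_algebra setT C.
    split => /=.
    - by rewrite /C /= preimage_set0.
    - by move=> A CA; rewrite /C /= setTD preimage_setC; exact: measurableC.
    - move=> F CF; rewrite /C /= preimage_bigcup.
      exact: bigcupT_measurable.
  suff : @measurable _ 'M[R]_(m, n) `<=` C by apply.
  apply: smallest_sub => // _ [[i j] _ [B mB <-]].
  rewrite /C /= setTI -(setTI (_ @^-1` _)).
  exact: mf.
by move=> _ S mS; rewrite setTI; exact: mf'.
Qed.

End measurable_matrix.

Section lebesgue_cV.
Context {R : realType}.

Definition cons_cV n (xv : measurableTypeR R * 'cV[R]_n) : 'cV[R]_n.+1 :=
  (col_mx (xv.1%:M : 'M[R]_1) xv.2 : 'cV[R]_(1 + n)).

Definition uncons_cV n (v : 'cV[R]_n.+1) : measurableTypeR R * 'cV[R]_n :=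
  (v 0 0, \col_i v (lift 0 i) 0).

Lemma cons_cVE0 n (xv : measurableTypeR R * 'cV[R]_n) j : cons_cV xv 0 j = xv.1.
Proof.
by rewrite /cons_cV mxE; case: splitP => // i _; rewrite !ord1 mxE eqxx mulr1n.
Qed.

Lemma cons_cVES n (xv : measurableTypeR R * 'cV[R]_n) i j : cons_cV xv (lift 0 i) j = xv.2 i 0.
Proof.
rewrite /cons_cV mxE; case: splitP => [k|k]; first by rewrite ord1.
by rewrite /= /bump /= => /eqP; rewrite eqSS => /eqP /val_inj ->; rewrite ord1.
Qed.

Lemma cons_cVK n : cancel (@cons_cV n) (@uncons_cV n).
Proof.
move=> [x v]; rewrite /uncons_cV cons_cVE0; congr pair.
by apply/matrixP => i j; rewrite mxE cons_cVES ord1.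
Qed.

Lemma uncons_cVK n : cancel (@uncons_cV n) (@cons_cV n).
Proof.
move=> v; apply/matrixP => i j; rewrite ord1.
case: (unliftP 0 i) => [k ->|->]; first by rewrite cons_cVES mxE.
by rewrite cons_cVE0.
Qed.

Lemma measurable_cons_cV n : measurable_fun setT (@cons_cV n).
Proof.
apply/measurable_fun_mxP => i j.
case: (unliftP 0 i) => [k ->|->].
- under eq_fun do rewrite cons_cVES.
  exact: (measurableT_comp (measurable_mx_entry _ _) measurable_snd).
- under eq_fun do rewrite cons_cVE0.
  exact: measurable_fst.
Qed.

Lemma measurable_uncons_cV n : measurable_fun setT (@uncons_cV n).
Proof.
apply/measurable_fun_pairP; split; first exact: measurable_mx_entry.
apply/measurable_fun_mxP => i j.
rewrite (_ : (fun _ => _) = fun v : 'cV[R]_n.+1 => v (lift 0 i) 0).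
  exact: measurable_mx_entry.
by apply/funext => v /=; rewrite mxE.
Qed.

Section step.
Context (n : nat) (m : {sigma_finite_measure set 'cV[R]_n -> \bar R}).

Definition lebesgue_cVS : set 'cV[R]_n.+1 -> \bar R :=
  pushforward (lebesgue_measure \x m)%E (@cons_cV n).

HB.instance Definition _ :=
  Measure.copy lebesgue_cVS
  (measure_function_pushforward__canonical__measure_function_Measure
     (lebesgue_measure \x m)%E (@measurable_cons_cV n)).

Let sigma_finite_lebesgue_cVS : sigma_finite setT lebesgue_cVS.
Proof.
have /sigma_finiteP[F [TF ndF Foo]] :=
  sigma_finiteT (@lebesgue_measure R : {sigma_finite_measure set _ -> \bar R}).
have /sigma_finiteP[G [TG ndG Goo]] := sigma_finiteT m.
exists (fun k => @uncons_cV n @^-1` (F k `*` G k)).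
  rewrite -preimage_bigcup (_ : \bigcup_k _ = setT) ?preimage_setT//.
  rewrite -subTset => -[x y] _.
  have [k _ Fk] : (\bigcup_k F k) x by rewrite -TF.
  have [l _ Gl] : (\bigcup_k G k) y by rewrite -TG.
  exists (maxn k l) => //; split => /=.
    by move: x Fk; exact/subsetPset/ndF/leq_maxl.
  by move: y Gl; exact/subsetPset/ndG/leq_maxr.
move=> k; have [mF Fk] := Foo k; have [mG Gk] := Goo k.
have mFG := measurableX mF mG; split.
  by rewrite -[X in measurable X]setTI; exact: measurable_uncons_cV.
rewrite /lebesgue_cVS /pushforward -comp_preimage.
rewrite (_ : _ \o _ = id); last by apply/funext => x /=; rewrite cons_cVK.
rewrite preimage_id [ltLHS]product_measure1E//.
by rewrite lte_mul_pinfty// ge0_fin_numE.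
Qed.

HB.instance Definition _ := Measure_isSigmaFinite.Build _ _ _ lebesgue_cVS
  sigma_finite_lebesgue_cVS.
End step.

(* Lebesgue measure on R^n as an iterated product of lebesgue_measure *)
Fixpoint lebesgue_cV n : {sigma_finite_measure set 'cV[R]_n -> \bar R} :=
  match n with
  | 0 => dirac (0 : 'cV[R]_0)
  | n'.+1 => lebesgue_cVS (lebesgue_cV n')
  end.

Lemma lebesgue_cVSE n A : lebesgue_cV n.+1 A =
  (\int[lebesgue_measure]_x
     lebesgue_cV n (xsection (@cons_cV n @^-1` A) x))%E.
Proof. by []. Qed.

End lebesgue_cV.

Section rotation_invariance.
Context {R : realType}.

Lemma measurable_mulmx_cV d (T : measurableType d) m n (M : T -> 'M[R]_(m, n))
    (u : T -> 'cV[R]_n) :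
  measurable_fun setT M -> measurable_fun setT u ->
  measurable_fun setT (fun t => M t *m u t).
Proof.
move=> /measurable_fun_mxP mM /measurable_fun_mxP mu.
apply/measurable_fun_mxP => i j; under eq_fun do rewrite mxE.
apply: measurable_sum => k.
by apply: measurable_funM; [exact: mM|exact: mu].
Qed.

Lemma measurable_addmx d (T : measurableType d) m n (u v : T -> 'M[R]_(m, n)) :
  measurable_fun setT u -> measurable_fun setT v ->
  measurable_fun setT (fun t => u t + v t).
Proof.
move=> /measurable_fun_mxP mu /measurable_fun_mxP mv.
apply/measurable_fun_mxP => i j; under eq_fun do rewrite mxE.
by apply: measurable_funD; [exact: mu|exact: mv].
Qed.

Lemma lebesgue_measure_shift (c : R) (A : set (measurableTypeR R)) :
  measurable A -> lebesgue_measure ((fun x => x + c) @^-1` A) =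
                  lebesgue_measure A.
Proof.
move=> mA.
have mf : measurable_fun setT
    ((fun x => x + c) : measurableTypeR R -> measurableTypeR R).
  exact: (@measurable_funD _ _ _ _ (fun x : measurableTypeR R => x) (cst c)).
pose mu := measure_function_pushforward__canonical__measure_function_Measure
             lebesgue_measure mf.
apply/esym/(lebesgue_measure_unique (mu := mu)) => //= _ [[a b]] _ <-.
rewrite /mu /= /pushforward (_ : _ @^-1` _ = `]a - c, b - c]%classic).
  rewrite !lebesgue_measure_itv/= !lte_fin ltrD2r.
  by congr (if _ then _ else _); rewrite -!EFinB opprB addrA subrK.
apply/seteqP; split => x /=; rewrite !in_itv/=.
  by rewrite ltrBlDr lerBrDr.
by rewrite ltrBlDr lerBrDr.
Qed.

Lemma cons_cVD n (x y : R) (u v : 'cV[R]_n) :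
  cons_cV (x, u) + cons_cV (y, v) = cons_cV (x + y, u + v).
Proof.
apply/matrixP => i j; rewrite ord1 mxE.
case: (unliftP 0 i) => [k ->|->]; first by rewrite !cons_cVES mxE.
by rewrite !cons_cVE0.
Qed.

Lemma lebesgue_cV_shift n (c : 'cV[R]_n) A : measurable A ->
  lebesgue_cV n ((fun x => x + c) @^-1` A) = lebesgue_cV n A.
Proof.
elim: n c A => [|n IHn] c A mA.
  congr (lebesgue_cV 0 _); apply/seteqP; split => x /=;
  by rewrite (_ : x + c = x)//; apply/matrixP => -[].
rewrite !lebesgue_cVSE.
have [c0 [c' ->]] : exists (c0 : R) c', c = cons_cV (c0, c').
  by case E : (uncons_cV c) => [c0 c']; exists c0, c'; rewrite -E uncons_cVK.
have mcA : measurable (@cons_cV R n @^-1` A).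
  by rewrite -[X in measurable X]setTI; exact: measurable_cons_cV.
pose g x := lebesgue_cV n (xsection (@cons_cV R n @^-1` A) x).
have mg : measurable_fun setT g by exact: measurable_fun_xsection.
transitivity (\int[lebesgue_measure]_x g ((x : R) + c0)%R)%E.
  apply: eq_integral => x _; rewrite /g -[in RHS](IHn c').
    congr (lebesgue_cV n _); apply/seteqP; split => v /=;
    by rewrite /xsection /= !inE /= cons_cVD.
  exact: measurable_xsection.
have mf : measurable_fun setT
    ((fun x => x + c0) : measurableTypeR R -> measurableTypeR R).
  exact: (@measurable_funD _ _ _ _ (fun x : measurableTypeR R => x) (cst c0)).
rewrite -[LHS](@ge0_integral_pushforward _ _ _ _ _ _ mf _ setT g)//.
by apply: eq_measure_integral => B mB _; exact: lebesgue_measure_shift.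
Qed.

Lemma lebesgue_cV_box n (a b : R) : a <= b ->
  measurable [set v : 'cV[R]_n | forall i, a <= v i 0 <= b] /\
  lebesgue_cV n [set v : 'cV[R]_n | forall i, a <= v i 0 <= b] =
  ((b - a) ^+ n)%:E.
Proof.
move=> ab; elim: n => [|n [mB IHn]].
  rewrite (_ : [set _ | _] = setT); last by apply/seteqP; split => // x _ [].
  by split=> //; rewrite /= diracT.
have E : @cons_cV R n @^-1` [set v : 'cV[R]_n.+1 | forall i, a <= v i 0 <= b] =
         (`[a, b]%classic : set (measurableTypeR R)) `*`
         [set v : 'cV[R]_n | forall i, a <= v i 0 <= b].
  apply/seteqP; split => [[x v] /= h|[x v] /= [+ h] i]; rewrite ?in_itv /=.
  - split; first by have := h 0; rewrite cons_cVE0.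
    by move=> i; have := h (lift 0 i); rewrite cons_cVES.
  - move=> xab; case: (unliftP 0 i) => [k ->|->].
      by rewrite cons_cVES.
    by rewrite cons_cVE0.
split.
  rewrite (_ : [set _ | _] = @uncons_cV R n @^-1`
    ((`[a, b]%classic : set (measurableTypeR R)) `*`
         [set v : 'cV[R]_n | forall i, a <= v i 0 <= b])).
    rewrite -[X in measurable X]setTI; apply: measurable_uncons_cV => //.
    exact: (measurableX (measurable_itv `[a, b]) mB).
  rewrite -E -comp_preimage (_ : _ \o _ = id) ?preimage_id//.
  by apply/funext => x /=; rewrite uncons_cVK.
rewrite /= /lebesgue_cVS /pushforward E.
have mI : measurable (`[a, b]%classic : set (measurableTypeR R)).
  exact: measurable_itv.
transitivity (lebesgue_measure (`[a, b]%classic : set (measurableTypeR R)) *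
  lebesgue_cV n [set v | forall i, (a <= v i 0 <= b)%R])%E.
  exact: product_measure1E.
rewrite lebesgue_measure_itv /= lte_fin.
move: ab; rewrite le_eqVlt => /predU1P[->|ab].
  by rewrite ltxx mul0e subrr expr0n.
by rewrite ab IHn exprS EFinM EFinB.
Qed.

Definition unit_ball n : set 'cV[R]_n := [set v | (v^T *m v) 0 0 <= 1].
Arguments unit_ball n : clear implicits.

Lemma sqnormE n (v : 'cV[R]_n) : (v^T *m v) 0 0 = \sum_i v i 0 ^+ 2.
Proof. by rewrite mxE; apply: eq_bigr => i _; rewrite mxE expr2. Qed.

Lemma measurable_unit_ball n : measurable (unit_ball n).
Proof.
have mf : measurable_fun setT (fun v : 'cV[R]_n => \sum_i v i 0 ^+ 2).
  apply: measurable_sum => i; apply: measurable_funX.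
  exact: measurable_mx_entry.
rewrite (_ : unit_ball n =
  setT `&` (fun v : 'cV[R]_n => \sum_i v i 0 ^+ 2) @^-1` `]-oo, 1]).
  exact: mf.
rewrite setTI; apply/seteqP.
by split => v /=; rewrite /unit_ball /= sqnormE in_itv.
Qed.

Lemma lebesgue_cV_unit_ball n : (0 < lebesgue_cV n (unit_ball n) < +oo)%E.
Proof.
have mU := @measurable_unit_ball n.
apply/andP; split.
  pose c : R := (n.+1%:R)^-1.
  have c0 : 0 < c by rewrite invr_gt0.
  have cc : - c <= c by rewrite ge0_cp// ltW.
  have [mB EB] := @lebesgue_cV_box n _ _ cc.
  apply: lt_le_trans (le_measure _ _ _ _ : (lebesgue_cV n [set v | forall i, (- c <= v i 0 <= c)%R] <= _)%E).
  - by rewrite EB lte_fin exprn_gt0// opprK addr_gt0.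
  - by rewrite inE.
  - by rewrite inE.
  - move=> v /= h; rewrite /unit_ball /= sqnormE.
    apply: (@le_trans _ _ (\sum_(i < n) c)).
      apply: ler_sum => i _.
      have : `|v i 0| <= c by rewrite ler_norml.
      move=> vc; rewrite -real_normK ?num_real// expr2.
      have c1 : c <= 1 by rewrite invf_le1// ler1n.
      by rewrite -[leRHS]mul1r; apply: ler_pM => //; exact: le_trans c1.
    rewrite sumr_const card_ord -[_ *+ _]mulr_natr.
    by rewrite mulrC ler_pdivrMr// mul1r ler_nat.
have [mB EB] := @lebesgue_cV_box n (-1) 1 (ge0_cp ler01).2.
apply: (@le_lt_trans _ _ (lebesgue_cV n [set v | forall i, - 1 <= v i 0 <= 1])).
  apply: le_measure; rewrite ?inE//.
  move=> v; rewrite /unit_ball /= sqnormE => v1 i.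
  rewrite -ler_norml -(@ler_pXn2r _ 2)// ?nnegrE// expr1n real_normK ?num_real//.
  apply: le_trans v1; rewrite (bigD1 i)//= lerDl.
  by apply: sumr_ge0 => j _; exact: sqr_ge0.
by rewrite EB ltry.
Qed.


(* Invariance of Lebesgue measure under v |-> Q v, by uniqueness of
   translation-invariant measures: integrating 1_A(x) 1_B(x + Q y) in both
   orders gives |A| |Q^-1 B| = |B| |(-Q)^-1 A|, and B is the unit ball. *)
Lemma lebesgue_cV_rot n (Q : 'M[R]_n) A : Q^T *m Q = 1%:M -> measurable A ->
  lebesgue_cV n (mulmx Q @^-1` A) = lebesgue_cV n A.
Proof.
move=> QQ mA.
have QQ' : Q *m Q^T = 1%:M by apply: mulmx1C.
have mlin (M : 'M[R]_n) : measurable_fun setT (mulmx M : 'cV[R]_n -> 'cV[R]_n).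
  by apply: measurable_mulmx_cV => //; exact: measurable_id.
have mpre (M : 'M[R]_n) (B : set 'cV[R]_n) : measurable B ->
    measurable (mulmx M @^-1` B).
  by move=> mB; rewrite -[X in measurable X]setTI; exact: mlin.
have key (S : 'M[R]_n) (B C : set 'cV[R]_n) : S *m S^T = 1%:M -> S^T *m S = 1%:M ->
    measurable B -> measurable C ->
    (lebesgue_cV n B * lebesgue_cV n (mulmx S @^-1` C) =
     lebesgue_cV n C * lebesgue_cV n (mulmx (- S) @^-1` B))%E.
  move=> SS' SS mB mC.
  pose l := lebesgue_cV n : {sigma_finite_measure set 'cV[R]_n -> \bar R}.
  have mprod (S' : 'M[R]_n) : measurable_fun setT
      (fun z : 'cV[R]_n * 'cV[R]_n => z.1 + S' *m z.2).
    apply: measurable_addmx; first exact: measurable_fst.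
    by apply: measurable_mulmx_cV => //; exact: measurable_snd.
  have mW (S' : 'M[R]_n) (D E : set 'cV[R]_n) : measurable D -> measurable E ->
      measurable [set z : 'cV[R]_n * 'cV[R]_n | D z.1 /\ E (z.1 + S' *m z.2)].
    move=> mD mE; apply: measurableI.
      by rewrite -[X in measurable X]setTI; exact: measurable_fst.
    rewrite -[X in measurable X]setTI; exact: (mprod S').
  have H (S' : 'M[R]_n) (D E : set 'cV[R]_n) : S' *m S'^T = 1%:M ->
      measurable D -> measurable E ->
      (\int[l]_x l (xsection [set z | D z.1 /\ E (z.1 + S' *m z.2)%R] x) =
       l D * l (mulmx S' @^-1` E))%E.
    move=> SS1 mD mE.
    have -> : (l D * l (mulmx S' @^-1` E) =
               \int[l]_(x in D) cst (l (mulmx S' @^-1` E)) x)%E.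
      by rewrite integral_cst// muleC.
    rewrite [RHS]integral_mkcond; apply: eq_integral => x _.
    rewrite patchE; case: ifPn => [/set_mem Dx|/negP xD].
      rewrite /= /l -[RHS](lebesgue_cV_shift (S'^T *m x) (mpre _ _ mE)).
      congr (lebesgue_cV n _); apply/seteqP; split => y /=;
        rewrite /xsection /= inE /= mulmxDr mulmxA SS1 mul1mx addrC.
        by case.
      by [].
    rewrite (_ : xsection _ _ = set0) ?measure0//.
    apply/seteqP; split => y //=; rewrite /xsection /= inE /= => -[Dx _].
    by apply: xD; rewrite inE.
  rewrite -[LHS]/(l B * l (mulmx S @^-1` C))%E -(H S)//.
  rewrite -[RHS]/(l C * l (mulmx (- S) @^-1` B))%E -(H (- S))//; last first.
    by rewrite linearN /= mulNmx mulmxN opprK.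
  set W := [set z : 'cV[R]_n * 'cV[R]_n | _ /\ C _].
  set W' := [set z : 'cV[R]_n * 'cV[R]_n | C _ /\ _].
  have E0 (V : set ('cV[R]_n * 'cV[R]_n)) : measurable V ->
    (\int[l]_x l (xsection V x) = \int[l]_y l (ysection V y))%E.
    move=> mV; rewrite -[LHS]/((l \x l)%E V) -[RHS]/((l \x^ l)%E V).
    by apply: product_measure_unique => // B' C' mB' mC'; exact: product_measure2E.
  rewrite E0; last exact: mW.
  rewrite E0; last exact: mW.
  apply: eq_integral => y _.
  rewrite -[LHS](lebesgue_cV_shift (- (S *m y))); last first.
    by apply: measurable_ysection; exact: mW.
  congr (lebesgue_cV n _); apply/seteqP; split => x /=;
    by rewrite /ysection /= !inE /W /W' /= mulNmx subrK => -[].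
have mU := @measurable_unit_ball n.
have /andP[U0 Uoo] := @lebesgue_cV_unit_ball n.
have rotU (S : 'M[R]_n) : S^T *m S = 1%:M ->
    mulmx S @^-1` unit_ball n = unit_ball n.
  move=> SS; apply/seteqP; split => v;
  by rewrite /unit_ball /= trmx_mul mulmxA -(mulmxA v^T) SS mulmx1.
have NTN (M N : 'M[R]_n) : (- M) *m (- N) = M *m N by rewrite mulNmx mulmxN opprK.
have := key (- Q) A (unit_ball n).
rewrite opprK !(raddfN (@trmx R n n)) /= !NTN rotU; last first.
  by rewrite (raddfN (@trmx R n n)) /= NTN.
have cancel (a b c : \bar R) : (0 < c < +oo)%E -> (a * c = c * b)%E -> b = a.
  case: c => [r|/andP[]|/andP[]]//; move=> /andP[r0 _]; rewrite muleC => h.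
  by apply/le_anti/andP; split; rewrite -(@lee_pmul2l _ r%:E)// h.
by move=> /(_ QQ' QQ mA mU); apply: cancel; rewrite U0.
Qed.

End rotation_invariance.

Section orthogonal_matrices.
Context {R : realType}.

Definition orthogonal_group (n : nat) : Type := {g : 'M[R]_n | g^T *m g == 1%:M}.

HB.instance Definition _ n := Choice.on (orthogonal_group n).

Lemma orthogonal_one n : (1%:M : 'M[R]_n)^T *m 1%:M == 1%:M.
Proof. by rewrite trmx1 mulmx1. Qed.

Lemma orthogonal_mul n (g h : orthogonal_group n) :
  (val g *m val h)^T *m (val g *m val h) == 1%:M.
Proof.
case: g h => g /= /eqP gg [h /= /eqP hh].
by rewrite trmx_mul mulmxA -(mulmxA h^T) gg mulmx1 hh.
Qed.

Definition orth1 n : orthogonal_group n := exist _ 1%:M (orthogonal_one n).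
Definition orth_mul n (g h : orthogonal_group n) : orthogonal_group n :=
  exist _ (val g *m val h) (orthogonal_mul g h).

HB.instance Definition _ n := isPointed.Build (orthogonal_group n) (orth1 n).

Definition orthogonal_measurable n : set (set (orthogonal_group n)) :=
  preimage_set_system setT val measurable.

Let orthogonal_sigma n : sigma_algebra setT (@orthogonal_measurable n).
Proof. by apply: sigma_algebra_preimage; exact: sigma_algebra_measurable. Qed.

Let orthogonalC n (A : set (orthogonal_group n)) :
  orthogonal_measurable A -> orthogonal_measurable (~` A).
Proof. by rewrite -setTD; have [_ + _] := orthogonal_sigma n; exact. Qed.

HB.instance Definition _ n := @isMeasurable.Build mx_display (orthogonal_group n)
  (@orthogonal_measurable n) (let: And3 h _ _ := orthogonal_sigma n in h)
  (@orthogonalC n) (let: And3 _ _ h := orthogonal_sigma n in h).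

Lemma measurable_val_orthogonal n :
  measurable_fun setT (val : orthogonal_group n -> 'M[R]_n).
Proof. by move=> _ B mB; exists B. Qed.

End orthogonal_matrices.
Arguments orthogonal_group R n : clear implicits.

Section orth_compl.
Context {R : realType} {n : nat}.
Implicit Types (U : {vspace 'cV[R]_n}) (u w : 'cV[R]_n).

(* U^perp for the Euclidean scalar product w^T u *)
Definition orth_compl U : {vspace 'cV[R]_n} :=
  (\bigcap_(i < \dim U) lker (linfun (mulmx ((vbasis U)`_i)^T)))%VS.

Lemma orth_complP U u :
  reflect (forall w, w \in U -> w^T *m u = 0) (u \in orth_compl U).
Proof.
apply: (iffP idP) => [uU w wU|h].
  rewrite (coord_vbasis wU) linear_sum mulmx_suml big1// => i _.
  rewrite linearZ /= -scalemxAl.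
  have : (orth_compl U <= lker (linfun (mulmx ((vbasis U)`_i)^T)))%VS.
    exact: bigcapv_inf.
  by move=> /subvP/(_ _ uU); rewrite memv_ker lfunE => /eqP ->; rewrite scaler0.
rewrite memvE; apply/subv_bigcapP => i _.
rewrite -memvE memv_ker lfunE; apply/eqP/h.
by apply: vbasis_mem; rewrite mem_nth// size_tuple.
Qed.

Lemma sqnorm_eq0 u : u^T *m u = 0 -> u = 0.
Proof.
move=> /matrixP /(_ 0 0); rewrite sqnormE mxE => /eqP.
rewrite psumr_eq0 => [/allP u0|i _]; last exact: sqr_ge0.
apply/matrixP => i j; rewrite ord1 mxE; apply/eqP.
by rewrite -sqrf_eq0; apply: u0; rewrite mem_index_enum.
Qed.

Lemma orth_complI U : (orth_compl U :&: U = 0)%VS.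
Proof.
apply/eqP; rewrite -subv0; apply/subvP => u /memv_capP[/orth_complP uU' uU].
by rewrite memv0; apply/eqP/sqnorm_eq0/uU'.
Qed.

End orth_compl.

Section grassmannian.
Context {R : realType}.

(* k : 'I_n bundles k < n, which makes G_{n,k} inhabited. *)
Definition grassmannian (n : nat) (k : 'I_n) : Type :=
  {xi : {vspace 'cV[R]_n} | \dim xi == k}.

HB.instance Definition _ n (k : 'I_n) := Choice.on (grassmannian k).

Definition coord_basis n (k : 'I_n) : k.-tuple 'cV[R]_n :=
  [tuple delta_mx (widen_ord (ltnW (ltn_ord k)) i) 0 | i < k].

(* R^k = R e_1 + ... + R e_k *)
Definition coord_space n (k : 'I_n) : {vspace 'cV[R]_n} :=
  <<coord_basis k>>%VS.

Lemma dim_coord_space n (k : 'I_n) : \dim (coord_space k) == k.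
Proof.
suff fX : free (coord_basis k) by rewrite /coord_space (eqnP fX) size_tuple.
have bE (j : 'I_k) : (coord_basis k)`_j =
    delta_mx (widen_ord (ltnW (ltn_ord k)) j) 0.
  by rewrite -[LHS](tnth_nth 0 (coord_basis k) j) tnth_mktuple.
apply/freeP => c + i => /matrixP/(_ (widen_ord (ltnW (ltn_ord k)) i) 0).
rewrite summxE [RHS]mxE (bigD1 i)//= big1 => [|j ji].
  by rewrite bE !mxE !eqxx mulr1 addr0.
rewrite bE !mxE (_ : _ == _ = false) ?mulr0//.
by apply: contraNF ji => /eqP/(congr1 val)/= /val_inj ->.
Qed.

Definition coord_plane n (k : 'I_n) : grassmannian k :=
  exist _ (coord_space k) (dim_coord_space k).

HB.instance Definition _ n (k : 'I_n) :=
  isPointed.Build (grassmannian k) (coord_plane k).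

Lemma dim_rotate n (g : orthogonal_group R n) (U : {vspace 'cV[R]_n}) :
  \dim (linfun (mulmx (val g)) @: U) = \dim U.
Proof.
rewrite limg_dim_eq//; apply/eqP; rewrite -subv0; apply/subvP => u.
move=> /memv_capP[_]; rewrite memv_ker lfunE memv0 => /eqP /= gu.
by have /eqP gg := valP g; rewrite -(mul1mx u) -gg -mulmxA gu mulmx0.
Qed.

Lemma dim_grass_act n (k : 'I_n) (g : orthogonal_group R n) (xi : grassmannian k) :
  \dim (linfun (mulmx (val g)) @: val xi) == k.
Proof. by rewrite dim_rotate; exact: valP xi. Qed.

Definition grass_act n (k : 'I_n) (g : orthogonal_group R n) (xi : grassmannian k) :
  grassmannian k :=
  exist _ (linfun (mulmx (val g)) @: val xi)%VS (dim_grass_act g xi).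

(* The Borel sigma-algebra of G_{n,k} as a homogeneous space of O(n): final
   for the orbit map g |-> g R^k. *)
Definition grassmannian_measurable n (k : 'I_n) : set (set (grassmannian k)) :=
  image_set_system setT (fun g => grass_act g (coord_plane k)) measurable.

Let grassmannian_sigma n (k : 'I_n) :
  sigma_algebra setT (@grassmannian_measurable n k).
Proof. by apply: sigma_algebra_image; exact: sigma_algebra_measurable. Qed.

Let grassmannianC n (k : 'I_n) (A : set (grassmannian k)) :
  grassmannian_measurable A -> grassmannian_measurable (~` A).
Proof. by rewrite -setTD; have [_ + _] := grassmannian_sigma k; exact. Qed.

HB.instance Definition _ n (k : 'I_n) :=
  @isMeasurable.Build mx_display (grassmannian k)
  (@grassmannian_measurable n k)
  (let: And3 h _ _ := grassmannian_sigma k in h)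
  (@grassmannianC n k) (let: And3 _ _ h := grassmannian_sigma k in h).

Lemma measurable_orbit n (k : 'I_n) :
  measurable_fun setT (fun g : orthogonal_group R n => grass_act g (coord_plane k)).
Proof. by move=> _ B mB; exact: mB. Qed.

Lemma measurable_fun_grassP d (T : measurableType d) n (k : 'I_n)
    (f : grassmannian k -> T) :
  measurable_fun setT (fun g => f (grass_act g (coord_plane k))) ->
  measurable_fun setT f.
Proof.
move=> mf _ B mB; rewrite setTI.
by move: (mf measurableT B mB); rewrite /measurable/= /grassmannian_measurable.
Qed.

End grassmannian.
Arguments grassmannian R {n} k.
Arguments coord_plane {R n} k.

Section affine_planes.
Context {R : realType}.

(* An affine k-plane xi + u is given by its direction xi and its foot u in
   xi^perp; this representation is unique. *)
Definition affine_plane (n : nat) (k : 'I_n) : Type :=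
  {tau : grassmannian R k * 'cV[R]_n | tau.2 \in orth_compl (val tau.1)}.

HB.instance Definition _ n (k : 'I_n) := Choice.on (affine_plane k).

Lemma translate_subproof n (k : 'I_n) (xi : grassmannian R k) (x : 'cV[R]_n) :
  (xi, daddv_pi (orth_compl (val xi)) (val xi) x).2 \in
    orth_compl (val (xi, daddv_pi (orth_compl (val xi)) (val xi) x).1).
Proof. exact: memv_pi. Qed.

(* The plane xi + x, for arbitrary x: its foot is the projection of x onto
   xi^perp along xi. *)
Definition translate n (k : 'I_n) (xi : grassmannian R k) (x : 'cV[R]_n) :
  affine_plane k := exist _ (xi, _) (translate_subproof xi x).

HB.instance Definition _ n (k : 'I_n) :=
  isPointed.Build (affine_plane k) (translate (coord_plane k) 0).

(* The trace on {u in xi^perp} of the product sigma-algebra of G_{n,k} x R^n *)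
Definition affine_plane_measurable n (k : 'I_n) : set (set (affine_plane k)) :=
  preimage_set_system setT val measurable.

Let affine_plane_sigma n (k : 'I_n) :
  sigma_algebra setT (@affine_plane_measurable n k).
Proof. by apply: sigma_algebra_preimage; exact: sigma_algebra_measurable. Qed.

Let affine_planeC n (k : 'I_n) (A : set (affine_plane k)) :
  affine_plane_measurable A -> affine_plane_measurable (~` A).
Proof. by rewrite -setTD; have [_ + _] := affine_plane_sigma k; exact. Qed.

HB.instance Definition _ n (k : 'I_n) :=
  @isMeasurable.Build mx_display (affine_plane k)
  (@affine_plane_measurable n k)
  (let: And3 h _ _ := affine_plane_sigma k in h)
  (@affine_planeC n k) (let: And3 _ _ h := affine_plane_sigma k in h).

Lemma measurable_fun_affine_plane d (T : measurableType d) n (k : 'I_n)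
    (f : T -> affine_plane k) :
  measurable_fun setT (fun t => val (f t)) -> measurable_fun setT f.
Proof.
by move=> mf _ _ [B mB <-]; have := mf measurableT B mB; rewrite !setTI.
Qed.

End affine_planes.
Arguments affine_plane R {n} k.

Section plane_measure.
Context {R : realType} {n : nat} {k : 'I_n}.
Implicit Types (xi : grassmannian R k) (g : orthogonal_group R n).

(* The columns of B are an orthonormal basis of xi^perp, i.e. v |-> B v is a
   linear isometry of R^(n - k) onto xi^perp. *)
Definition orth_frame xi (B : 'M[R]_(n, n - k)) : Prop :=
  B^T *m B = 1%:M /\
  forall u : 'cV[R]_n, u \in orth_compl (val xi) <-> exists v, u = B *m v.

Definition perp_frame xi : 'M[R]_(n, n - k) := xget 0 (orth_frame xi).

Lemma measurable_mulmx_frame xi :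
  measurable_fun setT (mulmx (perp_frame xi) : 'cV[R]_(n - k) -> 'cV[R]_n).
Proof.
by apply: measurable_mulmx_cV; [exact: measurable_cst|exact: measurable_id].
Qed.

(* Lebesgue measure du of the subspace xi^perp, as a measure on R^n carried by
   xi^perp; it does not depend on the orthonormal basis (lebesgue_cV_rot). *)
Definition lebesgue_perp xi : set 'cV[R]_n -> \bar R :=
  pushforward (lebesgue_cV (n - k)) (mulmx (perp_frame xi)).

HB.instance Definition _ xi := Measure.copy (lebesgue_perp xi)
  (measure_function_pushforward__canonical__measure_function_Measure
     (lebesgue_cV (n - k)) (measurable_mulmx_frame xi)).

Lemma orth_compl_act g xi u :
  (u \in orth_compl (val (grass_act g xi))) =
  ((val g)^T *m u \in orth_compl (val xi)).
Proof.
apply/orth_complP/orth_complP => h w wxi.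
  rewrite mulmxA -trmx_mul; apply: h.
  by apply/memv_imgP; exists w => //; rewrite lfunE.
move: wxi => /memv_imgP[v vxi ->]; rewrite lfunE /= trmx_mul -mulmxA.
exact: h.
Qed.

Lemma orth_frame_act g xi B :
  orth_frame xi B -> orth_frame (grass_act g xi) (val g *m B).
Proof.
move=> [BB PB]; have /eqP gg := valP g; have gg' := mulmx1C gg.
split; first by rewrite trmx_mul mulmxA -(mulmxA B^T) gg mulmx1.
move=> u; rewrite orth_compl_act; split.
  move=> /PB[v gu]; exists v.
  by rewrite -mulmxA -gu mulmxA gg' mul1mx.
move=> [v ->]; apply/PB; exists v.
by rewrite !mulmxA gg mul1mx.
Qed.

Lemma orth_frame_actV g xi B :
  orth_frame (grass_act g xi) B -> orth_frame xi ((val g)^T *m B).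
Proof.
move=> [BB PB]; have /eqP gg := valP g; have gg' := mulmx1C gg.
split; first by rewrite trmx_mul trmxK mulmxA -(mulmxA B^T) gg' mulmx1.
move=> u; rewrite (_ : u = (val g)^T *m (val g *m u)); last first.
  by rewrite mulmxA gg mul1mx.
rewrite -orth_compl_act; split.
  by move=> /PB[v ->]; exists v; rewrite mulmxA.
move=> [v E]; apply/PB; exists v.
by move/(congr1 (mulmx (val g))): E; rewrite !mulmxA gg' !mul1mx.
Qed.

Lemma orth_frame_uniq xi B B' : orth_frame xi B -> orth_frame xi B' ->
  exists2 Q : 'M[R]_(n - k), Q^T *m Q = 1%:M & B' = B *m Q.
Proof.
move=> [BB PB] [BB' PB'].
have E : B *m (B^T *m B') = B'.
  apply/matrixP => i j.
  have : B' *m delta_mx j (0 : 'I_1) \in orth_compl (val xi).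
    by apply/PB'; exists (delta_mx j 0).
  move=> /PB[v Ev].
  have : B *m (B^T *m B') *m delta_mx j (0 : 'I_1) = B' *m delta_mx j 0.
    by rewrite -!mulmxA Ev (mulmxA B^T) BB mul1mx.
  by rewrite -!colE => /matrixP/(_ i 0); rewrite !mxE.
exists (B^T *m B') => //.
by rewrite trmx_mul trmxK -mulmxA E.
Qed.

Lemma perp_frame_act g (A : set 'cV[R]_n) : measurable A ->
  lebesgue_perp (grass_act g (coord_plane k)) A =
  lebesgue_cV (n - k)
    ((fun v => val g *m (perp_frame (coord_plane k) *m v)) @^-1` A).
Proof.
move=> mA; rewrite /lebesgue_perp /pushforward.
set xi := coord_plane k.
have [[B fB]|nB] := pselect (exists B, orth_frame xi B).
  have fxi : orth_frame xi (perp_frame xi) := xgetI _ fB.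
  have fgxi : orth_frame (grass_act g xi) (perp_frame (grass_act g xi)).
    exact: xgetI _ (orth_frame_act g fB).
  have [Q QQ ->] := orth_frame_uniq (orth_frame_act g fxi) fgxi.
  rewrite -[RHS](lebesgue_cV_rot QQ).
    by congr (lebesgue_cV _ _); apply/seteqP; split => v /=; rewrite !mulmxA.
  rewrite -[X in measurable X]setTI.
  have mf : measurable_fun setT
      (fun v => val g *m (perp_frame xi *m v) : 'cV[R]_n).
    apply: measurable_mulmx_cV; first exact: measurable_cst.
    exact: measurable_mulmx_frame.
  exact: mf.
have nfr (g' : orthogonal_group R n) :
    perp_frame (grass_act g' xi) = 0.
  rewrite /perp_frame xgetPN// => B fB; apply: nB.
  by exists ((val g')^T *m B); exact: orth_frame_actV.
have nfr0 : perp_frame xi = 0.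
  by rewrite /perp_frame xgetPN// => B fB; apply: nB; exists B.
rewrite nfr nfr0; congr (lebesgue_cV _ _).
by apply/seteqP; split => v /=; rewrite !mul0mx mulmx0.
Qed.

Lemma measurable_translate xi :
  measurable_fun setT (translate xi : 'cV[R]_n -> affine_plane R k).
Proof.
apply: measurable_fun_affine_plane => /=.
apply/measurable_fun_pairP; split => /=; first exact: measurable_cst.
set f := daddv_pi _ _.
rewrite (_ : _ \o _ = fun x : 'cV[R]_n => \matrix_(i, j) f (delta_mx j 0) i 0 *m x).
  by apply: measurable_mulmx_cV; [exact: measurable_cst|exact: measurable_id].
apply/funext => x /=; apply/matrixP => i j; rewrite ord1 mxE.
rewrite [in LHS](matrix_sum_delta x) linear_sum summxE; apply: eq_bigr => l _.
by rewrite big_ord1 linearZ /= !mxE mulrC.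
Qed.

Lemma translate_foot xi (u : 'cV[R]_n) : u \in orth_compl (val xi) ->
  val (translate xi u) = (xi, u).
Proof. by move=> uxi; rewrite /= daddv_pi_id// orth_complI. Qed.

Lemma perp_frame_in xi v : perp_frame xi *m v \in orth_compl (val xi).
Proof.
rewrite /perp_frame; case: xgetP => [B _ [_ PB]|_]; last by rewrite mul0mx mem0v.
by apply/PB; exists v.
Qed.

Lemma measurable_lebesgue_perp_translate (A : set (affine_plane R k)) :
  measurable A ->
  measurable_fun setT (fun xi => lebesgue_perp xi (translate xi @^-1` A)).
Proof.
move=> mA; apply: measurable_fun_grassP.
pose F (z : orthogonal_group R n * 'cV[R]_(n - k)) : affine_plane R k :=
  translate (grass_act z.1 (coord_plane k))
    (val z.1 *m (perp_frame (coord_plane k) *m z.2)).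
have mF : measurable_fun setT F.
  apply: measurable_fun_affine_plane.
  rewrite (_ : (fun _ => _) = fun z => (grass_act z.1 (coord_plane k),
     val z.1 *m (perp_frame (coord_plane k) *m z.2))); last first.
    apply/funext => z; rewrite translate_foot// orth_compl_act !mulmxA.
    by have /eqP -> := valP z.1; rewrite mul1mx; exact: perp_frame_in.
  apply/measurable_fun_pairP; split => /=.
    exact: (measurableT_comp (@measurable_orbit R n k) measurable_fst).
  apply: measurable_mulmx_cV.
    exact: (measurableT_comp (@measurable_val_orthogonal R n) measurable_fst).
  apply: measurable_mulmx_cV; first exact: measurable_cst.
  exact: measurable_snd.
have mFA : measurable (F @^-1` A).
  by rewrite -[X in measurable X]setTI; exact: mF.
rewrite (_ : (fun g => _) =
    fun g => lebesgue_cV (n - k) (xsection (F @^-1` A) g)).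
  exact: measurable_fun_xsection.
apply/funext => g; rewrite perp_frame_act.
  by congr (lebesgue_cV _ _); apply/seteqP; split => v; rewrite /xsection /= inE.
by rewrite -[X in measurable X]setTI; exact: measurable_translate.
Qed.

(* The measure dtau = dxi du: the set A of planes has mass
   \int_G |{u in xi^perp : xi + u in A}| dxi. *)
Definition plane_measure (dxi : {measure set (grassmannian R k) -> \bar R})
    (A : set (affine_plane R k)) : \bar R :=
  (\int[dxi]_xi lebesgue_perp xi (translate xi @^-1` A))%E.

Section plane_measure_is_measure.
Variable dxi : {measure set (grassmannian R k) -> \bar R}.

Let plane_measure0 : plane_measure dxi set0 = 0%E.
Proof. by apply: integral0_eq => xi _; rewrite preimage_set0 measure0. Qed.

Let plane_measure_ge0 A : (0 <= plane_measure dxi A)%E.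
Proof. by apply: integral_ge0 => xi _. Qed.

Let mtrans xi (A : set (affine_plane R k)) : measurable A ->
  measurable (translate xi @^-1` A).
Proof.
by move=> mA; rewrite -[X in measurable X]setTI; exact: measurable_translate.
Qed.

Let plane_measure_sigma_additive : semi_sigma_additive (plane_measure dxi).
Proof.
move=> U mU tU mUU; rewrite [X in _ --> X](_ : _ =
  \int[dxi]_xi (\sum_(n <oo) lebesgue_perp xi (translate xi @^-1` U n)))%E;
    last first.
  apply: eq_integral => xi _; rewrite preimage_bigcup.
  apply/esym/cvg_lim => //; apply: measure_semi_sigma_additive.
  - by move=> i; exact: mtrans.
  - apply/trivIsetP => /= i j _ _ ij; rewrite -preimage_setI.
    by move/trivIsetP : tU => /(_ _ _ _ _ ij) ->//; rewrite preimage_set0.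
  - by rewrite -preimage_bigcup; exact: mtrans.
apply/cvg_closeP; split.
  by apply: is_cvg_nneseries => i _ _; exact: integral_ge0.
rewrite closeE// integral_nneseries// => i.
exact: measurable_lebesgue_perp_translate.
Qed.

HB.instance Definition _ := isMeasure.Build _ _ _ (plane_measure dxi)
  plane_measure0 plane_measure_ge0 plane_measure_sigma_additive.
End plane_measure_is_measure.

End plane_measure.

Section dual_transform.
Context {R : realType}.

(* dg is the invariant probability measure on the compact group O(n). *)
Definition haar_measure n (dg : probability (orthogonal_group R n) R) : Prop :=
  forall (g : orthogonal_group R n) (A : set (orthogonal_group R n)),
  measurable A ->
  dg (orth_mul g @^-1` A) = dg A /\ dg ((fun h => orth_mul h g) @^-1` A) = dg A.

Definition orthogonal_invariant n (k : 'I_n)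
    (dxi : probability (grassmannian R k) R) : Prop :=
  forall (g : orthogonal_group R n) (A : set (grassmannian R k)),
  measurable A -> dxi (grass_act g @^-1` A) = dxi A.

(* (R_k^* phi)(x) = \int_{O(n)} phi(g R^k + x) dg; as for any Rintegral, the
   value is irrelevant at the x where the integral does not exist. *)
Definition dual_transform n (k : 'I_n)
    (dg : probability (orthogonal_group R n) R) (phi : affine_plane R k -> R)
    (x : 'cV[R]_n) : R :=
  \int[dg]_g phi (translate (grass_act g (coord_plane k)) x).

Definition enorm n (x : 'cV[R]_n) : R := Num.sqrt (\sum_i x i 0 ^+ 2).

Definition plane_dist n (k : 'I_n) (tau : affine_plane R k) : R :=
  enorm (val tau).2.

Definition Gamma (s : R) : R :=
  \int[lebesgue_measure]_(t in `]0, +oo[) (t `^ (s - 1) * expR (- t)).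

(* The area sigma_d of the unit sphere S^d of R^(d + 1) *)
Definition sphere_area (d : nat) : R :=
  2 * pi `^ (d.+1%:R / 2) / Gamma (d.+1%:R / 2).

End dual_transform.

Section weighted_Lp.
Context d (T : measurableType d) (R : realType).
Variable m : {measure set T -> \bar R}.

Definition weighted_norm (w : T -> R) (a : R) (p : \bar R) (f : T -> R) :
  \bar R := ('N[m]_p[(fun t => (w t `^ a * f t)%:E)])%E.

Definition weighted_Lp (w : T -> R) (a : R) (p : \bar R) : set (T -> R) :=
  [set f | measurable_fun setT f /\ (weighted_norm w a p f < +oo)%E].
End weighted_Lp.

(* Operators between spaces X, Y of functions taken up to a.e. equality, with
   norms NX and NY. *)
Section bounded_operators.
Context d1 d2 (T1 : measurableType d1) (T2 : measurableType d2) (R : realType).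
Variables (m1 : {measure set T1 -> \bar R}) (m2 : {measure set T2 -> \bar R}).
Variables (X : set (T1 -> R)) (NX : (T1 -> R) -> \bar R).
Variables (Y : set (T2 -> R)) (NY : (T2 -> R) -> \bar R).
Implicit Type S : (T1 -> R) -> T2 -> R.

Definition linear_bounded_operator S : Prop :=
  [/\ forall f, X f -> Y (S f),
      forall f g, X f -> X g -> f = g %[ae m1] -> S f = S g %[ae m2],
      forall (a b : R) f g, X f -> X g ->
        S (fun t => a * f t + b * g t) =
        (fun t => a * S f t + b * S g t) %[ae m2]
    & exists2 C : R, 0 <= C & forall f, X f -> (NY (S f) <= C%:E * NX f)%E].

Definition operator_norm S : \bar R :=
  ereal_sup [set NY (S f) | f in [set f | X f /\ (NX f <= 1)%E]].
End bounded_operators.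

(* Main.v *)
(* Write d = n - k, a = mu + d / p and let P be the orthogonal projection of R^n
   onto the last d coordinates. The foot of the plane g R^k + x has norm
   |P g^T x|, so R_k^* maps |tau|^-a, which barely fails to be in L^p_mu, to
   c |x|^-a, where c is the average of |P g^T e_1|^-a over O(n).

   Upper bound: by Hoelder's inequality with this weight,
     |R_k^* phi|^p <= (c |x|^-a)^(p - 1) R_k^* (|tau|^(a (p - 1)) |phi|^p),
   and by duality integrating the right-hand side against |x|^(nu p) amounts to
   integrating |x|^(a - n) over each plane tau, which gives c' |tau|^(a - d). Thus
   the norm is at most (c^(p - 1) c')^(1 / p), and c and c' are computed from
   Gaussian integrals.

   Sharpness: the truncated powers |tau|^(- a + eps) on |tau| <= 1 have norms
   comparable exactly with those of their images on |x| <= 1; let eps tend to 0.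
   For p = oo the function |tau|^-mu itself is extremal. *)

Require Import Defs.
From mathcomp Require Import all_boot all_order all_algebra.
From mathcomp Require Import all_classical all_reals all_analysis.
From mathcomp Require Import measurable_realfun ess_sup_inf ring.
Import Order.TTheory GRing.Theory Num.Theory.
Import numFieldNormedType.Exports.
Local Open Scope classical_set_scope.
Local Open Scope ring_scope.
Set Implicit Arguments.
Unset Strict Implicit.
Unset Printing Implicit Defensive.

(** [dg] and [dxi] are known only through their invariance, and this shapes the proof. Nothing is
    computed on O(n) directly: the mean c is found by testing [plane_duality] on functions for which
    both sides are Gaussian integrals, and radial integrals are themselves evaluated by Fubini
    against a Gaussian. The duality needs [dtau] as an image of [dg] times Lebesgue measure, hence
    [dxi] as the image of [dg] under the orbit map. The Fubini argument for the latter calls for a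
    measurable choice of g with g R^k = xi on a quotient sigma-algebra; Gram-Schmidt by Householder
    reflections provides it. Norms appear squared throughout, which explains the halved exponents.
    The two bounds meet because c' = c A_n / A_d with A_m = pi^(m/2) / Gamma(m/2): then (c^(p - 1)
    c')^(1 / p) = c (A_n / A_d)^(1 / p), which is also the limit of the ratios of norms for the
    truncated powers. That limit is taken inside the integral over O(n) that represents c. *)

Definition sqnorm {R : realType} {n} (x : 'cV[R]_n) : R := \sum_i x i 0 ^+ 2.

Section sqnorm.
Context {R : realType}.

Lemma sqnorm_ge0 n (x : 'cV[R]_n) : 0 <= sqnorm x.
Proof. by apply: sumr_ge0 => i _; exact: sqr_ge0. Qed.

Lemma trmx_mul_sqnorm n (x : 'cV[R]_n) : x^T *m x = (sqnorm x)%:M.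
Proof. by rewrite [LHS]mx11_scalar sqnormE. Qed.

Lemma sqnorm_eq0P n (x : 'cV[R]_n) : sqnorm x = 0 <-> x = 0.
Proof.
split=> [x0|->]; last by rewrite /sqnorm big1// => i _; rewrite mxE expr0n.
by apply: sqnorm_eq0; rewrite trmx_mul_sqnorm x0 raddf0.
Qed.

Lemma sqnorm_isometry m n (A : 'M[R]_(m, n)) (x : 'cV[R]_n) :
  A^T *m A = 1%:M -> sqnorm (A *m x) = sqnorm x.
Proof.
move=> AA; have := trmx_mul_sqnorm (A *m x).
rewrite trmx_mul mulmxA -(mulmxA x^T) AA mulmx1 trmx_mul_sqnorm.
by move=> /matrixP/(_ 0 0); rewrite !mxE eqxx.
Qed.

Lemma sqnormZ n (a : R) (x : 'cV[R]_n) : sqnorm (a *: x) = a ^+ 2 * sqnorm x.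
Proof. by rewrite mulr_sumr; apply: eq_bigr => i _; rewrite mxE exprMn. Qed.

Lemma measurable_sqnorm d (T : measurableType d) n (f : T -> 'cV[R]_n) :
  measurable_fun setT f -> measurable_fun setT (fun t => sqnorm (f t)).
Proof.
move=> /measurable_fun_mxP mf; apply: measurable_sum => i.
by apply: measurable_funX; exact: mf.
Qed.

Lemma measurable_mulmx d (T : measurableType d) m n l
    (A : T -> 'M[R]_(m, n)) (B : T -> 'M[R]_(n, l)) :
  measurable_fun setT A -> measurable_fun setT B ->
  measurable_fun setT (fun t => A t *m B t).
Proof.
move=> /measurable_fun_mxP mA /measurable_fun_mxP mB.
apply/measurable_fun_mxP => i j; under eq_fun do rewrite mxE.
by apply: measurable_sum => k; apply: measurable_funM.
Qed.

Lemma measurable_trmx d (T : measurableType d) m n (A : T -> 'M[R]_(m, n)) :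
  measurable_fun setT A -> measurable_fun setT (fun t => (A t)^T).
Proof.
move=> /measurable_fun_mxP mA; apply/measurable_fun_mxP => i j.
by under eq_fun do rewrite mxE; exact: mA.
Qed.

Lemma measurable_scalemx d (T : measurableType d) m n (c : T -> R)
    (A : T -> 'M[R]_(m, n)) :
  measurable_fun setT c -> measurable_fun setT A ->
  measurable_fun setT (fun t => c t *: A t).
Proof.
move=> mc /measurable_fun_mxP mA; apply/measurable_fun_mxP => i j.
by under eq_fun do rewrite mxE; apply: measurable_funM.
Qed.

End sqnorm.

(** * Householder reflections *)

Section householder.
Context {R : realType} {n : nat}.
Implicit Types a b c : 'cV[R]_n.

(* The inverse is written as a real power, whose measurability is known; it
   vanishes when a = b. *)
Definition householder a b : 'M[R]_n :=
  1%:M - (2 * sqnorm (a - b) `^ (-1)) *: ((a - b) *m (a - b)^T).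

Let inv_sqnorm c : sqnorm c `^ (-1) = (sqnorm c)^-1.
Proof.
have [->|c0] := eqVneq (sqnorm c) 0; first by rewrite invr0 powR0// oppr_eq0 oner_eq0.
by rewrite powRN powRr1// sqnorm_ge0.
Qed.

Lemma householder_sym a b : (householder a b)^T = householder a b.
Proof. by rewrite /householder linearB linearZ /= trmx1 trmx_mul trmxK. Qed.

Lemma householderE a b c :
  householder a b *m c =
  c - (2 * (sqnorm (a - b))^-1 * ((a - b)^T *m c) 0 0) *: (a - b).
Proof.
rewrite /householder mulmxBl mul1mx inv_sqnorm -scalemxAl -mulmxA.
by rewrite {1}[(a - b)^T *m c]mx11_scalar mul_mx_scalar scalerA.
Qed.

Lemma householderK a b c : householder a b *m (householder a b *m c) = c.
Proof.
set u := a - b; rewrite householderE -/u.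
rewrite householderE -/u mulmxBr -scalemxAr trmx_mul_sqnorm.
move: (u^T *m c) => M; rewrite !mxE eqxx mulr1n.
have [/sqnorm_eq0P ->|u0] := eqVneq (sqnorm u) 0; first by rewrite !scaler0 !subr0.
rewrite -addrA -opprD -scalerDl; set z := (X in X *: u).
suff -> : z = 0 by rewrite scale0r subr0.
by rewrite /z; field.
Qed.

Lemma householder_orth a b : (householder a b)^T *m householder a b = 1%:M.
Proof.
rewrite householder_sym; apply/matrixP => i j.
have := householderK a b (delta_mx j 0).
by rewrite mulmxA -colE => /matrixP/(_ i 0); rewrite mxE => ->; rewrite !mxE eqxx andbT.
Qed.

Lemma householder_fix a b c : (a - b)^T *m c = 0 -> householder a b *m c = c.
Proof. by rewrite householderE => ->; rewrite mxE mulr0 scale0r subr0. Qed.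

(** With u = a - b, equality of the norms makes a + b orthogonal to u, so 2 u.a = u.(a + b) + |u|^2
    = |u|^2 and the reflection subtracts exactly u from a. If a = b the matrix is the identity. *)
Lemma householder_map a b : sqnorm a = sqnorm b -> householder a b *m a = b.
Proof.
move=> ab; rewrite householderE; set u := a - b.
have [/sqnorm_eq0P u0|u0] := eqVneq (sqnorm u) 0.
  by rewrite u0 scaler0 subr0; apply/eqP; rewrite -subr_eq0 -/u u0.
suff E : (u^T *m a) 0 0 = sqnorm u / 2.
  rewrite E (_ : 2 * _ * _ = 1); last by field.
  by rewrite scale1r /u opprB addrC subrK.
have aE v : (u^T *m v) 0 0 = \sum_i u i 0 * v i 0.
  by rewrite mxE; apply: eq_bigr => i _; rewrite mxE.
have : \sum_i (u i 0 * (a i 0 + b i 0)) = 0.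
  transitivity (sqnorm a - sqnorm b); last by rewrite ab subrr.
  rewrite -sumrB; apply: eq_bigr => i _.
  by rewrite /u !mxE; ring.
have -> : sqnorm u = (u^T *m a) 0 0 *+ 2 - \sum_i (u i 0 * (a i 0 + b i 0)).
  rewrite aE mulr2n -big_split -sumrB /=; apply: eq_bigr => i _.
  by rewrite /u !mxE; ring.
by move=> ->; rewrite subr0 -mulr_natr mulfK.
Qed.

End householder.

Lemma measurable_householder {R : realType} d (T : measurableType d) n
    (a b : T -> 'cV[R]_n) :
  measurable_fun setT a -> measurable_fun setT b ->
  measurable_fun setT (fun t => householder (a t) (b t)).
Proof.
move=> ma mb; have mab : measurable_fun setT (fun t => a t - b t).
  move/measurable_fun_mxP : ma => ma; move/measurable_fun_mxP : mb => mb.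
  apply/measurable_fun_mxP => i j; under eq_fun do rewrite !mxE.
  by apply: measurable_funB.
have -> : (fun t => householder (a t) (b t)) = fun t => 1%:M +
    (- (2 * sqnorm (a t - b t) `^ (-1))) *: ((a t - b t) *m (a t - b t)^T).
  by apply/funext => t; rewrite scaleNr.
apply: measurable_addmx; first exact: measurable_cst.
apply: measurable_scalemx; last first.
  by apply: measurable_mulmx => //; exact: measurable_trmx.
apply: measurableT_comp => //; apply: measurable_funM => //.
apply: (measurableT_comp (measurable_powR _)).
exact: measurable_sqnorm.
Qed.

(** * Measurable Gram-Schmidt and the invariant measure on the Grassmannian *)

Section gram_schmidt.
Context {R : realType} {n : nat}.
Implicit Types (w y z : 'cV[R]_n) (U : {vspace 'cV[R]_n}).

Definition unit_cV r : 'cV[R]_n := \col_i (i == r :> nat)%:R.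

Definition tail_cV r w : 'cV[R]_n := \col_i (if (i < r)%N then 0 else w i 0).

(* The state (g, r) of the orthonormalization: g is orthogonal and its first r
   columns span the vectors read so far. *)
Definition gram_schmidt_step (s : 'M[R]_n * nat) y : 'M[R]_n * nat :=
  let w := tail_cV s.2 (s.1^T *m y) in
  if sqnorm w == 0 then s
  else (s.1 *m householder (sqnorm w `^ 2^-1 *: unit_cV s.2) w, s.2.+1).

Definition gram_schmidt (ys : seq 'cV[R]_n) : 'M[R]_n * nat :=
  foldl gram_schmidt_step (1%:M, 0%N) ys.

Definition gram_schmidt_inv (s : 'M[R]_n * nat) U :=
  [/\ s.1^T *m s.1 = 1%:M, s.2 = \dim U &
   forall z, z \in U <-> forall i : 'I_n, (s.2 <= i)%N -> (s.1^T *m z) i 0 = 0].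

(** In the frame g, the vector w is the part of y orthogonal to U, so w = 0 exactly when y is in U.
    Otherwise the reflection h exchanges |w| e_r and w; both vanish in the coordinates below r, so h
    fixes the vectors supported there. Hence g h maps the first r + 1 coordinates onto U + <y>. *)
Lemma gram_schmidt_step_inv s U y : gram_schmidt_inv s U ->
  gram_schmidt_inv (gram_schmidt_step s y) (U + <[y]>)%VS.
Proof.
case: s => g r [/= gg rU gU]; rewrite /gram_schmidt_step /=.
set w := tail_cV r (g^T *m y).
have w_lt (i : 'I_n) : (i < r)%N -> w i 0 = 0 by move=> ir; rewrite mxE ir.
have w_ge (i : 'I_n) : (r <= i)%N -> w i 0 = (g^T *m y) i 0.
  by move=> ri; rewrite mxE ltnNge ri.
have yU : y \in U <-> w = 0.
  split=> [/gU yi|w0]; last by apply/gU => i ri; rewrite -w_ge// w0 mxE.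
  apply/matrixP => i j; rewrite ord1 [RHS]mxE.
  by have [/w_lt//|ri] := ltnP i r; rewrite w_ge// yi.
case: ifPn => [/eqP/sqnorm_eq0P/yU y0|w0].
  have -> : (U + <[y]>)%VS = U by apply/addv_idPl; rewrite -memvE.
  by split.
have {}yU : y \notin U by apply: contra w0 => /yU/sqnorm_eq0P ->.
have w_gt0 : 0 < sqnorm w by rewrite lt_neqAle eq_sym w0 sqnorm_ge0.
set t := sqnorm w `^ 2^-1.
have t0 : t != 0 by rewrite gt_eqF// powR_gt0.
have rn : (r < n)%N.
  rewrite ltnNge; apply: contra w0 => nr; apply/eqP/sqnorm_eq0P/matrixP => i j.
  by rewrite ord1 w_lt ?mxE// (leq_trans _ nr).
set h := householder _ _.
have hh z : h *m (h *m z) = z by exact: householderK.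
have he : h *m (t *: unit_cV r) = w.
  apply: householder_map; rewrite sqnormZ (_ : sqnorm (unit_cV r) = 1).
    by rewrite mulr1 -powR_mulrn ?powR_ge0// -powRrM mulVf ?pnatr_eq0// powRr1// ltW.
  rewrite /sqnorm (bigD1 (Ordinal rn))//= big1 ?addr0 ?mxE ?eqxx ?expr1n// => i ir.
  by rewrite mxE (_ : _ == _ = false) ?expr0n//; apply: contraNF ir => /eqP ?; exact/eqP/val_inj.
have hw : h *m w = t *: unit_cV r by rewrite -he hh.
have hfix z : (forall i : 'I_n, (r <= i)%N -> z i 0 = 0) -> h *m z = z.
  move=> zr; apply: householder_fix; apply/matrixP => i j; rewrite !ord1 mxE [RHS]mxE.
  apply: big1 => l _; have [lr|/zr ->] := ltnP l r; last by rewrite mulr0.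
  by rewrite !mxE lr ltn_eqF// mulr0 subr0 mul0r.
split.
- by rewrite trmx_mul mulmxA -(mulmxA h^T) gg mulmx1 householder_orth.
- have y0 : y != 0 by apply: contraNneq yU => ->; exact: mem0v.
  rewrite dimv_disjoint_sum; first by rewrite rU dim_vline y0 addn1.
  apply/eqP; rewrite -subv0; apply/subvP => z /memv_capP[zU /vlineP[c zc]].
  rewrite memv0 zc; have [->|c0] := eqVneq c 0; first by rewrite scale0r.
  by move: yU; rewrite -(scalerK c0 y) -zc memvZ.
- move=> z; rewrite trmx_mul householder_sym -mulmxA.
  set x := g^T *m z; rewrite -/h.
  (* Membership read in the frame g: beyond the first r coordinates, x must be a multiple of w. *)
  have -> : z \in (U + <[y]>)%VS <->
      exists c, forall i : 'I_n, (r <= i)%N -> x i 0 = c * w i 0.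
    split=> [/memv_addP[u /gU uU [_ /vlineP[c ->]] zE]|[c xc]].
      exists c => i ri; rewrite w_ge// /x zE mulmxDr -scalemxAr mxE uU// add0r.
      by rewrite [LHS]mxE.
    apply/memv_addP; exists (z - c *: y).
      apply/gU => i ri; rewrite mulmxBr -scalemxAr mxE -/x xc// w_ge//.
      by rewrite [X in _ + X]mxE [X in _ - X]mxE subrr.
    by exists (c *: y); rewrite ?subrK// memvZ// memv_line.
  clearbody x; split=> [[c xc] i ri|xr].
    have -> : h *m x = x - c *: w + (c * t) *: unit_cV r.
      rewrite -[in LHS](subrK (c *: w) x) mulmxDr -scalemxAr hw scalerA.
      by rewrite hfix// => j /xc xj; rewrite mxE xj [X in _ + X]mxE [X in _ - X]mxE subrr.
    rewrite mxE [X in X + _]mxE xc; last exact: ltnW.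
    rewrite [X in _ + X + _]mxE [X in _ - X + _]mxE subrr add0r.
    by rewrite !mxE gtn_eqF// mulr0.
  (* As h x has no coordinate beyond r, it is c e_r plus a vector fixed by h; applying h again gives
     x as that vector plus (c / t) w. *)
  exists ((h *m x) (Ordinal rn) 0 / t) => i ri.
  set c := (h *m x) _ _.
  have : x = (h *m x - c *: unit_cV r) + (c / t) *: w.
    rewrite -[LHS]hh -he -[in LHS](subrK (c *: unit_cV r) (h *m x)) mulmxDr.
    rewrite hfix -?scalemxAr ?scalerA ?divfK//.
    move=> j; rewrite leq_eqVlt => /predU1P[rj|rj].
      have -> : j = Ordinal rn by exact: val_inj.
      by rewrite !mxE eqxx mulr1 /c mxE subrr.
    by rewrite !mxE gtn_eqF// mulr0 subr0 -[RHS](xr j)// mxE.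
  move=> /matrixP/(_ i 0) ->; rewrite mxE [X in _ + X]mxE; apply/eqP.
  rewrite -subr_eq0 addrK mxE [X in _ + X]mxE [X in - X]mxE.
  move: ri; rewrite leq_eqVlt => /predU1P[rj|rj].
    have -> : i = Ordinal rn by exact: val_inj.
    by rewrite [X in _ * X]mxE eqxx mulr1 subrr.
  by rewrite [X in _ * X]mxE gtn_eqF// mulr0 subr0 xr.
Qed.

Lemma gram_schmidtP ys : gram_schmidt_inv (gram_schmidt ys) <<ys>>%VS.
Proof.
rewrite /gram_schmidt -[<<ys>>%VS]add0v.
have : gram_schmidt_inv (1%:M, 0%N) 0%VS.
  split=> /=; [by rewrite trmx1 mulmx1|by rewrite dimv0|move=> z].
  rewrite memv0 trmx1 mul1mx; split=> [/eqP -> i _|z0]; first by rewrite mxE.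
  by apply/eqP/matrixP => i j; rewrite ord1 z0// mxE.
elim: ys (1%:M, 0%N) 0%VS => [|y ys IH] s U sU; first by rewrite span_nil addv0.
by rewrite /= span_cons addvA; apply: IH; exact: gram_schmidt_step_inv.
Qed.

(** The number of input vectors is fixed, so this is a finite composition of measurable steps. The
    rank varies with t and is therefore carried as a measurable function with values in [nat]. *)
Lemma measurable_gram_schmidt d (T : measurableType d) (I : Type) (l : seq I)
    (f : I -> T -> 'cV[R]_n) : (forall i, measurable_fun setT (f i)) ->
  measurable_fun setT (fun t => (gram_schmidt [seq f i t | i <- l]).1).
Proof.
move=> mf.
suff H (s : T -> 'M[R]_n * nat) : measurable_fun setT s ->
    measurable_fun setT (fun t => foldl gram_schmidt_step (s t) [seq f i t | i <- l]).
  by apply/(measurableT_comp measurable_fst)/H; exact: measurable_cst.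
elim: l s => [|i l IH] s ms //=; apply: IH.
have ms1 : measurable_fun setT (fun t => (s t).1).
  exact: (measurableT_comp measurable_fst).
have ms2 : measurable_fun setT (fun t => (s t).2).
  exact: (measurableT_comp measurable_snd).
have mw : measurable_fun setT (fun t => tail_cV (s t).2 ((s t).1^T *m f i t)).
  apply/measurable_fun_mxP => a b; under eq_fun do rewrite mxE.
  apply: measurable_fun_ifT => //; first exact: measurable_fun_ltn.
  apply: (measurableT_comp (measurable_mx_entry a 0)).
  by apply: measurable_mulmx => //; exact: measurable_trmx.
have msw := measurable_sqnorm mw.
apply: measurable_fun_ifT => //; first exact: measurable_fun_eqr.
apply/measurable_fun_pairP; split=> /=; last first.
  exact: (@measurableT_comp _ _ _ _ _ _ succn).
apply: measurable_mulmx => //; apply: measurable_householder => //.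
apply: measurable_scalemx; first exact: (measurableT_comp (measurable_powR _)).
apply/measurable_fun_mxP => a b; under eq_fun do rewrite mxE.
apply: measurableT_comp => //.
exact: (@measurableT_comp _ _ _ _ _ _ (fun m : nat => (a == m :> nat))).
Qed.

End gram_schmidt.

(** * The orbit map of O(n), its measurable section, and feet of planes *)

Section grassmannian_orbit.
Context {R : realType} {n : nat} {k : 'I_n}.
Implicit Types (xi : grassmannian R k) (g : orthogonal_group R n).
Implicit Types (x z : 'cV[R]_n).

Lemma orthogonalE g : (val g)^T *m val g = 1%:M.
Proof. exact/eqP/(valP g). Qed.

Lemma orthogonalC g : val g *m (val g)^T = 1%:M.
Proof. exact/mulmx1C/orthogonalE. Qed.

Lemma orthogonalK g x : (val g)^T *m (val g *m x) = x.
Proof. by rewrite mulmxA orthogonalE mul1mx. Qed.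

Lemma orthogonalKV g x : val g *m ((val g)^T *m x) = x.
Proof. by rewrite mulmxA orthogonalC mul1mx. Qed.

Lemma mem_coord_space z :
  z \in coord_space k <-> forall i : 'I_n, (k <= i)%N -> z i 0 = 0.
Proof.
split=> [zk i ki|zk].
  rewrite (coord_span zk) summxE big1// => j _.
  rewrite mxE (_ : (Defs.coord_basis k)`_j = delta_mx (widen_ord (ltnW (ltn_ord k)) j) 0).
    rewrite mxE (_ : _ == _ = false) ?mulr0//.
    by apply/negbTE; apply: contraTneq ki => ->; rewrite /= -ltnNge.
  by rewrite -[LHS](tnth_nth 0 (Defs.coord_basis k) j) tnth_mktuple.
rewrite [z]matrix_sum_delta; apply: memv_suml => i _.
rewrite big_ord1; have [/zk ->|ik] := leqP k i; first by rewrite scale0r mem0v.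
apply/memvZ/memv_span; apply/mapP; exists (Ordinal ik); first by rewrite mem_enum.
by congr delta_mx; exact: val_inj.
Qed.

Lemma mem_orth_coord_space z :
  z \in orth_compl (coord_space k) <-> forall i : 'I_n, (i < k)%N -> z i 0 = 0.
Proof.
split=> [/orth_complP zk i ik|zk].
  have : (delta_mx i 0 : 'cV[R]_n) \in coord_space k.
    apply/mem_coord_space => j kj; rewrite mxE (_ : _ == _ = false)//.
    by apply/negbTE; apply: contraTneq kj => ->; rewrite -ltnNge.
  by move=> /zk; rewrite trmx_delta -rowE => /matrixP/(_ 0 0); rewrite !mxE.
apply/orth_complP => w /mem_coord_space wk; apply/matrixP => i j.
rewrite !ord1 mxE [RHS]mxE big1// => l _; rewrite mxE.
by have [/zk ->|/wk ->] := ltnP l k; rewrite ?mulr0 ?mul0r.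
Qed.

Lemma mem_grass_act g xi z :
  (z \in val (grass_act g xi)) = ((val g)^T *m z \in val xi).
Proof.
apply/memv_imgP/idP => [[w wxi ->]|gz]; first by rewrite lfunE /= orthogonalK.
by exists ((val g)^T *m z) => //; rewrite lfunE /= orthogonalKV.
Qed.

Lemma gram_schmidt_orth (ys : seq 'cV[R]_n) :
  (gram_schmidt ys).1^T *m (gram_schmidt ys).1 == 1%:M.
Proof. by apply/eqP; have [] := gram_schmidtP ys. Qed.

Definition orth_gram_schmidt ys : orthogonal_group R n :=
  exist _ (gram_schmidt ys).1 (gram_schmidt_orth ys).

(** At rank k the Gram-Schmidt invariant is precisely the description of g R^k by vanishing
    coordinates of g^T z. *)
Lemma orbit_gram_schmidt xi ys : <<ys>>%VS = val xi ->
  grass_act (orth_gram_schmidt ys) (coord_plane k) = xi.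
Proof.
move=> ysxi; apply/val_inj/vspaceP => z; rewrite mem_grass_act.
have [_ rk H] := gram_schmidtP ys.
rewrite ysxi (eqP (valP xi)) in rk.
apply/idP/idP => [/mem_coord_space zk|].
  by rewrite -ysxi; apply/H; rewrite rk.
by rewrite -ysxi => /H; rewrite rk => zk; apply/mem_coord_space.
Qed.

Lemma grass_transitive xi : exists g, xi = grass_act g (coord_plane k).
Proof.
exists (orth_gram_schmidt (vbasis (val xi))).
by rewrite (@orbit_gram_schmidt xi)// (span_basis (vbasisP _)).
Qed.

Lemma grass_actM g h xi :
  grass_act (orth_mul g h) xi = grass_act g (grass_act h xi).
Proof.
apply/val_inj/vspaceP => z.
by rewrite !mem_grass_act /= trmx_mul mulmxA.
Qed.

(** In the frame g, projecting along the direction is erasing the first k coordinates. Unlike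
    [daddv_pi], this formula is visibly measurable in g and x jointly. It holds because u in U^perp
    and x - u in U determine u. *)
Lemma translateE g x :
  val (translate (grass_act g (coord_plane k)) x) =
  (grass_act g (coord_plane k), val g *m tail_cV k ((val g)^T *m x)).
Proof.
set xi := grass_act _ _; set u := val g *m _.
have uO : u \in orth_compl (val xi).
  rewrite orth_compl_act orthogonalK; apply/mem_orth_coord_space => i ik.
  by rewrite mxE ik.
have xuxi : x - u \in val xi.
  rewrite mem_grass_act mulmxBr orthogonalK; apply/mem_coord_space => i ki.
  by rewrite mxE [X in _ + X]mxE [X in _ - X]mxE ltnNge ki subrr.
suff : daddv_pi (orth_compl (val xi)) (val xi) x = u by move=> <-.
have {uO xuxi} : u \in orth_compl (val xi) /\ x - u \in val xi by [].
move: (val xi) u => U u [uO xuU].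
have OI := orth_complI U.
have IO : (U :&: orth_compl U = 0)%VS by rewrite capvC.
suff f0 : daddv_pi (orth_compl U) U (x - u) = 0.
  have {1}-> : x = x - u + u by rewrite subrK.
  by rewrite linearD /= f0 add0r (daddv_pi_id OI uO).
have := daddv_pi_add OI (subvP (addvSr _ _) _ xuU).
rewrite (daddv_pi_id IO xuU).
by move=> /(canRL (addrK _)); rewrite subrr.
Qed.

Lemma foot_subK xi x : x - (val (translate xi x)).2 \in val xi.
Proof.
have [g ->] := grass_transitive xi; rewrite translateE mem_grass_act /=.
rewrite mulmxBr orthogonalK; apply/mem_coord_space => i ki.
by rewrite mxE [X in _ + X]mxE [X in _ - X]mxE ltnNge ki subrr.
Qed.

Lemma foot_fixed xi x : x \in val xi -> (val (translate xi x)).2 = 0.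
Proof.
have [g ->] := grass_transitive xi; rewrite translateE mem_grass_act /=.
move=> /mem_coord_space gx; rewrite (_ : tail_cV _ _ = 0) ?mulmx0//.
apply/matrixP => i j; rewrite mxE [RHS]mxE.
by have [//|/gx] := ltnP i k.
Qed.

(** The columns of the orthogonal projection onto xi. They are a redundant spanning family, but, in
    contrast to an arbitrarily chosen basis, they vary measurably with xi; the redundancy is
    harmless since Gram-Schmidt skips dependent vectors. *)
Definition direction_cols xi : seq 'cV[R]_n :=
  [seq delta_mx j 0 - (val (translate xi (delta_mx j 0))).2 | j <- enum 'I_n].

Lemma span_direction_cols xi : <<direction_cols xi>>%VS = val xi.
Proof.
apply/eqP; rewrite eqEsubv; apply/andP; split.
  by apply/span_subvP => _ /mapP[j _ ->]; exact: foot_subK.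
apply/subvP => x xxi; rewrite -[x]subr0 -(foot_fixed xxi) /=.
set f := daddv_pi _ _.
rewrite (matrix_sum_delta x) linear_sum -sumrB; apply: memv_suml => i _.
rewrite big_ord1 linearZ -scalerBr; apply/memvZ/memv_span/mapP.
by exists i => //; rewrite mem_enum.
Qed.

Definition grass_section xi : orthogonal_group R n :=
  orth_gram_schmidt (direction_cols xi).

Lemma grass_sectionK xi : grass_act (grass_section xi) (coord_plane k) = xi.
Proof. exact/orbit_gram_schmidt/span_direction_cols. Qed.

Lemma measurable_fun_orthogonal d (T : measurableType d)
    (f : T -> orthogonal_group R n) :
  measurable_fun setT (fun t => val (f t)) -> measurable_fun setT f.
Proof.
by move=> mf _ _ [B mB <-]; have := mf measurableT B mB; rewrite !setTI.
Qed.

Lemma measurable_orth_mul d (T : measurableType d)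
    (f g : T -> orthogonal_group R n) :
  measurable_fun setT f -> measurable_fun setT g ->
  measurable_fun setT (fun t => orth_mul (f t) (g t)).
Proof.
move=> mf mg; apply: measurable_fun_orthogonal => /=.
by apply: measurable_mulmx; apply: (measurableT_comp (@measurable_val_orthogonal R n)).
Qed.

Lemma measurable_tail_cV d (T : measurableType d) r (f : T -> 'cV[R]_n) :
  measurable_fun setT f -> measurable_fun setT (fun t => tail_cV r (f t)).
Proof.
move=> /measurable_fun_mxP mf; apply/measurable_fun_mxP => i j.
have [ir|ir] := boolP (i < r)%N.
  by under eq_fun do rewrite mxE ir; exact: measurable_cst.
by under eq_fun do rewrite mxE (negbTE ir); exact: mf.
Qed.

(** For the final sigma-algebra it suffices to check measurability after the orbit map, where
    [translateE] makes the columns explicit in g. *)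
Lemma measurable_grass_section : measurable_fun setT grass_section.
Proof.
apply: measurable_fun_grassP; apply: measurable_fun_orthogonal => /=.
apply: measurable_gram_schmidt => j.
pose f g := delta_mx j 0 + (-1) *: (val g *m tail_cV k ((val g)^T *m delta_mx j 0)) : 'cV[R]_n.
rewrite [X in measurable_fun _ X](_ : _ = f); last first.
  by apply/funext => g; rewrite translateE /f scaleN1r.
rewrite /f {f}.
have mv := @measurable_val_orthogonal R n.
apply: measurable_addmx => //; apply: measurable_scalemx => //.
apply: measurable_mulmx => //; apply: measurable_tail_cV.
by apply: measurable_mulmx => //; exact: measurable_trmx.
Qed.

Lemma measurable_translate_orbit d (T : measurableType d)
    (g : T -> orthogonal_group R n) (x : T -> 'cV[R]_n) :
  measurable_fun setT g -> measurable_fun setT x ->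
  measurable_fun setT (fun t => translate (grass_act (g t) (coord_plane k)) (x t)).
Proof.
move=> mg mx; apply: measurable_fun_affine_plane.
rewrite [X in measurable_fun _ X](_ : _ = fun t => (grass_act (g t) (coord_plane k),
    val (g t) *m tail_cV k ((val (g t))^T *m x t))); last first.
  by apply/funext => t; rewrite translateE.
have mv := measurableT_comp (@measurable_val_orthogonal R n) mg.
apply/measurable_fun_pairP; split => /=.
  exact: (measurableT_comp (@measurable_orbit R n k) mg).
apply: measurable_mulmx => //; apply: measurable_tail_cV.
by apply: measurable_mulmx => //; exact: measurable_trmx.
Qed.

(* Uniqueness of the invariant measure: Fubini for the set of pairs (g, xi) with
   g xi in A. The measurable section is what makes this set measurable, since
   the sigma-algebra of the Grassmannian is a quotient one. *)
Lemma invariant_grassmannianE (dg : probability (orthogonal_group R n) R)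
    (dxi : probability (grassmannian R k) R) (A : set (grassmannian R k)) :
  haar_measure dg -> orthogonal_invariant dxi -> measurable A ->
  dxi A = dg ((fun g => grass_act g (coord_plane k)) @^-1` A).
Proof.
move=> hg hxi mA; set B := _ @^-1` A.
(* Since [grass_section xi] sends R^k to xi, W is the set where g xi lies in A. Its slices at fixed
   g have mass [dxi A], and those at fixed xi have mass [dg B] by right invariance. *)
pose W := [set z : orthogonal_group R n * grassmannian R k |
  B (orth_mul z.1 (grass_section z.2))].
have mB : measurable B by rewrite -(setTI B); exact: measurable_orbit.
have mW : measurable W.
  rewrite -(setTI W); apply: measurable_orth_mul => //.
  exact: (measurableT_comp measurable_grass_section measurable_snd).
have : (dg \x dxi)%E W = (dg \x^ dxi)%E W.
  by apply: product_measure_unique => // B' C' mB' mC'; exact: product_measure2E.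
rewrite /product_measure1 /product_measure2 /=.
have -> : (\int[dg]_g (dxi \o xsection W) g = \int[dg]_g (cst (dxi A) g))%E.
  apply: eq_integral => g _ /=; rewrite -(hxi g A mA).
  congr (dxi _); apply/seteqP; split => xi; rewrite /xsection /= inE /W /B /=.
    by rewrite grass_actM grass_sectionK.
  by rewrite grass_actM grass_sectionK.
have -> : (\int[dxi]_xi (dg \o ysection W) xi = \int[dxi]_xi (cst (dg B) xi))%E.
  apply: eq_integral => xi _ /=; have [_ <-] := hg (grass_section xi) B mB.
  by congr (dg _); apply/seteqP; split => g; rewrite /ysection /= inE.
rewrite !integral_cst// => E.
have : (dxi A * dg setT = dg B * dxi setT)%E by exact: E.
by rewrite !probability_setT !mule1.
Qed.

End grassmannian_orbit.

(** * Integrals against Lebesgue measure *)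

Notation mR R := (measurableTypeR R).
Notation posR R := (`]0%R, +oo[%classic : set (measurableTypeR R)).

Section lebesgue_scaling.
Context {R : realType}.
Local Open Scope ereal_scope.

Lemma measurable_scale (c : R) :
  measurable_fun setT ((fun t => c * t)%R : mR R -> mR R).
Proof. exact: (@measurable_funM _ _ _ _ (cst c) (fun x : mR R => x)). Qed.

Lemma lebesgue_measure_scale (c : R) (A : set (mR R)) : (0 < c)%R ->
  measurable A ->
  lebesgue_measure ((fun t => c * t)%R @^-1` A) = c^-1%:E * lebesgue_measure A.
Proof.
move=> c0 mA.
pose mu := mscale (NngNum (ltW c0))
  (measure_function_pushforward__canonical__measure_function_Measure
     lebesgue_measure (measurable_scale c)).
suff -> : lebesgue_measure A = mu A.
  by rewrite /mu/= /mscale/= muleA -EFinM mulVf ?gt_eqF// mul1e.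
apply: lebesgue_measure_unique => //= _ [[a b]] _ <-.
rewrite /mu /mscale /= /pushforward (_ : _ @^-1` _ = `](a / c)%R, (b / c)%R]%classic).
  rewrite !lebesgue_measure_itv/= !lte_fin ltr_pM2r ?invr_gt0//.
  case: ifP => _; last by rewrite mule0.
  by rewrite -!EFinB -EFinM -mulrBl mulrC divfK// gt_eqF.
apply/seteqP; split => x /=; rewrite !in_itv/=.
  by rewrite ltr_pdivrMr// ler_pdivlMr// (mulrC x).
by rewrite ltr_pdivrMr// ler_pdivlMr// (mulrC x).
Qed.

Lemma ge0_integral_scale (c : R) (D : set (mR R)) (f : mR R -> \bar R) :
  (0 < c)%R -> measurable D -> measurable_fun D f ->
  (forall t, D t -> 0 <= f t) ->
  \int[lebesgue_measure]_(t in (fun t => c * t)%R @^-1` D) f (c * t)%R =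
  c^-1%:E * \int[lebesgue_measure]_(t in D) f t.
Proof.
move=> c0 mD mf f0.
have ci0 : (0 <= c^-1)%R by rewrite invr_ge0 ltW.
rewrite -[LHS](@ge0_integral_pushforward _ _ _ _ _ _ (measurable_scale c) _ D f)//; last first.
  by move=> t /[!inE]; exact: f0.
rewrite -(ge0_integral_mscale lebesgue_measure mD (NngNum ci0))//.
pose m := measure_function_pushforward__canonical__measure_function_Measure
     lebesgue_measure (measurable_scale c).
apply: (@eq_measure_integral _ _ _ _ (mscale (NngNum ci0) lebesgue_measure) m).
by move=> B mB _; exact: lebesgue_measure_scale.
Qed.

Lemma ge0_integral_scaleT (c : R) (f : mR R -> \bar R) :
  (0 < c)%R -> measurable_fun setT f -> (forall t, 0 <= f t) ->
  \int[lebesgue_measure]_t f (c * t)%R = c^-1%:E * \int[lebesgue_measure]_t f t.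
Proof. by move=> c0 mf f0; rewrite -ge0_integral_scale. Qed.

Lemma ge0_integral_scale_pos (c : R) (f : mR R -> \bar R) :
  (0 < c)%R -> measurable_fun (posR R) f ->
  (forall t, (0 < t)%R -> 0 <= f t) ->
  \int[lebesgue_measure]_(t in (posR R)) f (c * t)%R =
  c^-1%:E * \int[lebesgue_measure]_(t in (posR R)) f t.
Proof.
move=> c0 mf f0; rewrite -ge0_integral_scale//; last first.
  by move=> t /=; rewrite in_itv/= andbT; exact: f0.
congr (integral _ _ _); apply/seteqP.
by split=> t /=; rewrite !in_itv/= !andbT pmulr_rgt0.
Qed.

End lebesgue_scaling.

Section fubini_pos.
Context {R : realType} d (T : measurableType d).
Variable m : {sigma_finite_measure set T -> \bar R}.
Variable f : T * mR R -> \bar R.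
Hypothesis mf : measurable_fun setT f.
Hypothesis f0 : forall z, (0 <= f z)%E.
Local Open Scope ereal_scope.

(** Extension by 0 to t <= 0, so that Tonelli can be applied over the whole line. *)
Let g := f \_ (setT `*` (posR R)).

Let mg : measurable_fun setT g.
Proof.
apply/(measurable_restrictT _ _).1; last exact: measurable_funTS.
by apply: measurableX => //; exact: measurable_itv.
Qed.

Let g0 z : 0 <= g z.
Proof. by rewrite /g patchE; case: ifP. Qed.

Let gE x : \int[lebesgue_measure]_(t in (posR R)) f (x, t) =
  \int[lebesgue_measure]_t g (x, t).
Proof.
rewrite integral_mkcond; apply: eq_integral => t _; rewrite /g !patchE.
by congr (if _ then _ else _); apply/idP/idP; rewrite !inE/= => // -[].
Qed.

Lemma measurable_fun_integral_pos : measurable_fun setT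
  (fun x => \int[lebesgue_measure]_(t in (posR R)) f (x, t)).
Proof.
under eq_fun do rewrite gE.
exact: (measurable_fun_fubini_tonelli_F (m2 := lebesgue_measure) g).
Qed.

Lemma fubini_tonelli_pos :
  \int[m]_x \int[lebesgue_measure]_(t in (posR R)) f (x, t) =
  \int[lebesgue_measure]_(t in (posR R)) \int[m]_x f (x, t).
Proof.
under eq_integral do rewrite gE.
rewrite (fubini_tonelli (m1 := m) (m2 := lebesgue_measure) g)//.
rewrite [RHS]integral_mkcond; apply: eq_integral => t _; rewrite patchE.
case: ifPn => [/set_mem t0|t0].
  by apply: eq_integral => x _; rewrite /g patchE ifT// inE.
apply: integral0_eq => x _; rewrite /g patchE ifF//; apply/negbTE.
by apply: contra t0; rewrite !inE/= => -[].
Qed.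

End fubini_pos.

Section lebesgue_cV_integral.
Context {R : realType}.
Local Open Scope ereal_scope.

Lemma ge0_integral_cVS n (f : 'cV[R]_n.+1 -> \bar R) :
  measurable_fun setT f -> (forall x, 0 <= f x) ->
  \int[lebesgue_cV n.+1]_x f x =
  \int[lebesgue_measure]_x \int[lebesgue_cV n]_y f (cons_cV (x, y)).
Proof.
move=> mf f0.
pose m := (lebesgue_measure \x lebesgue_cV n)%E : {measure set _ -> \bar R}.
transitivity (\int[m]_z f (cons_cV z)).
  rewrite -(@ge0_integral_pushforward _ _ _ _ _ _ (@measurable_cons_cV R n) _ setT f)//.
rewrite (fubini_tonelli1 (m1 := lebesgue_measure) (m2 := lebesgue_cV n)
  (fun z => f (cons_cV z)))//.
exact: (measurableT_comp mf (@measurable_cons_cV R n)).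
Qed.

Lemma measurable_fun_cV_section n (f : 'cV[R]_n.+1 -> \bar R) :
  measurable_fun setT f -> (forall x, 0 <= f x) ->
  measurable_fun setT (fun x : mR R => \int[lebesgue_cV n]_y f (cons_cV (x, y))).
Proof.
move=> mf f0.
apply: (measurable_fun_fubini_tonelli_F (m2 := lebesgue_cV n) (fun z => f (cons_cV z))) => //.
exact: (measurableT_comp mf (@measurable_cons_cV R n)).
Qed.

Lemma cons_cVZ n (c x : R) (y : 'cV[R]_n) :
  (c *: cons_cV (x, y) = cons_cV ((c * x)%R, c *: y))%R.
Proof.
apply/matrixP => i j; rewrite ord1 mxE.
case: (unliftP 0%R i) => [l ->|->]; first by rewrite !cons_cVES mxE.
by rewrite !cons_cVE0.
Qed.

Lemma sqnorm_cons n (x : R) (y : 'cV[R]_n) :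
  (sqnorm (cons_cV (x, y)) = x ^+ 2 + sqnorm y)%R.
Proof.
rewrite /sqnorm big_ord_recl cons_cVE0; congr (_ + _)%R.
by apply: eq_bigr => i _; rewrite cons_cVES.
Qed.

Lemma measurable_scale_cV n (c : R) :
  measurable_fun setT (fun x : 'cV[R]_n => c *: x)%R.
Proof. exact: measurable_scalemx. Qed.

Lemma ge0_integral_scale_cV n (c : R) (f : 'cV[R]_n -> \bar R) :
  (0 < c)%R -> measurable_fun setT f -> (forall x, 0 <= f x) ->
  \int[lebesgue_cV n]_x f (c *: x)%R =
  ((c ^+ n)^-1)%:E * \int[lebesgue_cV n]_x f x.
Proof.
move=> c0; elim: n f => [|n IH] f mf f0.
  rewrite expr0 invr1 mul1e; apply: eq_integral => x _; congr f.
  by apply/matrixP => -[].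
have mfc := measurableT_comp mf (@measurable_scale_cV n.+1 c).
rewrite ge0_integral_cVS// ge0_integral_cVS//.
pose F (x : mR R) := \int[lebesgue_cV n]_y f (cons_cV (x, y)).
have mF : measurable_fun setT F by exact: measurable_fun_cV_section.
have F0 x : 0 <= F x by exact: integral_ge0.
transitivity (\int[lebesgue_measure]_x (((c ^+ n)^-1)%:E * F (c * x)%R)).
  apply: eq_integral => x _; rewrite -IH//.
    by apply: eq_integral => y _; rewrite cons_cVZ.
  by apply: (measurableT_comp mf); apply: (measurableT_comp (@measurable_cons_cV R n)).
rewrite -/F; move: F mF F0 => F mF F0.
have cn0 : 0 <= (c ^+ n)^-1%:E by rewrite lee_fin invr_ge0 exprn_ge0// ltW.
have mFc : measurable_fun setT (fun x : mR R => F (c * x)%R).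
  exact: (measurableT_comp mF (measurable_scale c)).
rewrite (ge0_integralZl lebesgue_measure measurableT mFc (fun x _ => F0 _) cn0).
rewrite (ge0_integral_scaleT c0 mF)// muleA -EFinM; congr (_%:E * _).
by rewrite exprS invfM mulrC.
Qed.

Lemma ge0_integral_rot n (Q : 'M[R]_n) (f : 'cV[R]_n -> \bar R) :
  (Q^T *m Q = 1%:M)%R -> measurable_fun setT f -> (forall x, 0 <= f x) ->
  \int[lebesgue_cV n]_x f (Q *m x)%R = \int[lebesgue_cV n]_x f x.
Proof.
move=> QQ mf f0.
have mQ : measurable_fun setT (mulmx Q : 'cV[R]_n -> 'cV[R]_n).
  by apply: measurable_mulmx => //; exact: measurable_id.
rewrite -[LHS](@ge0_integral_pushforward _ _ _ _ _ _ mQ _ setT f)//.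
by apply: eq_measure_integral => B mB _; exact: lebesgue_cV_rot.
Qed.

(* The coordinate embeddings of R^k onto the first k and of R^d onto the
   coordinates k + 1, ..., k + d of R^n. *)
Definition first_coords k n : 'M[R]_(n, k) := (\matrix_(i, j) (i == j :> nat)%:R)%R.
Definition last_coords k d n : 'M[R]_(n, d) :=
  (\matrix_(i, j) (i == k + j :> nat)%N%:R)%R.

Lemma first_coords_cons k n (x : R) (w : 'cV[R]_k) :
  (first_coords k.+1 n.+1 *m cons_cV (x, w) = cons_cV (x, first_coords k n *m w))%R.
Proof.
apply/matrixP => i j; rewrite ord1 mxE big_ord_recl cons_cVE0.
case: (unliftP 0%R i) => [l ->|->].
  rewrite cons_cVES !mxE mul0r add0r; apply: eq_bigr => a _.
  by rewrite cons_cVES !mxE.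
by rewrite cons_cVE0 mxE/= mul1r big1 ?addr0// => a _; rewrite mxE mul0r.
Qed.

Lemma last_coords_cons k d n (v : 'cV[R]_d) :
  (last_coords k.+1 d n.+1 *m v = cons_cV (0, last_coords k d n *m v))%R.
Proof.
apply/matrixP => i j; rewrite ord1 mxE.
case: (unliftP 0%R i) => [l ->|->].
  by rewrite cons_cVES !mxE; apply: eq_bigr => a _; rewrite !mxE.
by rewrite cons_cVE0 big1// => a _; rewrite mxE mul0r.
Qed.

Lemma measurable_coords k d n d' (T : measurableType d') (w : T -> 'cV[R]_k)
    (v : T -> 'cV[R]_d) : measurable_fun setT w -> measurable_fun setT v ->
  measurable_fun setT (fun t => first_coords k n *m w t + last_coords k d n *m v t)%R.
Proof. by move=> mw mv; apply: measurable_addmx; exact: measurable_mulmx. Qed.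

Lemma measurable_fun_split k d n (f : 'cV[R]_n -> \bar R) :
  measurable_fun setT f -> (forall x, 0 <= f x) ->
  measurable_fun setT (fun w : 'cV[R]_k => \int[lebesgue_cV d]_v
    f (first_coords k n *m w + last_coords k d n *m v)%R).
Proof.
move=> mf f0.
apply: (measurable_fun_fubini_tonelli_F (m2 := lebesgue_cV d) (fun z : 'cV[R]_k * 'cV[R]_d =>
    f (first_coords k n *m z.1 + last_coords k d n *m z.2)%R)) => //.
by apply: (measurableT_comp mf); apply: measurable_coords.
Qed.

(** The dimensions are linked by an equation instead of a type of the form k + d, so that d can be n
    - k without casts of matrices. *)
Lemma ge0_integral_split k d n (f : 'cV[R]_n -> \bar R) : (n = k + d)%N ->
  measurable_fun setT f -> (forall x, 0 <= f x) ->
  \int[lebesgue_cV n]_x f x = \int[lebesgue_cV k]_w \int[lebesgue_cV d]_v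
    f (first_coords k n *m w + last_coords k d n *m v)%R.
Proof.
elim: k n f => [|k IH] n f nkd mf f0.
  rewrite add0n in nkd; subst n.
  rewrite /= integral_dirac//; last exact: measurable_fun_split.
  rewrite diracE in_setT mul1e; apply: eq_integral => x _; congr f; rewrite mulmx0 add0r.
  rewrite (_ : last_coords _ _ _ = 1%:M)%R ?mul1mx//.
  by apply/matrixP => i j; rewrite !mxE.
case: n nkd f mf f0 => // n [nkd] f mf f0.
have mfw (x : R) : measurable_fun setT (fun y : 'cV[R]_n => f (cons_cV (x, y))).
  by apply: (measurableT_comp mf); apply: (measurableT_comp (@measurable_cons_cV R n)).
rewrite ge0_integral_cVS// [RHS]ge0_integral_cVS/=.
- apply: eq_integral => x _; rewrite (IH n)//.
  apply: eq_integral => w _; apply: eq_integral => v _.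
  by rewrite first_coords_cons last_coords_cons cons_cVD addr0.
- exact: measurable_fun_split.
- by move=> w; exact: integral_ge0.
Qed.

Lemma sqnorm_coords k d n (w : 'cV[R]_k) (v : 'cV[R]_d) : (n = k + d)%N ->
  (sqnorm (first_coords k n *m w + last_coords k d n *m v) = sqnorm w + sqnorm v)%R.
Proof.
elim: k n w => [|k IH] n w nkd.
  rewrite add0n in nkd; subst n.
  rewrite (_ : first_coords _ _ *m w = 0)%R ?add0r; last first.
    by apply/matrixP => i j; rewrite !mxE big_ord0.
  rewrite (_ : last_coords _ _ _ = 1%:M)%R ?mul1mx; last first.
    by apply/matrixP => i j; rewrite !mxE.
  by rewrite [sqnorm w]big_ord0 add0r.
case: n nkd => // n [nkd]; rewrite -(uncons_cVK w).
case: (uncons_cV w) => x w'.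
by rewrite first_coords_cons last_coords_cons cons_cVD addr0 !sqnorm_cons IH// addrA.
Qed.

End lebesgue_cV_integral.

(** * Convergence of the Gamma integral *)

Section gamma.
Context {R : realType}.
Local Open Scope ereal_scope.
Let mu := @lebesgue_measure R.

Lemma measurable_posR : measurable (posR R).
Proof. exact: measurable_itv. Qed.

Lemma in_posR (t : R) : t \in posR R = (0 < t)%R.
Proof. by apply/idP/idP; rewrite inE/= in_itv/= andbT. Qed.

Lemma measurable_powR_EFin (a : R) (D : set (mR R)) :
  measurable_fun D (fun t : mR R => (t `^ a)%:E).
Proof.
by apply/measurable_EFinP/measurable_funTS; exact: measurable_powR.
Qed.

(** The primitive t^s / s on intervals exhausting ]0, 1] bounds the integral by 1 / s. Positivity
    and finiteness are enough later, as this integral cancels when the norms of the truncated powers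
    are compared. *)
Lemma integral_powR_01 (s : R) : (0 < s)%R ->
  0 < \int[mu]_(t in (`]0%R, 1%R]%classic : set (mR R))) (t `^ (s - 1))%:E < +oo.
Proof.
move=> s0.
(* Starting at 1/2 keeps every interval nondegenerate, so the first one already gives positivity. *)
pose F (i : nat) : set (mR R) := `[(i.+2%:R^-1)%R, 1%R]%classic.
have i2 (i : nat) : (0 < (i.+2%:R^-1 : R) < 1)%R by rewrite invr_gt0 ltr0n/= invf_lt1// ltr1n.
have intF i : \int[mu]_(t in F i) (t `^ (s - 1))%:E =
    (s^-1 - s^-1 * i.+2%:R^-1 `^ s)%:E.
  have /andP[i0 i1] := i2 i.
  have dF (x : R) : (0 < x)%R -> is_derive x 1%R (fun t : R => s^-1 * t `^ s)%R (x `^ (s - 1))%R.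
    move=> x0; have <- : (s^-1 * (s * x `^ (s - 1)) = x `^ (s - 1))%R.
      by rewrite mulrA mulVf ?gt_eqF// mul1r.
    exact: (@is_deriveZ R R R (fun t : R => t `^ s)%R s^-1%R x 1%R _ (is_derive1_powR s x0)).
  have cF (x : R) : (0 < x)%R -> {for x, continuous (fun t : R => s^-1 * t `^ s)%R}.
    move=> x0; apply: differentiable_continuous; apply/derivable1_diffP.
    by have [] := dF x x0.
  rewrite (@continuous_FTC2 _ _ (fun t : R => s^-1 * t `^ s)%R)//.
  - by rewrite powR1 mulr1 EFinB.
  - apply: continuous_in_subspaceT => x; rewrite inE/= in_itv/= => /andP[xi _].
    apply: differentiable_continuous; apply/derivable1_diffP.
    by have [] := is_derive1_powR (s - 1) (lt_le_trans i0 xi).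
  - split.
    + move=> x; rewrite in_itv/= => /andP[xi _].
      by have [] := dF x (lt_trans i0 xi).
    + exact/cvg_at_right_filter/cF.
    + exact/cvg_at_left_filter/cF.
  - move=> x; rewrite in_itv/= => /andP[xi _].
    by have [_ <-] := dF x (lt_trans i0 xi); rewrite derive1E.
have UF : \bigcup_i F i = `]0%R, 1%R]%classic.
  apply/seteqP; split=> [x [i _]|x]; rewrite /F/= !in_itv/= => /andP[xi x1].
    by rewrite x1 andbT (lt_le_trans _ xi)//; case/andP: (i2 i).
  have [i _] := (near_infty_natSinv_lt (PosNum (xi : 0 < x)%R)).
  move=> /(_ i (leqnn _))/= ix; exists i => //; rewrite /F/= in_itv/= x1 andbT.
  by apply: le_trans (ltW ix); rewrite lef_pV2 ?posrE// ler_nat.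
have mF i : measurable (F i) by exact: measurable_itv.
apply/andP; split.
  apply: (@lt_le_trans _ _ (\int[mu]_(t in F 0%N) (t `^ (s - 1))%:E)).
    rewrite intF lte_fin subr_gt0 gtr_pMr ?invr_gt0//.
    have : ((2%:R^-1 : R) `^ s < 1 `^ s)%R.
      by apply: gt0_ltr_powR; rewrite ?nnegrE//; case/andP: (i2 0%N).
    by rewrite powR1.
  apply: ge0_subset_integral => //; first exact: measurable_powR_EFin.
    by move=> t _; rewrite lee_fin powR_ge0.
  by rewrite -UF; exact: bigcup_sup.
apply: (@le_lt_trans _ _ (s^-1)%:E); last by rewrite ltry.
rewrite -UF.
have h : \int[mu]_(t in F i) (t `^ (s - 1))%:E @[i --> \oo] -->
    \int[mu]_(t in \bigcup_i F i) (t `^ (s - 1))%:E.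
  apply: (@ge0_nondecreasing_set_cvg_integral _ _ _ F (fun t => (t `^ (s - 1))%:E) mu) => //.
  - move=> i j ij; apply/subsetPset => x; rewrite /F/= !in_itv/= => /andP[xi ->].
    by rewrite andbT (le_trans _ xi)// lef_pV2 ?posrE// ler_nat.
  - by move=> i; exact: measurable_powR_EFin.
  - by move=> i x _; rewrite lee_fin powR_ge0.
rewrite -(cvg_lim _ h)//; apply: lime_le; first exact: (cvgP _ h).
apply: nearW => i; rewrite intF lee_fin gerBl mulr_ge0 ?powR_ge0//.
by rewrite invr_ge0 ltW.
Qed.

(** [Gamma] is the [fine] part of this integral and would be 0 if it diverged, so convergence has to
    be shown in the extended reals. *)
Definition egamma (s : R) :=
  \int[mu]_(t in posR R) (t `^ (s - 1) * expR (- t))%:E.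

Lemma measurable_gamma_fun (s c : R) (D : set (mR R)) :
  measurable_fun D (fun t : mR R => (t `^ s * expR (- (c * t)))%:E).
Proof.
apply/measurable_EFinP/measurable_funTS; apply: measurable_funM.
  exact: measurable_powR.
apply: (@measurableT_comp _ _ _ _ _ _ (@expR R)) => //.
by apply: (@measurableT_comp _ _ _ _ _ _ (@GRing.opp R)).
Qed.

Lemma egamma_gt0_lty (s : R) : (0 < s)%R -> 0 < egamma s < +oo.
Proof.
move=> s0; have /andP[p0 poo] := integral_powR_01 s0.
have mg D : measurable_fun D (fun t : mR R => (t `^ (s - 1) * expR (- t))%:E).
  by have := @measurable_gamma_fun (s - 1) 1 D; under eq_fun do rewrite mul1r.
have g0 (t : mR R) : 0 <= (t `^ (s - 1) * expR (- t))%:E.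
  by rewrite lee_fin mulr_ge0 ?powR_ge0 ?expR_ge0.
have m01 : measurable (`]0%R, 1%R]%classic : set (mR R)) by exact: measurable_itv.
have m1y : measurable (`]1%R, +oo[%classic : set (mR R)) by exact: measurable_itv.
apply/andP; split.
  apply: (@lt_le_trans _ _ (\int[mu]_(t in (`]0%R, 1%R]%classic : set (mR R)))
      ((expR (-1))%:E * (t `^ (s - 1))%:E))).
    rewrite (ge0_integralZl mu m01 (@measurable_powR_EFin _ _)) ?lee_fin ?expR_ge0//; last first.
      by move=> t _; rewrite lee_fin powR_ge0.
    by rewrite mule_gt0// lte_fin expR_gt0.
  apply: (@le_trans _ _ (\int[mu]_(t in (`]0%R, 1%R]%classic : set (mR R)))
      (t `^ (s - 1) * expR (- t))%:E)).
    apply: ge0_le_integral => //.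
    - by move=> t _; rewrite mule_ge0// lee_fin ?expR_ge0 ?powR_ge0.
    - by apply: measurable_funeM; exact: measurable_powR_EFin.
    - move=> t /=; rewrite in_itv/= => /andP[t0 t1].
      by rewrite -EFinM lee_fin mulrC ler_wpM2l ?powR_ge0// ler_expR lerN2.
  apply: ge0_subset_integral => //.
  by move=> t; rewrite /= !in_itv/= => /andP[->].
rewrite /egamma (_ : posR R = `]0%R, 1%R]%classic `|` `]1%R, +oo[%classic); last first.
  apply/seteqP; split=> t /=; rewrite !in_itv/= !andbT.
    by move=> t0; rewrite t0/=; have [t1|t1] := leP t 1%R; [left|right].
  by case=> [/andP[]//|]; exact: lt_trans.
rewrite ge0_integral_setU//; last first.
  apply/disj_setPS => t /= []; rewrite !in_itv/= andbT => /andP[_].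
  by move=> /le_lt_trans/[apply]; rewrite ltxx.
apply: lte_add_pinfty.
  apply: le_lt_trans poo; apply: ge0_le_integral => //.
    exact: measurable_powR_EFin.
  move=> t /=; rewrite in_itv/= => /andP[t0 t1].
  by rewrite lee_fin ler_piMr ?powR_ge0// -expR0 ler_expR oppr_le0 ltW.
(* For t > 1, t^(s - 1) <= t^(m + 1) <= C exp(t / 2) by one term of the exponential series, so the
   integrand is at most C exp(- t / 2), which is 2 C times the exponential density of rate 1/2. *)
pose m := Num.bound s.
pose C : R := (2 ^+ m.+1 * m.+1`!%:R)%R.
have C0 : (0 <= C)%R by rewrite mulr_ge0// exprn_ge0.
apply: (@le_lt_trans _ _ (\int[mu]_t ((C * 2)%:E * (exponential_pdf 2^-1 t)%:E))).
  apply: (@le_trans _ _ (\int[mu]_(t in (`]1%R, +oo[%classic : set (mR R)))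
      ((C * 2)%:E * (exponential_pdf 2^-1 t)%:E))).
    apply: ge0_le_integral => //.
    - apply/measurable_funeM/measurable_EFinP/measurable_funTS.
      exact: measurable_exponential_pdf.
    - move=> t /=; rewrite in_itv/= andbT => t1.
      have t0 : (0 <= t)%R by rewrite (le_trans ler01)// ltW.
      rewrite -EFinM lee_fin /exponential_pdf patchE ifT; last first.
        by rewrite inE/= in_itv/= t0.
      rewrite [leRHS](_ : _ = C * expR (- (2^-1 * t)))%R; last first.
        by rewrite mulNr; field.
      have -> : expR (- t) = (expR (- (2^-1 * t)) * expR (- (2^-1 * t)))%R :> R.
        by rewrite -expRD; congr expR; field.
      rewrite mulrA ler_wpM2r ?expR_ge0//.
      rewrite expRN ler_pdivrMr ?expR_gt0//.
      apply: (@le_trans _ _ (t ^+ m.+1)%R).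
        rewrite -powR_mulrn// ler_powR ?(ltW t1)//.
        by rewrite lerBlDr -natr1 (le_trans (ltW (archi_boundP (ltW s0))))// -addrA lerDl.
      have := @expR_ge1Dxn _ (2^-1 * t)%R m (mulr_ge0 _ t0).
      rewrite invr_ge0 ler0n => /(_ isT); move=> /(le_trans _) => h.
      have {}h : ((2^-1 * t) ^+ m.+1 / m.+1`!%:R <= expR (2^-1 * t))%R.
        by apply: h; rewrite lerDr.
      rewrite -[leLHS](_ : C * ((2^-1 * t) ^+ m.+1 / m.+1`!%:R) = _)%R.
        by rewrite ler_wpM2l.
      rewrite exprMn exprVn /C; field.
      by rewrite !expf_neq0//= pnatr_eq0 -lt0n fact_gt0.
  apply: ge0_subset_integral => //.
    by apply/measurable_funeM/measurable_EFinP; exact: measurable_exponential_pdf.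
  by move=> t _; rewrite -EFinM lee_fin; apply: mulr_ge0; rewrite ?exponential_pdf_ge0// mulr_ge0.
rewrite ge0_integralZl//; last 3 first.
- by apply/measurable_EFinP; exact: measurable_exponential_pdf.
- by move=> t _; rewrite lee_fin exponential_pdf_ge0.
- by rewrite lee_fin mulr_ge0.
by rewrite integral_exponential_pdf ?invr_gt0// mule1 ltry.
Qed.

Lemma Gamma_gt0 (s : R) : (0 < s)%R -> (0 < Gamma s)%R.
Proof. by move=> s0; rewrite /Gamma /Rintegral fine_gt0// egamma_gt0_lty. Qed.

Lemma egammaE (s : R) : (0 < s)%R -> egamma s = (Gamma s)%:E.
Proof.
move=> s0; rewrite /Gamma /Rintegral fineK//.
have /andP[g0 goo] := egamma_gt0_lty s0.
by rewrite ge0_fin_numE// ltW.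
Qed.

End gamma.

(** * Gaussian integrals and scaling on R^n *)

Section gaussian_radial.
Context {R : realType}.
Local Open Scope ereal_scope.
Let mu := @lebesgue_measure R.

Lemma measurable_sqnormT n : measurable_fun setT (@sqnorm R n).
Proof. exact: (@measurable_sqnorm _ _ _ _ id). Qed.

Lemma gt0_powRD (x r s : R) : (0 < x)%R -> (x `^ (r + s) = x `^ r * x `^ s)%R.
Proof. by move=> x0; rewrite powRD// (gt_eqF x0) implybT. Qed.

Lemma integral_gamma_scaled (a c : R) : (0 < a)%R -> (0 < c)%R ->
  \int[mu]_(t in posR R) (t `^ (a - 1) * expR (- (c * t)))%:E =
  (c `^ (- a) * Gamma a)%:E.
Proof.
move=> a0 c0; rewrite EFinM -egammaE// /egamma.
have mg : measurable_fun (posR R) (fun t : mR R => (t `^ (a - 1) * expR (- t))%:E).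
  have := @measurable_gamma_fun R (a - 1)%R 1%R (posR R).
  by congr (measurable_fun _ _); apply/funext => t; rewrite mul1r.
have g0 (t : mR R) : 0 <= (t `^ (a - 1) * expR (- t))%:E.
  by rewrite lee_fin mulr_ge0 ?powR_ge0 ?expR_ge0.
have mgc : measurable_fun (posR R)
    (fun t : mR R => ((c * t) `^ (a - 1) * expR (- (c * t)))%:E).
  apply/measurable_EFinP/measurable_funTS; apply: measurable_funM.
    exact: (measurableT_comp (measurable_powR _) (measurable_scale c)).
  apply: (@measurableT_comp _ _ _ _ _ _ (@expR R)) => //.
  apply: (@measurableT_comp _ _ _ _ _ _ (@GRing.opp R)) => //.
transitivity (\int[mu]_(t in posR R) ((c `^ (1 - a))%:E *
    ((c * t) `^ (a - 1) * expR (- (c * t)))%:E)).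
  apply: eq_integral => t; rewrite in_posR => t0.
  rewrite -EFinM mulrA (powRM _ (ltW c0) (ltW t0)) mulrA -gt0_powRD//.
  by rewrite addrA subrK subrr powRr0 mul1r.
rewrite ge0_integralZl ?lee_fin ?powR_ge0//.
rewrite (@ge0_integral_scale_pos _ c (fun t => (t `^ (a - 1) * expR (- t))%:E))//.
rewrite muleA -EFinM; congr (_%:E * _).
by rewrite -[(c^-1)%R]powR_inv1 ?ltW// -gt0_powRD// addrAC subrr add0r.
Qed.

Lemma measurable_gaussian n (c : R) :
  measurable_fun setT (fun x : 'cV[R]_n => (expR (- (c * sqnorm x)))%:E).
Proof.
apply/measurable_EFinP.
apply: (@measurableT_comp _ _ _ _ _ _ (@expR R)) => //.
apply: (@measurableT_comp _ _ _ _ _ _ (@GRing.opp R)) => //.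
apply: measurable_funM => //; exact: measurable_sqnormT.
Qed.

Lemma integral_gaussian n :
  \int[lebesgue_cV n]_x (expR (- sqnorm x))%:E = (pi `^ (n%:R / 2))%:E :> \bar R.
Proof.
have mg m : measurable_fun setT (fun x : 'cV[R]_m => (expR (- sqnorm x))%:E).
  have := @measurable_gaussian m 1%R.
  by congr (measurable_fun _ _); apply/funext => x; rewrite mul1r.
have e0 (x : R) : 0 <= (expR x)%:E by rewrite lee_fin expR_ge0.
elim: n => [|n IH].
  rewrite mul0r powRr0 /= integral_dirac//; last exact: (mg 0%N).
  by rewrite diracE in_setT mul1e [sqnorm _]big_ord0 oppr0 expR0.
rewrite (@ge0_integral_cVS _ n (fun x => (expR (- sqnorm x))%:E))//.
transitivity (\int[mu]_x ((pi `^ (n%:R / 2))%:E * (gauss_fun x)%:E)).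
  apply: eq_integral => x _.
  rewrite -IH muleC -ge0_integralZl ?lee_fin ?gauss_fun_ge0//; last exact: (mg n).
  by apply: eq_integral => y _; rewrite sqnorm_cons opprD expRD EFinM.
rewrite ge0_integralZl ?lee_fin ?powR_ge0//; last first.
- by move=> x _; rewrite lee_fin gauss_fun_ge0.
- by apply/measurable_EFinP; exact: measurable_gauss_fun.
rewrite integralT_gauss -EFinM -powR12_sqrt ?pi_ge0// -gt0_powRD ?pi_gt0//.
by congr (_ `^ _)%:E; rewrite -(natr1 n) mulrDl mul1r.
Qed.

Lemma powR_half_sqr (s : R) : (0 < s)%R -> ((s `^ 2^-1) ^+ 2 = s)%R.
Proof. by move=> s0; rewrite -powR_mulrn ?powR_ge0// -powRrM mulVf// powRr1// ltW. Qed.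

Lemma powR_halfX n (s : R) : (0 < s)%R -> ((s `^ 2^-1) ^+ n = s `^ (n%:R / 2))%R.
Proof. by move=> s0; rewrite -powR_mulrn ?powR_ge0// -powRrM mulrC. Qed.

Lemma ge0_integral_sqnorm_scale n (s : R) (f : mR R -> \bar R) : (0 < s)%R ->
  measurable_fun setT f -> (forall t, 0 <= f t) ->
  \int[lebesgue_cV n]_x f (s * sqnorm x)%R =
  (s `^ (- (n%:R / 2)))%:E * \int[lebesgue_cV n]_x f (sqnorm x).
Proof.
move=> s0 mf f0.
rewrite powRN -powR_halfX// -ge0_integral_scale_cV ?powR_gt0//.
- by apply: eq_integral => x _; rewrite sqnormZ powR_half_sqr.
- exact: (measurableT_comp mf (@measurable_sqnormT n)).
Qed.

Lemma integral_gaussian_scaled n (s : R) : (0 < s)%R ->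
  \int[lebesgue_cV n]_x (expR (- (s * sqnorm x)))%:E =
  (s `^ (- (n%:R / 2)) * pi `^ (n%:R / 2))%:E.
Proof.
move=> s0; rewrite EFinM -integral_gaussian.
rewrite -(@ge0_integral_sqnorm_scale n s (fun t : mR R => (expR (- t))%:E))//.
apply/measurable_EFinP.
by apply: (@measurableT_comp _ _ _ _ _ _ (@expR R)).
Qed.

(** The set {0} is invariant under x |-> 2 x, so its measure m satisfies m = 2^-n m; it is finite,
    as {0} lies in the unit ball, hence 0 for n > 0. *)
Lemma lebesgue_cV_sqnorm0 n : (0 < n)%N ->
  {ae lebesgue_cV n, forall x : 'cV[R]_n, sqnorm x != 0%R}.
Proof.
move=> n0; have mZ : measurable [set x : 'cV[R]_n | sqnorm x = 0%R].
  rewrite [X in measurable X](_ : _ = setT `&` sqnorm @^-1` [set 0%R]).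
    by apply: measurable_sqnormT.
  by rewrite setTI.
exists [set x : 'cV[R]_n | sqnorm x = 0%R]; split=> //; last first.
  by move=> x /= /negP; rewrite negbK => /eqP.
set Z := [set x | _]; set m := lebesgue_cV n Z.
have mE : m = \int[lebesgue_cV n]_x (\1_Z x)%:E by rewrite integral_indic// setIT.
have : m = ((2 ^+ n)^-1)%:E * m.
  rewrite {2}mE -(@ge0_integral_scale_cV _ n 2 (fun x => (\1_Z x)%:E))//.
    rewrite mE; apply: eq_integral => x _; rewrite !indicE.
    congr (_%:R)%:E; congr (nat_of_bool _).
    apply/idP/idP; rewrite !inE /Z /= sqnormZ; first by move=> ->; rewrite mulr0.
    by move=> /eqP; rewrite mulf_eq0 expf_eq0 pnatr_eq0 andbF/= => /eqP.
  by apply/measurable_EFinP; exact: measurable_indic.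
have : m < +oo.
  have /andP[_] := @lebesgue_cV_unit_ball R n; apply: le_lt_trans.
  apply: le_measure; rewrite ?inE//; first exact: measurable_unit_ball.
  by move=> x; rewrite /Z/= /unit_ball /= sqnormE -/(sqnorm x) => ->.
have : 0 <= m by exact: measure_ge0.
case: m {mE} => // r r0 _ /eqP; rewrite -EFinM eqe => /eqP rE.
congr EFin; apply/eqP; move: rE => /eqP; rewrite -subr_eq0 -{1}(mul1r r) -mulrBl mulf_eq0.
rewrite subr_eq0 eq_sym invr_eq1 gt_eqF//.
by rewrite exprn_egt1// ?ltr1n// -lt0n.
Qed.

End gaussian_radial.

(** * Integrals of radial functions *)

Section radial.
Context {R : realType}.
Local Open Scope ereal_scope.
Let mu := @lebesgue_measure R.

(* Fubini on R^n x ]0, oo[ for t^-1 exp(- |x|^2 / t) f(t): integrating in x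
   first gives the right-hand side, substituting t |-> t |x|^2 and integrating
   in x by scaling gives D times the left-hand integral. The constant D is
   identified with Gamma(n / 2) by taking f(t) = exp(- t). *)
Lemma integral_radial n (f : mR R -> \bar R) : (0 < n)%N ->
  measurable_fun setT f -> (forall t, 0 <= f t) ->
  (Gamma (n%:R / 2))%:E * \int[lebesgue_cV n]_x f (sqnorm x) =
  (pi `^ (n%:R / 2))%:E * \int[mu]_(t in posR R) ((t `^ (n%:R / 2 - 1))%:E * f t).
Proof.
move=> n0 mf f0; pose h : R := (n%:R / 2)%R.
have h0 : (0 < h)%R by rewrite divr_gt0// ltr0n.
have mpow (a : R) : measurable_fun setT (fun t : mR R => (t `^ a)%:E).
  exact: measurable_powR_EFin.
pose D := \int[mu]_(t in posR R)
  ((t `^ (-1) * expR (- t `^ (-1)))%:E * (t `^ (- h))%:E).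
have mexp d (T : measurableType d) (g : T -> mR R) : measurable_fun setT g ->
    measurable_fun setT (fun z => expR (- g z)).
  move=> mg; apply: (@measurableT_comp _ _ _ _ _ _ (@expR R)) => //.
  exact: (@measurableT_comp _ _ _ _ _ _ (@GRing.opp R)).
have key (g : mR R -> \bar R) : measurable_fun setT g -> (forall t, 0 <= g t) ->
    D * \int[lebesgue_cV n]_x g (sqnorm x) =
    (pi `^ h)%:E * \int[mu]_(t in posR R) ((t `^ (h - 1))%:E * g t).
  move=> mg g0.
  pose G (z : 'cV[R]_n * mR R) :=
    (z.2 `^ (-1) * expR (- (z.2 `^ (-1) * sqnorm z.1)))%:E * g z.2.
  pose H (z : 'cV[R]_n * mR R) :=
    (z.2 `^ (-1) * expR (- z.2 `^ (-1)))%:E * g (z.2 * sqnorm z.1)%R.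
  have mp2 : measurable_fun setT (fun z : 'cV[R]_n * mR R => z.2 `^ (-1))%R.
    exact: (measurableT_comp (measurable_powR (-1)) measurable_snd).
  have mN1 : measurable_fun setT (fun z : 'cV[R]_n * mR R => sqnorm z.1).
    exact: (measurableT_comp (@measurable_sqnormT R n) measurable_fst).
  have mG : measurable_fun setT G.
    apply: emeasurable_funM; last exact: (measurableT_comp mg measurable_snd).
    apply/measurable_EFinP; apply: measurable_funM => //; apply: mexp.
    exact: measurable_funM.
  have mH : measurable_fun setT H.
    apply: emeasurable_funM.
      by apply/measurable_EFinP; apply: measurable_funM => //; exact: mexp.
    by apply: (measurableT_comp mg); exact: measurable_funM.
  have G0 z : 0 <= G z by rewrite mule_ge0// lee_fin mulr_ge0 ?powR_ge0 ?expR_ge0.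
  have H0 z : 0 <= H z by rewrite mule_ge0// lee_fin mulr_ge0 ?powR_ge0 ?expR_ge0.
  transitivity (\int[lebesgue_cV n]_x \int[mu]_(t in posR R) H (x, t)).
    rewrite fubini_tonelli_pos// /D muleC -ge0_integralZl//; last 3 first.
    - apply: emeasurable_funM; last exact: measurable_funTS.
      apply/measurable_EFinP/measurable_funTS; apply: measurable_funM.
        exact: measurable_powR.
      by apply: mexp; exact: measurable_powR.
    - by move=> t _; rewrite mule_ge0// lee_fin ?mulr_ge0 ?powR_ge0 ?expR_ge0.
    - exact: integral_ge0.
    apply: eq_integral => t; rewrite in_posR => t0.
    rewrite /H /= ge0_integralZl//; last 2 first.
    - apply: (measurableT_comp mg); apply: measurable_funM => //.
      exact: measurable_sqnormT.
    - by rewrite lee_fin mulr_ge0 ?powR_ge0 ?expR_ge0.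
    by rewrite ge0_integral_sqnorm_scale// muleC -!muleA.
  transitivity (\int[lebesgue_cV n]_x \int[mu]_(t in posR R) G (x, t)).
    apply: ge0_ae_eq_integral => //.
    - exact: measurable_fun_integral_pos.
    - exact: measurable_fun_integral_pos.
    - by move=> x _; exact: integral_ge0.
    - by move=> x _; exact: integral_ge0.
    (* The substitution t |-> t |x|^2 requires x != 0, which holds almost everywhere. *)
    apply: filterS (lebesgue_cV_sqnorm0 n0) => x x0 _.
    have {}x0 : (0 < sqnorm x)%R by rewrite lt_neqAle eq_sym x0 sqnorm_ge0.
    have mGx : measurable_fun setT (fun t : mR R => G (x, t)).
      exact: (measurableT_comp mG (measurable_pair1 x)).
    rewrite -[RHS]mul1e -[1](_ : (sqnorm x)%:E * ((sqnorm x)^-1)%:E = _); last first.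
      by rewrite -EFinM divff ?gt_eqF.
    rewrite -muleA -(@ge0_integral_scale_pos _ (sqnorm x) (fun t => G (x, t)))//; last first.
      by apply: measurable_funTS; exact: mGx.
    have mGs : measurable_fun (posR R) (fun t : mR R => G (x, (sqnorm x * t)%R)).
      apply: measurable_funTS.
      exact: (measurableT_comp mGx (measurable_scale (sqnorm x))).
    rewrite -(ge0_integralZl mu (@measurable_posR R) mGs (fun t _ => G0 _)); last first.
      by rewrite lee_fin ltW.
    apply: eq_integral => t; rewrite in_posR => t0; rewrite /H /G /= muleA -EFinM.
    rewrite !powR_inv1 ?mulr_ge0 ?(ltW t0) ?(ltW x0)//.
    rewrite (mulrC t); congr (_%:E * _); rewrite mulrA invfM mulrA divff ?gt_eqF// mul1r.
    by rewrite -mulrA mulrCA mulVf ?gt_eqF// mulr1.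
  rewrite fubini_tonelli_pos// -ge0_integralZl//; last 3 first.
  - by apply: emeasurable_funM; exact: measurable_funTS.
  - by move=> t _; rewrite mule_ge0// lee_fin powR_ge0.
  - by rewrite lee_fin powR_ge0.
  apply: eq_integral => t; rewrite in_posR => t0; rewrite /G /=.
  have ti0 : (0 < t `^ (-1))%R by rewrite powR_gt0.
  rewrite ge0_integralZr//; last 2 first.
  - apply/measurable_EFinP; apply: measurable_funM => //.
    by apply: mexp; apply: measurable_funM => //; exact: measurable_sqnormT.
  - by move=> x _; rewrite lee_fin mulr_ge0 ?powR_ge0 ?expR_ge0.
  rewrite muleA; congr (_ * _).
  under eq_integral do rewrite EFinM.
  rewrite (ge0_integralZl _ measurableT (@measurable_gaussian R n (t `^ (-1)))); last 2 first.
  - by move=> x _; rewrite lee_fin expR_ge0.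
  - by rewrite lee_fin powR_ge0.
  rewrite integral_gaussian_scaled// -!EFinM -/h; congr EFin.
  rewrite mulrA -powRrM -gt0_powRD// mulrC; congr (_ * _ `^ _)%R.
  by ring.
rewrite -key//; congr (_ * _).
have mE : measurable_fun setT (fun t : mR R => (expR (- t))%:E).
  by apply/measurable_EFinP; exact: mexp.
have E0 (t : mR R) : 0 <= (expR (- t))%:E by rewrite lee_fin expR_ge0.
have := key _ mE E0; rewrite integral_gaussian.
under [in RHS]eq_integral do rewrite -EFinM.
rewrite -[X in _ = _ * X]/(egamma h) egammaE//.
have D0 : 0 <= D.
  by apply: integral_ge0 => t _; rewrite -EFinM lee_fin !mulr_ge0 ?powR_ge0 ?expR_ge0.
have p0 : (0 < pi `^ h :> R)%R by rewrite powR_gt0// pi_gt0.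
(* D could be infinite a priori; D pi^h = pi^h Gamma(h) with a finite right-hand side excludes
   this. *)
case: D {key} D0 => [r _||//]; last by rewrite mulyr gtr0_sg// mul1e.
by rewrite -!EFinM => -[]; rewrite -/h mulrC => /(mulfI (lt0r_neq0 p0)) ->.
Qed.

(* Gamma(b) s^-b = \int_0^oo t^(b - 1) exp(- s t) dt reduces this to a Gaussian
   integral in w. *)
Lemma integral_riesz k (b t : R) : (k%:R / 2 < b)%R -> (0 < t)%R ->
  \int[lebesgue_cV k]_w ((sqnorm w + t) `^ (- b))%:E =
  (pi `^ (k%:R / 2) * (Gamma (b - k%:R / 2) / Gamma b) * t `^ (k%:R / 2 - b))%:E.
Proof.
move=> kb t0; set h := (k%:R / 2)%R in kb *.
have b0 : (0 < b)%R by apply: le_lt_trans kb; rewrite divr_ge0.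
have G0 := Gamma_gt0 b0.
pose F (z : 'cV[R]_k * mR R) :=
  (z.2 `^ (b - 1) * expR (- ((sqnorm z.1 + t) * z.2)))%:E.
have F0 z : 0 <= F z by rewrite lee_fin mulr_ge0 ?powR_ge0 ?expR_ge0.
have mN1 : measurable_fun setT (fun z : 'cV[R]_k * mR R => sqnorm z.1).
  exact: (measurableT_comp (@measurable_sqnormT R k) measurable_fst).
have mF : measurable_fun setT F.
  apply/measurable_EFinP; apply: measurable_funM.
    exact: (measurableT_comp (measurable_powR _) measurable_snd).
  apply: (@measurableT_comp _ _ _ _ _ _ (@expR R)) => //.
  apply: (@measurableT_comp _ _ _ _ _ _ (@GRing.opp R)) => //.
  by apply: measurable_funM => //; exact: measurable_funD.
have st0 (w : 'cV[R]_k) : (0 < sqnorm w + t)%R by rewrite ltr_wpDl// sqnorm_ge0.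
transitivity ((Gamma b)^-1%:E * \int[lebesgue_cV k]_w \int[mu]_(s in posR R) F (w, s)).
  rewrite -ge0_integralZl//; last 3 first.
  - exact: measurable_fun_integral_pos.
  - by move=> w _; exact: integral_ge0.
  - by rewrite lee_fin invr_ge0 ltW.
  apply: eq_integral => w _; rewrite /F /= integral_gamma_scaled// -EFinM.
  by rewrite mulrC mulfK ?gt_eqF.
rewrite fubini_tonelli_pos//.
have -> : \int[mu]_(s in posR R) \int[lebesgue_cV k]_w F (w, s) =
    \int[mu]_(s in posR R) ((pi `^ h)%:E * (s `^ (b - h - 1) * expR (- (t * s)))%:E).
  apply: eq_integral => s; rewrite in_posR => s0.
  transitivity (\int[lebesgue_cV k]_w ((s `^ (b - 1) * expR (- (t * s)))%:E *
      (expR (- (s * sqnorm w)))%:E)).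
    apply: eq_integral => w _; rewrite /F /= -EFinM -mulrA -expRD.
    by congr (_ * expR _)%:E; ring.
  rewrite (ge0_integralZl _ measurableT (@measurable_gaussian R k s)); last 2 first.
  - by move=> w _; rewrite lee_fin expR_ge0.
  - by rewrite lee_fin mulr_ge0 ?powR_ge0 ?expR_ge0.
  rewrite integral_gaussian_scaled// -!EFinM -/h; congr EFin.
  rewrite [(b - h - 1)%R](_ : _ = (b - 1) - h)%R; last by ring.
  rewrite [in RHS]gt0_powRD//; ring.
rewrite (ge0_integralZl _ (@measurable_posR R)
  (@measurable_gamma_fun R (b - h - 1) t (posR R))); last 2 first.
- by move=> s _; rewrite lee_fin mulr_ge0 ?powR_ge0 ?expR_ge0.
- by rewrite lee_fin powR_ge0.
rewrite integral_gamma_scaled ?subr_gt0// -!EFinM opprB; congr EFin.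
by ring.
Qed.

End radial.

Lemma ge0_integral_pushforward_prod {R : realType} d1 d2 d3
    (T1 : measurableType d1) (T2 : measurableType d2) (T3 : measurableType d3)
    (m1 : {sigma_finite_measure set T1 -> \bar R})
    (m2 : {sigma_finite_measure set T2 -> \bar R})
    (F : T1 * T2 -> T3) (phi : T3 -> \bar R) :
  measurable_fun setT F -> measurable_fun setT phi -> (forall t, 0 <= phi t)%E ->
  (\int[pushforward (m1 \x m2) F]_t phi t =
   \int[m1]_x \int[m2]_y phi (F (x, y)))%E.
Proof.
move=> mF mphi phi0; rewrite (ge0_integral_pushforward mF)//.
exact: (fubini_tonelli1 (m1 := m1) (m2 := m2) (phi \o F)
  (measurableT_comp mphi mF) (fun=> phi0 _)).
Qed.

(** * The measure on affine planes and the duality of R_k and R_k^* *)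

Section planes.
Context {R : realType} {n : nat} {k : 'I_n}.
Implicit Types (g : orthogonal_group R n) (x : 'cV[R]_n).
Local Open Scope ereal_scope.

Notation plane g x := (translate (grass_act g (coord_plane k)) x).
Notation A := (first_coords k n : 'M[R]_(n, k)).
Notation B := (last_coords k (n - k) n : 'M[R]_(n, n - k)).

Definition foot_sqnorm (tau : affine_plane R k) : R := sqnorm (val tau).2.

Let nkd : (n = k + (n - k))%N.
Proof. by rewrite subnKC// ltnW. Qed.

Lemma tail_coords (w : 'cV[R]_k) (v : 'cV[R]_(n - k)) :
  tail_cV k (A *m w + B *m v)%R = (B *m v)%R.
Proof.
apply/matrixP => i j; rewrite ord1 !mxE; have [ik|ki] := ltnP i k.
  rewrite big1// => l _; rewrite mxE ltn_eqF ?mul0r//.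
  by rewrite (leq_trans ik)// leq_addr.
rewrite big1 ?add0r// => l _; rewrite mxE gtn_eqF ?mul0r//.
by rewrite (leq_trans (ltn_ord l)).
Qed.

Lemma tail_last_coords (v : 'cV[R]_(n - k)) : tail_cV k (B *m v)%R = (B *m v)%R.
Proof. by have := tail_coords 0 v; rewrite mulmx0 add0r. Qed.

Lemma sqnorm_last_coords (v : 'cV[R]_(n - k)) : sqnorm (B *m v)%R = sqnorm v.
Proof.
have := sqnorm_coords (0 : 'cV[R]_k) v nkd.
have -> : sqnorm (0 : 'cV[R]_k) = 0%R by apply/sqnorm_eq0P.
by rewrite mulmx0 !add0r.
Qed.

Lemma last_coords_isometry : (B^T *m B = 1%:M)%R.
Proof.
apply/matrixP => i j; rewrite !mxE.
have ki : (k + i < n)%N by rewrite -ltn_subRL.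
rewrite (bigD1 (Ordinal ki))//= !mxE eqxx mul1r big1 ?addr0 ?eqn_add2l//.
move=> l li; rewrite !mxE (_ : _ == _ = false) ?mul0r//.
apply: contraNF li => /eqP li. exact/eqP/val_inj.
Qed.

Lemma orth_frame_last_coords : orth_frame (coord_plane k) B.
Proof.
split; first exact: last_coords_isometry.
move=> u; split=> [/mem_orth_coord_space uk|[v ->]].
  exists (\col_i u (cast_ord (esym nkd) (rshift k i)) 0%R)%R.
  apply/matrixP => i j; rewrite ord1 mxE.
  have [ik|ki] := ltnP i k.
    rewrite uk// big1// => l _; rewrite mxE ltn_eqF ?mul0r//.
    by rewrite (leq_trans ik)// leq_addr.
  have ikd : (i - k < n - k)%N by rewrite ltn_sub2r// (leq_ltn_trans ki).
  rewrite (bigD1 (Ordinal ikd))//= !mxE /= subnKC// eqxx mul1r big1 ?addr0.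
    by congr (u _ _); apply: val_inj; rewrite /= subnKC.
  move=> l li; rewrite !mxE (_ : _ == _ = false) ?mul0r//.
  apply: contraNF li => /eqP li; apply/eqP/val_inj => /=.
  by rewrite li addKn.
apply/mem_orth_coord_space => i ik.
by rewrite -tail_last_coords mxE ik.
Qed.

Lemma plane_coords g (w : 'cV[R]_k) (v : 'cV[R]_(n - k)) :
  plane g (val g *m (A *m w + B *m v))%R = plane g (val g *m (B *m v))%R.
Proof.
by apply: val_inj; rewrite !translateE !orthogonalK tail_coords tail_last_coords.
Qed.

Lemma foot_sqnorm_plane g x : foot_sqnorm (plane g x) = sqnorm (tail_cV k ((val g)^T *m x)).
Proof.
by rewrite /foot_sqnorm translateE /= sqnorm_isometry// orthogonalE.
Qed.

Lemma foot_sqnorm_coords g (v : 'cV[R]_(n - k)) :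
  foot_sqnorm (plane g (val g *m (B *m v))%R) = sqnorm v.
Proof.
by rewrite foot_sqnorm_plane orthogonalK tail_last_coords sqnorm_last_coords.
Qed.

Lemma measurable_foot_sqnorm : measurable_fun setT foot_sqnorm.
Proof.
apply: measurable_sqnorm; apply: (measurableT_comp measurable_snd).
by move=> _ Y mY; rewrite setTI; exists Y => //; rewrite setTI.
Qed.

Lemma measurable_plane_coords : measurable_fun setT
  (fun z : orthogonal_group R n * 'cV[R]_(n - k) => plane z.1 (val z.1 *m (B *m z.2))%R).
Proof.
apply: measurable_translate_orbit => //; apply: measurable_mulmx.
  exact: (measurableT_comp (@measurable_val_orthogonal R n) measurable_fst).
exact: measurable_mulmx.
Qed.

Lemma measurable_plane2 : measurable_fun setT
  (fun z : 'cV[R]_n * orthogonal_group R n => plane z.2 z.1).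
Proof. exact: measurable_translate_orbit. Qed.

Section haar.
Variables (dg : probability (orthogonal_group R n) R).
Variable dxi : probability (grassmannian R k) R.
Hypothesis hdg : haar_measure dg.
Hypothesis hdxi : orthogonal_invariant dxi.

(** [invariant_grassmannianE] replaces [dxi] by [dg], and [perp_frame_act] replaces the frame of g
    R^k by g times the frame of R^k, so [dtau] is an image of a product measure. *)
Lemma plane_measureE (Y : set (affine_plane R k)) : measurable Y ->
  plane_measure dxi Y = (dg \x lebesgue_cV (n - k))%E
    ((fun z => plane z.1 (val z.1 *m (perp_frame (coord_plane k) *m z.2))%R) @^-1` Y).
Proof.
move=> mY; pose m := measure_function_pushforward__canonical__measure_function_Measure
  dg (@measurable_orbit R n k).
pose Phi xi := lebesgue_perp xi (translate xi @^-1` Y).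
have mPhi : measurable_fun setT Phi by exact: measurable_lebesgue_perp_translate.
rewrite /plane_measure.
transitivity (\int[m]_xi Phi xi).
  apply: (@eq_measure_integral _ _ _ _ m dxi) => C mC _.
  exact: invariant_grassmannianE.
rewrite [LHS](@ge0_integral_pushforward _ _ _ _ _ _ (@measurable_orbit R n k) _ setT Phi)//.
rewrite /product_measure1 /=; apply: eq_integral => g _ /=.
rewrite /Phi perp_frame_act; last first.
  by rewrite -[X in measurable X]setTI; exact: measurable_translate.
by congr (lebesgue_cV _ _); apply/seteqP; split=> v; rewrite /xsection /= inE.
Qed.

(** The frame picked by [xget] is B Q with Q orthogonal, and rotation invariance in R^(n - k)
    absorbs Q. Planes are thereby parametrised by pairs (g, v) with explicit coordinates. *)
Lemma ge0_integral_plane_measure (phi : affine_plane R k -> \bar R) :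
  measurable_fun setT phi -> (forall tau, 0 <= phi tau) ->
  \int[plane_measure dxi]_tau phi tau =
  \int[dg]_g \int[lebesgue_cV (n - k)]_v phi (plane g (val g *m (B *m v))%R).
Proof.
move=> mphi phi0; pose P : 'M[R]_(n, n - k) := perp_frame (coord_plane k).
have [Q QQ PE] := orth_frame_uniq orth_frame_last_coords
  (xgetI 0%R orth_frame_last_coords : orth_frame (coord_plane k) P).
pose F (z : orthogonal_group R n * 'cV[R]_(n - k)) := plane z.1 (val z.1 *m (P *m z.2))%R.
have mF : measurable_fun setT F.
  apply: measurable_translate_orbit => //; apply: measurable_mulmx.
    exact: (measurableT_comp (@measurable_val_orthogonal R n) measurable_fst).
  exact: measurable_mulmx.
pose m := measure_function_pushforward__canonical__measure_function_Measure
  (dg \x lebesgue_cV (n - k))%E mF.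
transitivity (\int[m]_tau phi tau).
  by apply: eq_measure_integral => C mC _; exact: plane_measureE.
rewrite [LHS](ge0_integral_pushforward_prod dg (lebesgue_cV (n - k)) mF mphi phi0).
apply: eq_integral => g _.
rewrite -(@ge0_integral_rot _ _ Q (fun v => phi (plane g (val g *m (B *m v))%R)))//; last first.
  exact: (measurableT_comp mphi (measurableT_comp measurable_plane_coords (measurable_pair1 g))).
by apply: eq_integral => v _; rewrite /F /= PE !mulmxA.
Qed.

(* The two orders of integration over the pairs (x, tau) with x in tau; the
   points of tau at distance |w| from its foot have squared norm
   |w|^2 + |tau|^2. *)
Lemma plane_duality (h : mR R -> \bar R) (phi : affine_plane R k -> \bar R) :
  measurable_fun setT h -> (forall t, 0 <= h t) ->
  measurable_fun setT phi -> (forall tau, 0 <= phi tau) ->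
  \int[lebesgue_cV n]_x (h (sqnorm x) * \int[dg]_g phi (plane g x)) =
  \int[plane_measure dxi]_tau
    (phi tau * \int[lebesgue_cV k]_w h (sqnorm w + foot_sqnorm tau)%R).
Proof.
move=> mh h0 mphi phi0.
have mp2 := measurableT_comp mphi measurable_plane2.
have mhN : measurable_fun setT (fun x : 'cV[R]_n => h (sqnorm x)).
  exact: (measurableT_comp mh (@measurable_sqnormT R n)).
pose G (z : 'cV[R]_n * orthogonal_group R n) := h (sqnorm z.1) * phi (plane z.2 z.1).
have mG : measurable_fun setT G.
  apply: emeasurable_funM => //.
  exact: (measurableT_comp mhN measurable_fst).
have G0 z : 0 <= G z by rewrite mule_ge0.
transitivity (\int[lebesgue_cV n]_x \int[dg]_g G (x, g)).
  apply: eq_integral => x _; rewrite -ge0_integralZl//.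
  exact: (measurableT_comp mp2 (measurable_pair1 x)).
rewrite (fubini_tonelli (m1 := lebesgue_cV n) (m2 := dg) G)//.
have mHw : measurable_fun setT (fun z : affine_plane R k * 'cV[R]_k =>
    h (sqnorm z.2 + foot_sqnorm z.1)%R).
  apply: (measurableT_comp mh); apply: measurable_funD.
    exact: (measurableT_comp (@measurable_sqnormT R k) measurable_snd).
  exact: (measurableT_comp measurable_foot_sqnorm measurable_fst).
rewrite ge0_integral_plane_measure; last 2 first.
- apply: emeasurable_funM => //.
  exact: (measurable_fun_fubini_tonelli_F (m2 := lebesgue_cV k) _ mHw (fun=> h0 _)).
- by move=> tau; rewrite mule_ge0// integral_ge0.
apply: eq_integral => g _.
have mGg : measurable_fun setT (fun x => G (x, g)).
  exact: (measurableT_comp mG (measurable_pair2 g)).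
(* Write x = g (A w + B v): the plane of direction g R^k through x depends on v alone, and |x|^2 =
   |w|^2 + |v|^2. *)
rewrite -(ge0_integral_rot (orthogonalE g))//.
have mg : measurable_fun setT (fun x : 'cV[R]_n => val g *m x)%R.
  exact: measurable_mulmx.
have mGgg := measurableT_comp mGg mg.
rewrite (ge0_integral_split nkd mGgg)//=.
pose K (z : 'cV[R]_k * 'cV[R]_(n - k)) :=
  G ((val g *m (A *m z.1 + B *m z.2))%R, g).
have mK : measurable_fun setT K.
  by apply: (measurableT_comp mGgg); apply: measurable_coords.
rewrite [LHS](fubini_tonelli (m1 := lebesgue_cV k) (m2 := lebesgue_cV (n - k)) K mK (fun=> G0 _)).
apply: eq_integral => v _; rewrite muleC -ge0_integralZr//; last first.
  apply: (measurableT_comp mh); apply: measurable_funD => //.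
  exact: measurable_sqnormT.
apply: eq_integral => w _; rewrite /K /G /= plane_coords foot_sqnorm_coords.
by rewrite sqnorm_isometry ?orthogonalE// sqnorm_coords.
Qed.

Lemma ae_foot_sqnorm : {ae plane_measure dxi, forall tau, foot_sqnorm tau != 0%R}.
Proof.
have d0 : (0 < n - k)%N by rewrite subn_gt0.
pose Z := foot_sqnorm @^-1` [set 0%R].
have mZ : measurable Z.
  by rewrite -(setTI Z); apply: measurable_foot_sqnorm.
exists Z; split=> //; last by move=> tau /= /negP; rewrite negbK => /eqP.
transitivity (\int[plane_measure dxi]_tau (\1_Z tau)%:E).
  by rewrite integral_indic// setIT.
rewrite ge0_integral_plane_measure//; last first.
  by apply/measurable_EFinP; exact: measurable_indic.
apply: integral0_eq => g _.
transitivity (\int[lebesgue_cV (n - k)]_v (\1_[set v | sqnorm v = 0%R] v)%:E : \bar R).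
  apply: eq_integral => v _; rewrite !indicE; congr (nat_of_bool _)%:R%:E.
  by apply/idP/idP; rewrite !inE /Z /= foot_sqnorm_coords.
rewrite integral_indic// ?setIT; last first.
  rewrite -[X in measurable X]setTI.
  by apply: (@measurable_sqnormT R (n - k) measurableT [set 0%R]).
have [N [mN N0 sN]] := @lebesgue_cV_sqnorm0 R _ d0.
apply/eqP; rewrite -measure_le0 -N0; apply: le_measure; rewrite ?inE//.
  rewrite -[X in measurable X]setTI.
  by apply: (@measurable_sqnormT R (n - k) measurableT [set 0%R]).
by move=> v /= v0; apply: sN => /=; rewrite v0 eqxx.
Qed.

(** Transfers null sets of planes to almost every point, which makes R_k^* well defined on classes
    of functions. Apply the duality to h = 1 and the indicator of a null set N: the integral of h
    over R^k may be infinite, but off N it is multiplied by 0, and 0 times infinity is 0. *)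
Lemma ae_plane (P : set (affine_plane R k)) :
  {ae plane_measure dxi, forall tau, P tau} ->
  {ae lebesgue_cV n, forall x, {ae dg, forall g, P (plane g x)}}.
Proof.
move=> [N [mN N0 sN]].
have m1 : measurable_fun setT (fun tau => (\1_N tau)%:E : \bar R).
  by apply/measurable_EFinP; exact: measurable_indic.
have i0 tau : 0 <= (\1_N tau)%:E :> \bar R by rewrite lee_fin.
have := @plane_duality (cst 1) _ _ _ m1 i0.
have m1x : measurable_fun setT (fun x => \int[dg]_g (\1_N (plane g x))%:E).
  exact: (measurable_fun_fubini_tonelli_F (m2 := dg) _ (measurableT_comp m1 measurable_plane2) (fun=> i0 _)).
rewrite [X in _ -> _ -> _ = X](_ : _ = 0); last first.
  have -> : 0 = \int[plane_measure dxi]_tau (cst 0 tau) by rewrite integral0.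
  apply: ge0_ae_eq_integral => //.
  - apply: emeasurable_funM; first exact: m1.
    exact: (measurable_cst (\int[lebesgue_cV k]_w cst 1 w)).
  - by move=> tau _; rewrite mule_ge0// integral_ge0.
  exists N; split=> // tau /= h; apply: contrapT => tN; apply: h => _.
  by rewrite indicE memNset// mul0e.
move=> /(_ (measurable_cst _) (fun=> lee01)) E.
have : {ae lebesgue_cV n, forall x, \int[dg]_g (\1_N (plane g x))%:E = 0}.
  have E' : \int[lebesgue_cV n]_x `| \int[dg]_g (\1_N (plane g x))%:E | = 0.
    rewrite -[RHS]E; apply: eq_integral => x _.
    by rewrite mul1e gee0_abs// integral_ge0.
  have := (ae_eq_integral_abs _ measurableT m1x).1 E'.
  by apply: filterS => x /(_ I).
apply: filterS => x Ex.
have mNx : measurable ((fun g => plane g x) @^-1` N).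
  rewrite -[X in measurable X]setTI.
  exact: (measurableT_comp measurable_plane2 (measurable_pair1 x)).
exists ((fun g => plane g x) @^-1` N); split=> //; last first.
  by move=> g /= Pg; exact: sN.
rewrite -Ex -[X in dg X]setIT -integral_indic//.
Qed.

End haar.
End planes.

(** * Averages over O(n) of powers of the distance to the foot *)

Section haar_mean.
Context {R : realType} {n : nat} {k : 'I_n}.
Implicit Types (g : orthogonal_group R n) (x : 'cV[R]_n).
Local Open Scope ereal_scope.
Notation plane g x := (translate (grass_act g (coord_plane k)) x).

(** This is |P g^T e_1|^2, the squared distance to the origin of g R^k + e_1; [unit_cV] counts
    coordinates from 0. *)
Definition tail_ratio g : R := sqnorm (tail_cV k ((val g)^T *m unit_cV 0)).

Lemma measurable_tail_ratio : measurable_fun setT tail_ratio.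
Proof.
apply: measurable_sqnorm; apply: measurable_tail_cV; apply: measurable_mulmx => //.
by apply: measurable_trmx; exact: measurable_val_orthogonal.
Qed.

Lemma sqnorm_unit_cV0 : sqnorm (unit_cV 0 : 'cV[R]_n) = 1%R.
Proof.
have n0 : (0 < n)%N by exact: leq_trans (ltn_ord k).
rewrite /sqnorm (bigD1 (Ordinal n0))//= big1 ?addr0 ?mxE ?eqxx ?expr1n// => i i0.
rewrite mxE (_ : _ == _ = false) ?expr0n//.
by apply: contraNF i0 => /eqP i0; exact/eqP/val_inj.
Qed.

Lemma sqnorm_tail_le r x : (sqnorm (tail_cV r x) <= sqnorm x)%R.
Proof.
apply: ler_sum => i _; rewrite mxE; case: ifP => // _.
by rewrite expr0n sqr_ge0.
Qed.

Lemma tail_ratio_ge0 g : (0 <= tail_ratio g)%R.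
Proof. exact: sqnorm_ge0. Qed.

Lemma tail_ratio_le1 g : (tail_ratio g <= 1)%R.
Proof.
rewrite -sqnorm_unit_cV0; apply: le_trans (sqnorm_tail_le _ _) _.
by rewrite sqnorm_isometry// trmxK orthogonalC.
Qed.

Variable dg : probability (orthogonal_group R n) R.
Hypothesis hdg : haar_measure dg.

(* By invariance the law of |P g^T x|^2 depends on x only through |x|. *)
Lemma haar_mean (f : mR R -> \bar R) x :
  measurable_fun setT f -> (forall t, 0 <= f t) ->
  \int[dg]_g f (foot_sqnorm (plane g x)) =
  \int[dg]_g f (sqnorm x * tail_ratio g)%R.
Proof.
move=> mf f0; pose t := (sqnorm x `^ 2^-1)%R.
have t2 : (t ^+ 2 = sqnorm x)%R.
  by rewrite -powR_mulrn ?powR_ge0// -powRrM mulVf// powRr1// sqnorm_ge0.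
(* H maps |x| e_1 to x and is symmetric, so g^T x = |x| (H g)^T e_1; left invariance of [dg] then
   removes H. *)
pose H := householder (t *: unit_cV 0 : 'cV[R]_n)%R x.
have HH : (H^T *m H == 1%:M)%R by apply/eqP/householder_orth.
pose h : orthogonal_group R n := exist _ H HH.
have Hx : (H *m (t *: unit_cV 0) = x)%R.
  by apply: householder_map; rewrite sqnormZ sqnorm_unit_cV0 mulr1.
have E g : (foot_sqnorm (plane g x) = sqnorm x * tail_ratio (orth_mul h g))%R.
  rewrite foot_sqnorm_plane /tail_ratio /= -t2 -sqnormZ -[in LHS]Hx; congr sqnorm.
  rewrite trmx_mul householder_sym -/H -mulmxA -!scalemxAr.
  by apply/matrixP => i j; rewrite !mxE; case: ifP; rewrite ?mulr0.
under eq_integral do rewrite E.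
have mh : measurable_fun setT (orth_mul h).
  exact: (measurable_orth_mul (measurable_cst h) (@measurable_id _ _ _)).
pose F g := f (sqnorm x * tail_ratio g)%R.
have mF : measurable_fun setT F.
  apply: (measurableT_comp mf); apply: measurable_funM => //.
  exact: measurable_tail_ratio.
have F0 g : 0 <= F g by exact: f0.
rewrite -[LHS](@ge0_integral_pushforward _ _ _ _ _ _ mh dg setT F)//.
pose m := measure_function_pushforward__canonical__measure_function_Measure dg mh.
apply: (@eq_measure_integral _ _ _ _ dg m) => A mA _.
by have [] := hdg h mA.
Qed.

Variable dxi : probability (grassmannian R k) R.
Hypothesis hdxi : orthogonal_invariant dxi.

Lemma integral_foot_sqnorm (f : mR R -> \bar R) :
  measurable_fun setT f -> (forall t, 0 <= f t) ->
  \int[plane_measure dxi]_tau f (foot_sqnorm tau) =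
  \int[lebesgue_cV (n - k)]_v f (sqnorm v).
Proof.
move=> mf f0; rewrite (ge0_integral_plane_measure hdg hdxi)//; last first.
  exact: (measurableT_comp mf measurable_foot_sqnorm).
under eq_integral do under eq_integral do rewrite foot_sqnorm_coords.
by rewrite integral_cst//= probability_setT mule1.
Qed.

Lemma integral_power_gaussian m (a : R) : (0 < m)%N -> (a < m%:R)%R ->
  \int[lebesgue_cV m]_v (expR (- sqnorm v) * sqnorm v `^ (- a / 2))%:E =
  (pi `^ (m%:R / 2) * Gamma ((m%:R - a) / 2) / Gamma (m%:R / 2) : R)%:E.
Proof.
move=> m0 am; have G0 : (0 < Gamma (m%:R / 2 : R))%R.
  by rewrite Gamma_gt0// divr_gt0// ltr0n.
pose f (t : mR R) := (expR (- t) * t `^ (- a / 2))%:E.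
have mf : measurable_fun setT f.
  apply/measurable_EFinP; apply: measurable_funM; last exact: measurable_powR.
  by apply: (@measurableT_comp _ _ _ _ _ _ (@expR R)).
have f0 t : 0 <= f t by rewrite lee_fin mulr_ge0 ?expR_ge0 ?powR_ge0.
have := integral_radial m0 mf f0.
have -> : \int[lebesgue_measure]_(t in posR R) ((t `^ (m%:R / 2 - 1))%:E * f t) =
    (Gamma ((m%:R - a) / 2))%:E.
  rewrite -egammaE ?divr_gt0 ?subr_gt0//; apply: eq_integral => t.
  rewrite in_posR => t0; rewrite /f -EFinM mulrCA mulrC -gt0_powRD//.
  by congr (_ `^ _ * _)%:E; field.
set X := \int[_]_v _; have X0 : 0 <= X by exact: integral_ge0.
case: X X0 => [r _||//]; last by rewrite gt0_muley ?lte_fin.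
rewrite -!EFinM => -[/(canRL (mulKf (lt0r_neq0 G0))) ->]; congr EFin.
by rewrite mulrC.
Qed.

(** Take exp(- |x|^2) and |tau|^-a in the duality. By homogeneity the side over R^n is the unknown
    mean times the integral of exp(- |x|^2) |x|^-a; the side over planes is pi^(k/2) times the same
    integral over R^d. Both integrals are known and the mean is their quotient. *)
Lemma haar_mean_power (a : R) : (a < (n - k)%:R)%R ->
  \int[dg]_g (tail_ratio g `^ (- a / 2))%:E =
  (Gamma (n%:R / 2) * Gamma (((n - k)%:R - a) / 2) /
   (Gamma ((n - k)%:R / 2) * Gamma ((n%:R - a) / 2)) : R)%:E.
Proof.
move=> ad; set d := (n - k)%N in ad *.
have d0 : (0 < d)%N by rewrite subn_gt0.
have n0 : (0 < n)%N by exact: leq_trans (ltn_ord k).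
have nkd : (n%:R = k%:R + d%:R :> R)%R by rewrite -natrD subnKC// ltnW.
have an : (a < n%:R)%R by rewrite nkd (lt_le_trans ad)// lerDr.
pose h (t : mR R) := (expR (- t))%:E : \bar R.
have mh : measurable_fun setT h.
  by apply/measurable_EFinP; apply: (@measurableT_comp _ _ _ _ _ _ (@expR R)).
have h0 t : 0 <= h t by rewrite lee_fin expR_ge0.
pose pw (t : mR R) := (t `^ (- a / 2))%:E : \bar R.
have mpw : measurable_fun setT pw by exact: measurable_powR_EFin.
have pw0 t : 0 <= pw t by rewrite lee_fin powR_ge0.
have mphi : measurable_fun setT (fun tau : affine_plane R k => pw (foot_sqnorm tau)).
  exact: (measurableT_comp mpw measurable_foot_sqnorm).
have := plane_duality hdg hdxi mh h0 mphi (fun=> pw0 _).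
set c := \int[dg]_g _.
have c0 : 0 <= c by apply: integral_ge0 => g _; rewrite lee_fin powR_ge0.
have mtr : measurable_fun setT (fun g => (tail_ratio g `^ (- a / 2))%:E).
  exact: (measurableT_comp mpw measurable_tail_ratio).
have cE x : \int[dg]_g pw (foot_sqnorm (plane g x)) = (sqnorm x `^ (- a / 2))%:E * c.
  rewrite haar_mean// /c -(ge0_integralZl dg measurableT mtr); last 2 first.
  - by move=> g _; rewrite lee_fin powR_ge0.
  - by rewrite lee_fin powR_ge0.
  by apply: eq_integral => g _; rewrite /pw powRM ?sqnorm_ge0 ?tail_ratio_ge0// EFinM.
clearbody c.
have mE m : measurable_fun setT (fun x : 'cV[R]_m =>
    (expR (- sqnorm x) * sqnorm x `^ (- a / 2))%:E).
  apply/measurable_EFinP; apply: measurable_funM.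
    by apply/measurable_EFinP; apply: (measurableT_comp mh); exact: measurable_sqnormT.
  by apply: (measurableT_comp (measurable_powR _)); exact: measurable_sqnormT.
have E0 m (x : 'cV[R]_m) : 0 <= (expR (- sqnorm x) * sqnorm x `^ (- a / 2))%:E.
  by rewrite lee_fin mulr_ge0 ?expR_ge0 ?powR_ge0.
have -> : \int[lebesgue_cV n]_x (h (sqnorm x) * \int[dg]_g pw (foot_sqnorm (plane g x))) =
    c * \int[lebesgue_cV n]_x (expR (- sqnorm x) * sqnorm x `^ (- a / 2))%:E.
  rewrite -(ge0_integralZl _ measurableT (mE n) (fun x _ => E0 n x) c0).
  by apply: eq_integral => x _; rewrite cE EFinM muleA muleC.
have -> : \int[plane_measure dxi]_tau (pw (foot_sqnorm tau) *
      \int[lebesgue_cV k]_w h (sqnorm w + foot_sqnorm tau)%R) =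
    (pi `^ (k%:R / 2))%:E *
    \int[lebesgue_cV d]_v (expR (- sqnorm v) * sqnorm v `^ (- a / 2))%:E.
  have mf : measurable_fun setT (fun t : mR R => (expR (- t) * t `^ (- a / 2))%:E).
    apply/measurable_EFinP; apply: measurable_funM; last exact: measurable_powR.
    by apply/measurable_EFinP.
  have f0 (t : mR R) : 0 <= (expR (- t) * t `^ (- a / 2))%:E.
    by rewrite lee_fin mulr_ge0 ?expR_ge0 ?powR_ge0.
  rewrite -(@integral_foot_sqnorm (fun t => (expR (- t) * t `^ (- a / 2))%:E))//.
  rewrite -ge0_integralZl ?lee_fin ?powR_ge0//; last first.
    exact: (measurableT_comp mf measurable_foot_sqnorm).
  apply: eq_integral => tau _; rewrite /h.
  under eq_integral do rewrite opprD expRD EFinM muleC.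
  have mg : measurable_fun setT (fun w : 'cV[R]_k => (expR (- sqnorm w))%:E).
    have := @measurable_gaussian R k 1%R.
    by congr (measurable_fun _ _); apply/funext => x; rewrite mul1r.
  rewrite (ge0_integralZl _ measurableT mg); last 2 first.
  - by move=> x _; rewrite lee_fin expR_ge0.
  - by rewrite lee_fin expR_ge0.
  rewrite integral_gaussian /pw -!EFinM; congr EFin; ring.
rewrite !integral_power_gaussian//.
have Gn : (0 < Gamma (n%:R / 2 : R))%R by rewrite Gamma_gt0// divr_gt0// ltr0n.
have Gd : (0 < Gamma (d%:R / 2 : R))%R by rewrite Gamma_gt0// divr_gt0// ltr0n.
have Ga : (0 < Gamma ((n%:R - a) / 2 : R))%R.
  by rewrite Gamma_gt0// divr_gt0// subr_gt0.
have -> : (pi `^ (n%:R / 2) = pi `^ (k%:R / 2) * pi `^ (d%:R / 2) :> R)%R.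
  by rewrite -gt0_powRD ?pi_gt0// -mulrDl -nkd.
have pk : (0 < pi `^ (k%:R / 2) :> R)%R by rewrite powR_gt0// pi_gt0.
have pd : (0 < pi `^ (d%:R / 2) :> R)%R by rewrite powR_gt0// pi_gt0.
(* An infinite mean would make the side over R^n infinite, whereas the other one is finite. *)
case: (c) c0 => [r _||//]; last first.
  by rewrite gt0_mulye ?lte_fin ?divr_gt0 ?mulr_gt0// -EFinM.
rewrite -!EFinM => -[E]; congr EFin.
move: pk pd Gn Gd Ga E.
move: (pi `^ (k%:R / 2))%R (pi `^ (d%:R / 2))%R (Gamma (n%:R / 2)) (Gamma (d%:R / 2))
  (Gamma ((n%:R - a) / 2)) (Gamma ((d%:R - a) / 2)) => pk pd gn gd gna gda.
move=> /lt0r_neq0 pk0 /lt0r_neq0 pd0 /lt0r_neq0 gn0 /lt0r_neq0 gd0 /lt0r_neq0 gna0 E.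
apply: (@mulIf _ (pk * pd * gna / gn)%R).
  by rewrite !mulf_neq0// invr_neq0.
rewrite E; field.
by rewrite gd0 gna0 gn0.
Qed.

(** Almost every plane misses the origin, so by [ae_plane] some x != 0 lies on planes through the
    origin only for a null set of g. Such an x exists because the unit ball is not null, and
    [haar_mean] transports the property from x to e_1. *)
Lemma ae_tail_ratio : {ae dg, forall g, tail_ratio g != 0%R}.
Proof.
have n0 : (0 < n)%N by exact: leq_trans (ltn_ord k).
have [x [x0 xg]] : exists x : 'cV[R]_n, sqnorm x != 0%R /\
    {ae dg, forall g, foot_sqnorm (plane g x) != 0%R}.
  have := filterI (lebesgue_cV_sqnorm0 n0) (ae_plane hdg hdxi (ae_foot_sqnorm hdg hdxi)).
  move=> [N [mN N0 sN]]; apply: contrapT => H.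
  have /andP[+ _] := @lebesgue_cV_unit_ball R n; apply/negP; rewrite -leNgt -N0.
  apply: le_measure; rewrite ?inE//; first exact: measurable_unit_ball.
  move=> x _; apply: sN => /= -[x0 xg]; apply: H; exists x; split=> //.
pose f (t : mR R) := (\1_[set 0%R] t)%:E : \bar R.
have m0 : measurable ([set 0%R] : set (mR R)) by [].
have mf : measurable_fun setT f.
  by apply/measurable_EFinP; exact: measurable_indic.
have f0 t : 0 <= f t by rewrite lee_fin.
have := haar_mean x mf f0.
have -> : \int[dg]_g f (foot_sqnorm (plane g x)) = 0.
  have -> : 0 = \int[dg]_g (cst 0 g) by rewrite integral0.
  apply: ge0_ae_eq_integral => //.
    apply: (measurableT_comp mf); apply: (measurableT_comp measurable_foot_sqnorm).
    exact: (measurable_translate_orbit (@measurable_id _ _ _) (measurable_cst x)).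
  apply: filterS xg => g gx _; rewrite /f indicE memNset//=.
  exact/eqP.
move=> /esym E.
have mF : measurable_fun setT (fun g => f (sqnorm x * tail_ratio g)%R).
  apply: (measurableT_comp mf); apply: measurable_funM => //.
  exact: measurable_tail_ratio.
have E' : \int[dg]_g `| f (sqnorm x * tail_ratio g)%R | = 0.
  by rewrite -[RHS]E; apply: eq_integral => g _; rewrite gee0_abs.
have := (ae_eq_integral_abs _ measurableT mF).1 E'.
apply: filterS => g /(_ I) /eqP; apply: contraL => /eqP r0.
by rewrite /f indicE mem_set/= ?r0 ?mulr0// eqe oner_eq0.
Qed.

End haar_mean.

(** * The Schur test and its sharpness *)

Section weighted_hoelder.
Context {R : realType} d (T : measurableType d) (m : {measure set T -> \bar R}).
Local Open Scope ereal_scope.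

(** Hoelder for the product of |F| s^e and s^-e, raised to the power p. The choice e = al (p - 1) /
    p gives e q = al and e p = al (p - 1). Positivity of s is what makes s^e s^-e equal to 1. The
    case p = 1, where q is infinite, is immediate. *)
Lemma weighted_hoelder (F s : T -> R) (al p : R) : (1 <= p)%R ->
  measurable_fun setT F -> measurable_fun setT s ->
  {ae m, forall t, (0 < s t)%R} ->
  (\int[m]_t `|F t|%:E) `^ p <=
  (\int[m]_t (s t `^ (- al))%:E) `^ (p - 1) *
  \int[m]_t (`|F t| `^ p * s t `^ (al * (p - 1)))%:E.
Proof.
move=> p1 mF ms s0.
have mnF : measurable_fun setT (fun t => `|F t|%R) by exact: measurableT_comp.
have msp (e : R) : measurable_fun setT (fun t => s t `^ e)%R.
  exact: (measurableT_comp (measurable_powR e)).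
have [->|pn1] := eqVneq p 1%R.
  rewrite subrr mulr0 poweRe1 ?integral_ge0// poweRe0 mul1e le_eqVlt; apply/orP; left.
  by apply/eqP/eq_integral => t _; rewrite powRr0 powRr1// mulr1.
have {pn1}p1 : (1 < p)%R by rewrite lt_neqAle eq_sym pn1.
have p0 : (0 < p)%R by exact: lt_trans p1.
have p1' : (0 < p - 1)%R by rewrite subr_gt0.
pose q := (p / (p - 1))%R.
have q0 : (0 < q)%R by rewrite divr_gt0.
have pq : (p^-1 + q^-1 = 1)%R.
  by rewrite /q invf_div; field; rewrite gt_eqF.
pose e := (al * (p - 1) / p)%R.
have H := hoelder m (measurable_funM mnF (msp e)) (msp (- e)%R) p0 q0 pq.
have {}H : \int[m]_t `|F t|%:E <=
    (\int[m]_t (`|F t| `^ p * s t `^ (al * (p - 1)))%:E) `^ p^-1 *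
    (\int[m]_t (s t `^ (- al))%:E) `^ q^-1.
  move: H; rewrite Lnorm1.
  have -> : \int[m]_x `|(EFin \o ((fun t => `|F t| * s t `^ e) \* (fun t => s t `^ (- e)))%R) x|
      = \int[m]_t `|F t|%:E.
    apply: ge0_ae_eq_integral => //.
    - apply: measurableT_comp => //; apply/measurable_EFinP.
      by apply: measurable_funM => //; exact: measurable_funM.
    - by apply/measurable_EFinP.
    apply: filterS s0 => t st _ /=.
    by rewrite -mulrA -gt0_powRD// subrr powRr0 mulr1 normr_id.
  rewrite unlock /Lnorm => /le_trans; apply; rewrite le_eqVlt; apply/orP; left.
  apply/eqP; congr (_ `^ _ * _ `^ _); apply: eq_integral => t _ /=.
    rewrite ger0_norm ?mulr_ge0 ?powR_ge0// powRM ?powR_ge0// -powRrM.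
    by congr (_ * _ `^ _)%:E; rewrite /e divfK// gt_eqF.
  rewrite ger0_norm ?powR_ge0// -powRrM; congr (_ `^ _)%:E.
  by rewrite /e /q; field; rewrite !gt_eqF.
set X := (X in X `^ _ <= _) in H *; set Y := (X in _ <= _ * X) in H *.
set Z := (X in _ <= X `^ _ * _) in H *.
have X0 : 0 <= X by apply: integral_ge0 => t _; rewrite lee_fin.
have Y0 : 0 <= Y by apply: integral_ge0 => t _; rewrite lee_fin mulr_ge0// powR_ge0.
have Z0 : 0 <= Z by apply: integral_ge0 => t _; rewrite lee_fin powR_ge0.
have := @gt0_ler_poweR _ p (ltW p0) X _ _ _ H.
rewrite !in_itv/= !leey !andbT X0 mule_ge0 ?poweR_ge0// => /(_ isT isT).
rewrite poweRM ?poweR_ge0// -!poweRrM mulVf ?gt_eqF// poweRe1// muleC.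
by rewrite (_ : q^-1 * p = p - 1)%R// /q invf_div divfK// gt_eqF.
Qed.

End weighted_hoelder.

Section schur.
Context {R : realType} {n : nat} {k : 'I_n}.
Variables (dg : probability (orthogonal_group R n) R).
Variable dxi : probability (grassmannian R k) R.
Hypothesis hdg : haar_measure dg.
Hypothesis hdxi : orthogonal_invariant dxi.
Local Open Scope ereal_scope.
Notation plane g x := (translate (grass_act g (coord_plane k)) x).
Local Notation d := (n - k)%N.

(* The average of |P g^T e_1|^-a over O(n), and \int_{R^k} (1 + |w|^2)^((a - n) / 2) dw. *)
Definition mean_constant (a : R) : R :=
  (Gamma (n%:R / 2) * Gamma ((d%:R - a) / 2) /
   (Gamma (d%:R / 2) * Gamma ((n%:R - a) / 2)))%R.

Definition fiber_constant (a : R) : R :=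
  (pi `^ (k%:R / 2) * (Gamma ((d%:R - a) / 2) / Gamma ((n%:R - a) / 2)))%R.

Lemma nat_dimE : (n%:R = k%:R + d%:R :> R)%R.
Proof. by rewrite -natrD subnKC// ltnW. Qed.

Lemma mean_constant_gt0 (a : R) : (a < d%:R)%R -> (0 < mean_constant a)%R.
Proof.
move=> ad; have d0 : (0 < d)%N by rewrite subn_gt0.
have an : (a < n%:R)%R by rewrite nat_dimE (lt_le_trans ad)// lerDr.
have n0 : (0 < n)%N by exact: leq_trans (ltn_ord k).
by rewrite /mean_constant divr_gt0// mulr_gt0// Gamma_gt0// divr_gt0// ?subr_gt0// ltr0n.
Qed.

Lemma fiber_constant_gt0 (a : R) : (a < d%:R)%R -> (0 < fiber_constant a)%R.
Proof.
move=> ad; have an : (a < n%:R)%R by rewrite nat_dimE (lt_le_trans ad)// lerDr.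
by rewrite /fiber_constant mulr_gt0 ?divr_gt0 ?powR_gt0 ?pi_gt0// Gamma_gt0// divr_gt0// subr_gt0.
Qed.

Lemma haar_mean_foot_power (a : R) (x : 'cV[R]_n) : (a < d%:R)%R ->
  \int[dg]_g (foot_sqnorm (plane g x) `^ (- a / 2))%:E =
  (mean_constant a * sqnorm x `^ (- a / 2))%:E.
Proof.
move=> ad.
have mpw : measurable_fun setT (fun t : mR R => (t `^ (- a / 2))%:E).
  exact: measurable_powR_EFin.
rewrite (haar_mean hdg x mpw); last by move=> t; rewrite lee_fin powR_ge0.
rewrite [(mean_constant a * _)%R]mulrC EFinM -(haar_mean_power hdg hdxi ad).
rewrite -ge0_integralZl ?lee_fin ?powR_ge0//.
- by apply: eq_integral => g _; rewrite powRM ?sqnorm_ge0 ?tail_ratio_ge0// EFinM.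
- exact: (measurableT_comp mpw measurable_tail_ratio).
- by move=> g _; rewrite lee_fin powR_ge0.
Qed.

Lemma measurable_plane_of (x : 'cV[R]_n) :
  measurable_fun setT (fun g : orthogonal_group R n => plane g x).
Proof. exact: (measurableT_comp measurable_plane2 (measurable_pair1 x)). Qed.

Lemma measurable_haar_mean (f : affine_plane R k -> \bar R) :
  measurable_fun setT f -> (forall tau, 0 <= f tau) ->
  measurable_fun setT (fun x => \int[dg]_g f (plane g x)).
Proof.
move=> mf f0.
exact: (measurable_fun_fubini_tonelli_F (m2 := dg) _ (measurableT_comp mf measurable_plane2) (fun=> f0 _)).
Qed.

(* With a = mu + d / p, where |tau|^-a is the borderline power for L^p_mu:
   Hoelder with the weight |tau|^(a (p - 1)), then duality. *)
Lemma schur_inequality (p mu : R) (phi : affine_plane R k -> R) :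
  (1 <= p)%R -> (mu + d%:R / p < d%:R)%R -> measurable_fun setT phi ->
  \int[lebesgue_cV n]_x ((sqnorm x `^ ((mu - k%:R / p) * p / 2))%:E *
     (\int[dg]_g `|phi (plane g x)|%:E) `^ p) <=
  (mean_constant (mu + d%:R / p) `^ (p - 1) * fiber_constant (mu + d%:R / p))%:E *
  \int[plane_measure dxi]_tau (foot_sqnorm tau `^ (mu * p / 2) * `|phi tau| `^ p)%:E.
Proof.
move=> p1; set a := (mu + _)%R => ad mphi.
have p0 : (0 < p)%R by exact: lt_le_trans p1.
have n0 : (0 < n)%N by exact: leq_trans (ltn_ord k).
have mc0 := mean_constant_gt0 ad; have fc0 := fiber_constant_gt0 ad.
have mabs : measurable_fun setT (fun tau => `|phi tau|%:E).
  by apply/measurable_EFinP; exact: measurableT_comp.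
have abs0 (tau : affine_plane R k) : 0 <= `|phi tau|%:E by rewrite lee_fin.
pose Psi tau := (`|phi tau| `^ p * foot_sqnorm tau `^ (a / 2 * (p - 1)))%:E.
have mPsi : measurable_fun setT Psi.
  apply/measurable_EFinP; apply: measurable_funM.
    by apply: (measurableT_comp (measurable_powR p)); exact/measurable_EFinP.
  exact: (measurableT_comp (measurable_powR _) measurable_foot_sqnorm).
have Psi0 tau : 0 <= Psi tau by rewrite lee_fin mulr_ge0 ?powR_ge0.
(* Hoelder produces |x|^(- a (p - 1)) next to |x|^(nu p); as a p = mu p + d and nu p = mu p - k, the
   total exponent is a - n. *)
pose h (t : mR R) := (t `^ ((a - n%:R) / 2))%:E : \bar R.
have mh : measurable_fun setT h by exact: measurable_powR_EFin.
have h0 t : 0 <= h t by rewrite lee_fin powR_ge0.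
have mhN : measurable_fun setT (fun x : 'cV[R]_n => h (sqnorm x)).
  exact: (measurableT_comp mh (@measurable_sqnormT R n)).
have mPm := measurable_haar_mean mPsi Psi0.
have Pm0 x : 0 <= \int[dg]_g Psi (plane g x) by exact: integral_ge0.
apply: (@le_trans _ _ (\int[lebesgue_cV n]_x ((mean_constant a `^ (p - 1))%:E *
    (h (sqnorm x) * \int[dg]_g Psi (plane g x))))).
  apply: ae_ge0_le_integral => //.
  - by move=> x _; rewrite mule_ge0 ?poweR_ge0// lee_fin powR_ge0.
  - apply: emeasurable_funM.
      apply/measurable_EFinP; apply: (measurableT_comp (measurable_powR _)).
      exact: measurable_sqnormT.
    apply: (measurableT_comp (measurable_poweR _)).
    exact: (measurable_haar_mean mabs abs0).
  - by move=> x _; rewrite !mule_ge0// lee_fin powR_ge0.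
  - by apply: emeasurable_funM; [exact: measurable_cst|exact: emeasurable_funM].
  apply: filterS2 (lebesgue_cV_sqnorm0 n0) (ae_plane hdg hdxi (ae_foot_sqnorm hdg hdxi)).
  move=> x x0 xg _.
  have {}x0 : (0 < sqnorm x)%R by rewrite lt_neqAle eq_sym x0 sqnorm_ge0.
  have mphx : measurable_fun setT (fun g => phi (plane g x)).
    exact: (measurableT_comp mphi (measurable_plane_of x)).
  have mfx : measurable_fun setT (fun g => foot_sqnorm (plane g x)).
    exact: (measurableT_comp measurable_foot_sqnorm (measurable_plane_of x)).
  have pos : {ae dg, forall g, (0 < foot_sqnorm (plane g x))%R}.
    by apply: filterS xg => g gx; rewrite lt_neqAle eq_sym gx sqnorm_ge0.
  have := weighted_hoelder (a / 2) p1 mphx mfx pos.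
  rewrite -mulNr haar_mean_foot_power// poweR_EFin => H.
  apply: (@le_trans _ _ ((sqnorm x `^ ((mu - k%:R / p) * p / 2))%:E *
    (((mean_constant a * sqnorm x `^ (- a / 2)) `^ (p - 1))%:E *
      \int[dg]_g Psi (plane g x)))).
    by rewrite lee_wpmul2l// lee_fin powR_ge0.
  rewrite !muleA -!EFinM le_eqVlt; apply/orP; left; apply/eqP; congr (_%:E * _).
  rewrite powRM ?powR_ge0// ?(ltW mc0)// mulrCA -mulrA; congr (_ * _)%R.
  rewrite -powRrM -gt0_powRD//; congr (_ `^ _)%R.
  by rewrite /a nat_dimE; field; rewrite gt_eqF.
rewrite ge0_integralZl ?lee_fin ?powR_ge0//; last 2 first.
- exact: emeasurable_funM.
- by move=> x _; rewrite mule_ge0.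
rewrite (plane_duality hdg hdxi mh h0 mPsi Psi0) EFinM -muleA.
rewrite lee_wpmul2l ?lee_fin ?powR_ge0// le_eqVlt; apply/orP; left; apply/eqP.
have mG : measurable_fun setT
    (fun tau => (foot_sqnorm tau `^ (mu * p / 2) * `|phi tau| `^ p)%:E).
  apply/measurable_EFinP; apply: measurable_funM.
    exact: (measurableT_comp (measurable_powR _) measurable_foot_sqnorm).
  by apply: (measurableT_comp (measurable_powR p)); exact/measurable_EFinP.
have G0 tau : 0 <= (foot_sqnorm tau `^ (mu * p / 2) * `|phi tau| `^ p)%:E.
  by rewrite lee_fin mulr_ge0 ?powR_ge0.
rewrite -(ge0_integralZl _ measurableT mG (fun x _ => G0 x)) ?lee_fin ?(ltW fc0)//.
have mH : measurable_fun setT (fun tau : affine_plane R k =>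
    \int[lebesgue_cV k]_w h (sqnorm w + foot_sqnorm tau)%R).
  have mHw : measurable_fun setT (fun z : affine_plane R k * 'cV[R]_k =>
      h (sqnorm z.2 + foot_sqnorm z.1)%R).
    apply: (measurableT_comp mh); apply: measurable_funD.
      exact: (measurableT_comp (@measurable_sqnormT R k) measurable_snd).
    exact: (measurableT_comp measurable_foot_sqnorm measurable_fst).
  exact: (measurable_fun_fubini_tonelli_F (m2 := lebesgue_cV k) _ mHw (fun=> h0 _)).
apply: ge0_ae_eq_integral => //.
- exact: emeasurable_funM.
- by apply: emeasurable_funM => //; exact: measurable_cst.
- by move=> tau _; rewrite mule_ge0// integral_ge0.
- by move=> tau _; rewrite mule_ge0// lee_fin ltW.
apply: filterS (ae_foot_sqnorm hdg hdxi) => tau t0 _.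
have {}t0 : (0 < foot_sqnorm tau)%R by rewrite lt_neqAle eq_sym t0 sqnorm_ge0.
(* Integrability of |x|^(a - n) over a k-plane off the origin amounts to n - a > k, that is a <
   d. *)
have kb : (k%:R / 2 < (n%:R - a) / 2 :> R)%R.
  by rewrite ltr_pM2r// ltrBrDr addrC -ltrBrDr nat_dimE addrAC subrr add0r.
have -> : \int[lebesgue_cV k]_w h (sqnorm w + foot_sqnorm tau)%R =
    \int[lebesgue_cV k]_w ((sqnorm w + foot_sqnorm tau) `^ (- ((n%:R - a) / 2)))%:E.
  by apply: eq_integral => w _; rewrite /h -mulNr opprB.
rewrite integral_riesz// /Psi -!EFinM; congr EFin.
rewrite /fiber_constant.
have -> : ((n%:R - a) / 2 - k%:R / 2 = (d%:R - a) / 2)%R by rewrite nat_dimE; field.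
set K := (pi `^ _ * _)%R; set f := foot_sqnorm tau in t0 *.
rewrite [LHS](_ : _ = K * (f `^ (a / 2 * (p - 1)) *
    f `^ (k%:R / 2 - (n%:R - a) / 2) * `|phi tau| `^ p))%R; last by ring.
(* The powers a (p - 1) from the weight and a - d from the fiber add up to a p - d = mu p. *)
rewrite -gt0_powRD//; congr (_ * (_ `^ _ * _))%R.
by rewrite nat_dimE /a; field; rewrite gt_eqF.
Qed.

End schur.

Section weighted_norm_sqrt.
Context {R : realType} dT (T : measurableType dT) (m : {measure set T -> \bar R}).
Local Open Scope ereal_scope.

Lemma powR_sqrt (s a : R) : (0 <= s)%R -> (Num.sqrt s `^ a = s `^ (a / 2))%R.
Proof. by move=> s0; rewrite -powR12_sqrt// -powRrM mulrC. Qed.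

Lemma weighted_norm_fin (s : T -> R) (a p : R) (f : T -> R) :
  (forall t, 0 <= s t)%R ->
  weighted_norm m (fun t => Num.sqrt (s t)) a p%:E f =
  (\int[m]_t (s t `^ (a * p / 2) * `|f t| `^ p)%:E) `^ p^-1.
Proof.
move=> s0; rewrite /weighted_norm unlock /Lnorm; congr (_ `^ _).
apply: eq_integral => t _ /=.
rewrite powR_sqrt// normrM ger0_norm ?powR_ge0// powRM ?powR_ge0// -powRrM.
by rewrite mulrAC.
Qed.

End weighted_norm_sqrt.

(** * Upper bounds for finite and infinite p *)

Section boundedness.
Context {R : realType} {n : nat} {k : 'I_n}.
Variables (dg : probability (orthogonal_group R n) R).
Variable dxi : probability (grassmannian R k) R.
Hypothesis hdg : haar_measure dg.
Hypothesis hdxi : orthogonal_invariant dxi.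
Local Open Scope ereal_scope.
Notation plane g x := (translate (grass_act g (coord_plane k)) x).
Local Notation d := (n - k)%N.
Local Notation dtau := (plane_measure dxi).
Local Notation dx := (lebesgue_cV n).

(** For p = oo, [Lnorm] is the essential supremum only on a space of positive measure and 0
    otherwise; this selects the right branch for [dx]. *)
Lemma lebesgue_cV_setT_gt0 m : 0 < @lebesgue_cV R m setT.
Proof.
have /andP[+ _] := @lebesgue_cV_unit_ball R m => /lt_le_trans; apply.
by apply: le_measure; rewrite ?inE//; exact: measurable_unit_ball.
Qed.

(** The integral is the difference of those of the positive and negative parts, each measurable in x
    by Tonelli, and [fine] is measurable; points where the integral is infinite are covered as
    well. *)
Lemma measurable_dual_transform (phi : affine_plane R k -> R) :
  measurable_fun setT phi -> measurable_fun setT (dual_transform dg phi).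
Proof.
move=> mphi; have mE : measurable_fun setT (EFin \o phi) by exact/measurable_EFinP.
rewrite [X in measurable_fun _ X](_ : _ = fine \o
    ((fun x => \int[dg]_g (EFin \o phi)^\+ (plane g x)) \-
     (fun x => \int[dg]_g (EFin \o phi)^\- (plane g x)))).
  apply: (measurableT_comp (fine_measurable measurableT)).
  apply: emeasurable_funB; apply: measurable_haar_mean => //.
    exact: measurable_funepos.
  exact: measurable_funeneg.
apply/funext => x; rewrite /dual_transform /Rintegral integralE /=.
congr (fine (_ - _)); apply: eq_integral => g _.
  by rewrite !funeposE.
by rewrite !funenegE.
Qed.

Lemma measurable_phi_plane (phi : affine_plane R k -> R) (x : 'cV[R]_n) :
  measurable_fun setT phi -> measurable_fun setT (fun g => (phi (plane g x))%:E).
Proof.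
by move=> mphi; apply/measurable_EFinP; exact: (measurableT_comp mphi (measurable_plane_of x)).
Qed.

Lemma dual_transform_le (phi : affine_plane R k -> R) (x : 'cV[R]_n) :
  measurable_fun setT phi ->
  `|dual_transform dg phi x|%:E <= \int[dg]_g `|phi (plane g x)|%:E.
Proof.
move=> mphi; apply: le_trans (le_abse_integral dg measurableT (measurable_phi_plane x mphi)).
rewrite /dual_transform /Rintegral.
(* At an infinite integral the transform takes the default value 0, and the bound is trivial. *)
by case: (\int[dg]_g _) => [r| |] //=; rewrite ?normr0 ?leey.
Qed.

Lemma plane_integrable (phi : affine_plane R k -> R) (x : 'cV[R]_n) :
  measurable_fun setT phi -> \int[dg]_g `|phi (plane g x)|%:E < +oo ->
  dg.-integrable setT (fun g => (phi (plane g x))%:E).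
Proof. by move=> mphi foo; apply/integrableP; split=> //; exact: measurable_phi_plane. Qed.

Section finite_exponent.
Variables (p mu : R).
Hypothesis p1 : (1 <= p)%R.
Let a := (mu + d%:R / p)%R.
Hypothesis ad : (a < d%:R)%R.

Definition schur_constant : R :=
  ((mean_constant (n := n) (k := k) a `^ (p - 1) * fiber_constant (n := n) (k := k) a) `^ p^-1)%R.

Let p0 : (0 < p)%R. Proof. exact: lt_le_trans p1. Qed.

Let C0 : (0 < mean_constant (n := n) (k := k) a `^ (p - 1) * fiber_constant (n := n) (k := k) a)%R.
Proof. by rewrite mulr_gt0 ?powR_gt0 ?mean_constant_gt0 ?fiber_constant_gt0. Qed.

Let normXE phi : weighted_norm dtau (@plane_dist R n k) mu p%:E phi =
  (\int[dtau]_tau (foot_sqnorm tau `^ (mu * p / 2) * `|phi tau| `^ p)%:E) `^ p^-1.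
Proof. by rewrite -(weighted_norm_fin dtau)// => tau; exact: sqnorm_ge0. Qed.

Let normYE nu f : weighted_norm dx (@enorm R n) nu p%:E f =
  (\int[dx]_x (sqnorm x `^ (nu * p / 2) * `|f x| `^ p)%:E) `^ p^-1.
Proof. by rewrite -(weighted_norm_fin dx)// => tau; exact: sqnorm_ge0. Qed.

(** The left-hand integrand of the Schur inequality has a finite integral, so it is finite almost
    everywhere; as its weight is positive for x != 0, the mean of |phi| is finite there. *)
Lemma ae_integrable_fin (phi : affine_plane R k -> R) :
  weighted_Lp dtau (@plane_dist R n k) mu p%:E phi ->
  {ae dx, forall x, dg.-integrable setT (fun g => (phi (plane g x))%:E)}.
Proof.
move=> [mphi]; rewrite normXE => /lty_poweRy; rewrite invr_neq0 ?gt_eqF// => /(_ isT) J.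
have n0 : (0 < n)%N by exact: leq_trans (ltn_ord k).
have := schur_inequality hdg hdxi p1 ad mphi.
set f := fun x => _ * _ `^ p; set J' := \int[dx]_x _ => IJ.
have f0 x : 0 <= f x by rewrite mule_ge0 ?poweR_ge0// lee_fin powR_ge0.
have Ioo : J' < +oo.
  apply: le_lt_trans IJ _; apply: lte_mul_pinfty => //.
  by rewrite lee_fin ltW.
have mabs : measurable_fun setT (fun tau => `|phi tau|%:E).
  by apply/measurable_EFinP; exact: measurableT_comp.
have abs0 (tau : affine_plane R k) : 0 <= `|phi tau|%:E by rewrite lee_fin.
have If : dx.-integrable setT f.
  apply/integrableP; split; last first.
    by under eq_integral do rewrite gee0_abs//.
  apply: emeasurable_funM.
    apply/measurable_EFinP; apply: (measurableT_comp (measurable_powR _)).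
    exact: measurable_sqnormT.
  apply: (measurableT_comp (measurable_poweR _)).
  exact: (measurable_haar_mean dg mabs abs0).
apply: filterS2 (lebesgue_cV_sqnorm0 n0) (integrable_ae measurableT If) => x x0 /(_ I) fx.
apply: plane_integrable => //.
rewrite ltey; apply/negP => /eqP Poo.
move: fx; rewrite /f Poo poweRyr ?gt_eqF// gt0_muley// lte_fin powR_gt0//.
by rewrite lt_neqAle eq_sym x0 sqnorm_ge0.
Qed.

Lemma dual_transform_bound_fin (phi : affine_plane R k -> R) :
  measurable_fun setT phi ->
  weighted_norm dx (@enorm R n) (mu - k%:R / p) p%:E (dual_transform dg phi) <=
  schur_constant%:E * weighted_norm dtau (@plane_dist R n k) mu p%:E phi.
Proof.
move=> mphi; rewrite normXE normYE /schur_constant -poweR_EFin -poweRM; last 2 first.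
- by rewrite lee_fin ltW.
- by apply: integral_ge0 => t _; rewrite lee_fin mulr_ge0 ?powR_ge0.
have pi0 : (0 <= p^-1)%R by rewrite invr_ge0 ltW.
apply: gt0_ler_poweR => //.
- rewrite in_itv/= leey andbT; apply: integral_ge0 => t _.
  by rewrite lee_fin mulr_ge0 ?powR_ge0.
- rewrite in_itv/= leey andbT mule_ge0 ?lee_fin ?(ltW C0)//; apply: integral_ge0 => t _.
  by rewrite lee_fin mulr_ge0 ?powR_ge0.
apply: le_trans (schur_inequality hdg hdxi p1 ad mphi).
have mabs : measurable_fun setT (fun tau => `|phi tau|%:E).
  by apply/measurable_EFinP; exact: measurableT_comp.
have abs0 (tau : affine_plane R k) : 0 <= `|phi tau|%:E by rewrite lee_fin.
have mN (e : R) : measurable_fun setT (fun x : 'cV[R]_n => sqnorm x `^ e)%R.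
  by apply: (measurableT_comp (measurable_powR _)); exact: measurable_sqnormT.
apply: ge0_le_integral => //.
- by move=> x _; rewrite lee_fin mulr_ge0 ?powR_ge0.
- apply/measurable_EFinP; apply: measurable_funM => //.
  apply: (measurableT_comp (measurable_powR _)).
  by apply: measurableT_comp => //; exact: measurable_dual_transform.
- apply: emeasurable_funM; first exact/measurable_EFinP.
  apply: (measurableT_comp (measurable_poweR _)).
  exact: (measurable_haar_mean dg mabs abs0).
move=> x _; rewrite EFinM lee_wpmul2l ?lee_fin ?powR_ge0// -poweR_EFin.
apply: gt0_ler_poweR; rewrite ?(ltW p0)// ?in_itv/= ?leey ?andbT ?lee_fin//.
  by apply: integral_ge0 => g _; rewrite lee_fin.
exact: dual_transform_le.
Qed.

End finite_exponent.

Section infinite_exponent.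
Variable mu : R.
Hypothesis mud : (mu < d%:R)%R.
Let c := mean_constant (n := n) (k := k) mu.

Let norm_foot (phi : affine_plane R k -> R) tau :
  `|(plane_dist tau `^ mu * phi tau)%:E| = (foot_sqnorm tau `^ (mu / 2) * `|phi tau|)%:E.
Proof.
rewrite /plane_dist /enorm /= normrM ger0_norm ?powR_ge0// powR_sqrt//.
exact: sqnorm_ge0.
Qed.

Lemma ae_haar_mean_oo (phi : affine_plane R k -> R) (K : R) :
  measurable_fun setT phi -> (0 <= K)%R ->
  weighted_norm dtau (@plane_dist R n k) mu +oo phi = K%:E ->
  {ae dx, forall x, \int[dg]_g `|phi (plane g x)|%:E <=
    (K * (c * sqnorm x `^ (- mu / 2)))%:E}.
Proof.
move=> mphi K0 NK.
have le_ae : {ae dtau, forall tau, `|phi tau| <= K * foot_sqnorm tau `^ (- mu / 2)}%R.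
  have H : {ae dtau, forall tau, (foot_sqnorm tau `^ (mu / 2) * `|phi tau| <= K)%R}.
    move: NK; rewrite /weighted_norm unlock /Lnorm; case: ifPn => [m0 NK|m0 _].
      have := ess_sup_ge dtau (abse \o (fun tau => (plane_dist tau `^ mu * phi tau)%:E)).
      by apply: filterS => tau; rewrite NK [(abse \o _) _]norm_foot lee_fin.
    (* If [dtau] had total mass 0 the norm would carry no information, but then every property holds
       almost everywhere. *)
    exists setT; split=> //; apply/eqP; rewrite eq_le measure_ge0 andbT.
    by rewrite -leNgt in m0.
  apply: filterS2 H (ae_foot_sqnorm hdg hdxi) => tau H f0.
  have {}f0 : (0 < foot_sqnorm tau)%R by rewrite lt_neqAle eq_sym f0 sqnorm_ge0.
  by rewrite mulNr powRN ler_pdivlMr ?powR_gt0// mulrC.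
apply: filterS (ae_plane hdg hdxi le_ae) => x H.
rewrite EFinM -(haar_mean_foot_power hdg hdxi x mud).
have mf : measurable_fun setT (fun g => (foot_sqnorm (plane g x) `^ (- mu / 2))%:E).
  apply/measurable_EFinP; apply: (measurableT_comp (measurable_powR _)).
  exact: (measurableT_comp measurable_foot_sqnorm (measurable_plane_of x)).
rewrite -(ge0_integralZl _ measurableT mf); last 2 first.
- by move=> g _; rewrite lee_fin powR_ge0.
- by rewrite lee_fin.
apply: ae_ge0_le_integral => //.
- by have := measurableT_comp (@abse_measurable R setT) (measurable_phi_plane x mphi).
- by move=> g _; rewrite mule_ge0// lee_fin powR_ge0.
- by apply: emeasurable_funM => //; exact: measurable_cst.
by apply: filterS H => g H _; rewrite -EFinM lee_fin.
Qed.

Lemma dual_transform_bound_oo (phi : affine_plane R k -> R) :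
  weighted_Lp dtau (@plane_dist R n k) mu +oo phi ->
  {ae dx, forall x, dg.-integrable setT (fun g => (phi (plane g x))%:E)} /\
  weighted_norm dx (@enorm R n) mu +oo (dual_transform dg phi) <=
  c%:E * weighted_norm dtau (@plane_dist R n k) mu +oo phi.
Proof.
move=> [mphi]; set N := weighted_norm _ _ _ _ _ => Noo.
have N0 : 0 <= N by exact: Lnorm_ge0.
have n0 : (0 < n)%N by exact: leq_trans (ltn_ord k).
have [K [K0 NK]] : exists K, (0 <= K)%R /\ N = K%:E.
  by case: N Noo N0 => // r _ r0; exists r.
have H := ae_haar_mean_oo mphi K0 NK.
split.
  apply: filterS H => x H; apply: plane_integrable => //.
  by apply: le_lt_trans H _; rewrite ltry.
rewrite /weighted_norm unlock /Lnorm lebesgue_cV_setT_gt0.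
apply/ess_supP; rewrite NK.
apply: filterS2 (lebesgue_cV_sqnorm0 n0) H => x x0 H /=.
have {}x0 : (0 < sqnorm x)%R by rewrite lt_neqAle eq_sym x0 sqnorm_ge0.
rewrite normrM ger0_norm ?powR_ge0// -[enorm x]/(Num.sqrt (sqnorm x)).
rewrite powR_sqrt ?sqnorm_ge0// -EFinM lee_fin.
have := le_trans (dual_transform_le x mphi) H; rewrite lee_fin => {}H.
apply: (le_trans (ler_wpM2l (powR_ge0 _ _) H)).
rewrite mulNr powRN [leLHS](_ : _ = c * K)%R//.
by field; rewrite gt_eqF// powR_gt0.
Qed.

End infinite_exponent.

End boundedness.

(** * Lower bounds for the operator norm *)

Section sharpness.
Context {R : realType} {n : nat} {k : 'I_n}.
Variables (dg : probability (orthogonal_group R n) R).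
Variable dxi : probability (grassmannian R k) R.
Hypothesis hdg : haar_measure dg.
Hypothesis hdxi : orthogonal_invariant dxi.
Local Open Scope ereal_scope.
Notation plane g x := (translate (grass_act g (coord_plane k)) x).
Local Notation d := (n - k)%N.
Local Notation dtau := (plane_measure dxi).
Local Notation dx := (lebesgue_cV n).
Local Notation mc a := (@mean_constant R n k a).

Let n0 : (0 < n)%N. Proof. exact: leq_trans (ltn_ord k). Qed.
Let d0 : (0 < d)%N. Proof. by rewrite subn_gt0. Qed.

(* Monotone convergence: 0 < |P g^T e_1| <= 1 almost surely. *)
Lemma mean_constant_le (a B : R) : (a < d%:R)%R ->
  (forall e, (0 < e)%R -> (mc (a - e) <= B)%R) -> (mc a <= B)%R.
Proof.
move=> ad leB.
pose rho := @tail_ratio R n k.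
pose ex (j : nat) : R := (- (a - j.+1%:R^-1) / 2)%R.
(* At rho = 0 a real power is 0 or 1 depending on the exponent, so F and G are set to 0 there;
   convergence and monotonicity in j then hold at every g. *)
pose F (j : nat) g : \bar R := if rho g == 0%R then 0 else (rho g `^ ex j)%:E.
pose G g : \bar R := if rho g == 0%R then 0 else (rho g `^ (- a / 2))%:E.
have mrho : measurable_fun setT rho by exact: measurable_tail_ratio.
have mpow (e : R) : measurable_fun setT (fun g => (rho g `^ e)%:E).
  by apply/measurable_EFinP; exact: (measurableT_comp (measurable_powR e)).
have mcut (e : R) : measurable_fun setT
    (fun g => if rho g == 0%R then 0 else (rho g `^ e)%:E).
  by apply: measurable_fun_ifT => //; exact: measurable_fun_eqr.
have F0 j g : 0 <= F j g by rewrite /F; case: ifP => // _; rewrite lee_fin powR_ge0.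
have G0 g : 0 <= G g by rewrite /G; case: ifP => // _; rewrite lee_fin powR_ge0.
have FG g : limn (F^~ g) = G g.
  apply/cvg_lim => //; rewrite /F /G; case: ifPn => [_|r0]; first exact: cvg_cst.
  apply/fine_cvgP; split; first exact: nearW.
  have ->: fine \o (fun j => (rho g `^ ex j)%:E) = (fun j => expR (ex j * ln (rho g))).
    by apply/funext => j /=; rewrite /powR (negbTE r0).
  rewrite /powR (negbTE r0).
  have cex : ex j @[j --> \oo] --> (- a / 2)%R.
    rewrite /ex; apply: cvgMr_tmp; apply: cvgN.
    rewrite -[X in _ --> X]subr0; apply: cvgB; first exact: cvg_cst.
    exact: cvg_harmonic.
  exact: (continuous_cvg _ (@continuous_expR R _) (cvgMr_tmp (b := ln (rho g)) cex)).
have intG : \int[dg]_g G g = (mc a)%:E.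
  rewrite -(haar_mean_power hdg hdxi ad).
  apply: ge0_ae_eq_integral => //; first exact: (mcut (- a / 2)%R).
    by move=> g _; rewrite lee_fin powR_ge0.
  by apply: filterS (ae_tail_ratio hdg hdxi) => g r0 _; rewrite /G (negbTE r0).
have intF j : \int[dg]_g F j g <= B%:E.
  have e0 : (0 < j.+1%:R^-1 :> R)%R by rewrite invr_gt0.
  have aed : (a - j.+1%:R^-1 < d%:R)%R by rewrite (lt_trans _ ad)// gtrBl.
  apply: (@le_trans _ _ (mc (a - j.+1%:R^-1))%:E); last by rewrite lee_fin leB.
  rewrite -(haar_mean_power hdg hdxi aed); apply: ge0_le_integral => //.
    exact: (mcut (ex j)).
  by move=> g _; rewrite /F; case: ifP => // _; rewrite lee_fin powR_ge0.
rewrite -lee_fin -intG.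
under eq_integral do rewrite -FG.
have ndF g : setT g -> {homo F^~ g : i j / (i <= j)%N >-> i <= j}.
  move=> _ i j ij; rewrite /F; case: ifPn => // r0; rewrite lee_fin.
  apply: ger_powR; first by rewrite tail_ratio_le1 lt_neqAle eq_sym r0 tail_ratio_ge0.
  by rewrite /ex ler_pM2r// lerN2 lerB// lef_pV2 ?posrE// ler_nat.
have cF := cvg_monotone_convergence measurableT (fun j => mcut (ex j)) (fun j g _ => F0 j g) ndF.
rewrite -(cvg_lim _ (cF dg))//; apply: lime_le; first exact: (cvgP _ (cF dg)).
exact: nearW.
Qed.

(** Half the area of the unit sphere of R^m, the constant of [integral_radial]. *)
Definition radial_constant (m : nat) : R := (pi `^ (m%:R / 2) / Gamma (m%:R / 2))%R.

Lemma radial_constant_gt0 m : (0 < m)%N -> (0 < radial_constant m)%R.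
Proof.
by move=> m0; rewrite divr_gt0 ?powR_gt0 ?pi_gt0// Gamma_gt0// divr_gt0// ltr0n.
Qed.

(* As a function of t = |tau|^2, with e = - (a - eps) / 2, this is the nearly
   extremal function l |tau|^(- a + eps) on |tau| <= 1. For |x| <= 1 all planes
   through x meet the unit ball, so R_k^* maps it exactly to a power of |x|. *)
Definition cut_power (l e t : R) : R := (l * (t `^ e * (t <= 1)%R%:R))%R.

Lemma measurable_cut_power l e : measurable_fun setT (cut_power l e : mR R -> R).
Proof.
apply: measurable_funM => //; apply: measurable_funM; first exact: measurable_powR.
have mb : measurable_fun setT (fun t : mR R => (t <= 1)%R).
  exact: (@measurable_fun_ler _ _ _ setT (fun t : mR R => t) (cst 1%R)).
have -> : (fun t : mR R => (t <= 1)%R%:R : R) = fun t => if (t <= 1)%R then 1%R else 0%R.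
  by apply/funext => t; case: ifP.
exact: measurable_fun_ifT.
Qed.

(** The remaining integral depends on s alone. Since mu p + d = nu p + n = a p, the function on
    planes and its image on R^n lead to the same s, so only the ratio of the radial constants
    survives. *)
Lemma integral_cut_power m (b e p l s : R) : (0 < m)%N -> (0 < p)%R -> (0 <= l)%R ->
  (b + e * p + m%:R / 2 = s)%R ->
  \int[lebesgue_cV m]_x (sqnorm x `^ b * `|cut_power l e (sqnorm x)| `^ p)%:E =
  (radial_constant m * l `^ p)%:E *
  \int[lebesgue_measure]_(t in (`]0%R, 1%R]%classic : set (mR R))) (t `^ (s - 1))%:E.
Proof.
move=> m0 p0 l0 sE; have G0 : (0 < Gamma (m%:R / 2 : R))%R.
  by rewrite Gamma_gt0// divr_gt0// ltr0n.
pose f (t : mR R) := (t `^ b * `|cut_power l e t| `^ p)%:E.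
have mf : measurable_fun setT f.
  apply/measurable_EFinP; apply: measurable_funM; first exact: measurable_powR.
  apply: (measurableT_comp (measurable_powR p)).
  by apply: measurableT_comp => //; exact: measurable_cut_power.
have f0 t : 0 <= f t by rewrite lee_fin mulr_ge0 ?powR_ge0.
have := integral_radial m0 mf f0.
set M := \int[lebesgue_measure]_(t in (`]0%R, 1%R]%classic : set (mR R))) _.
have -> : \int[lebesgue_measure]_(t in posR R) ((t `^ (m%:R / 2 - 1))%:E * f t) =
    (l `^ p)%:E * M.
  have m01 : measurable (`]0%R, 1%R]%classic : set (mR R)) by exact: measurable_itv.
  rewrite -(ge0_integralZl _ m01 (@measurable_powR_EFin R (s - 1) _)); last 2 first.
  - by move=> t _; rewrite lee_fin powR_ge0.
  - by rewrite lee_fin powR_ge0.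
  rewrite [LHS]integral_mkcond [RHS]integral_mkcond; apply: eq_integral => t _.
  rewrite !patchE in_posR; have [t0|t0] := ltP 0%R t; last first.
    by rewrite ifF//; apply/negbTE; rewrite notin_setE/= in_itv/= => /andP[]; rewrite ltNge t0.
  rewrite /f /cut_power; have [t1|t1] := leP t 1%R.
    rewrite ifT; last by rewrite inE/= in_itv/= t0 t1.
    rewrite mulr1 ger0_norm ?mulr_ge0 ?powR_ge0// powRM ?powR_ge0// -!EFinM.
    rewrite -powRrM; congr EFin; rewrite mulrA mulrCA.
    rewrite mulrA [LHS](_ : _ = l `^ p *
      (t `^ (m%:R / 2 - 1) * t `^ b * t `^ (e * p)))%R; last by ring.
    by rewrite -!gt0_powRD//; congr (_ * _ `^ _)%R; rewrite -sE; ring.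
  rewrite ifF; last by apply/negbTE; rewrite notin_setE/= in_itv/= t0/= leNgt t1.
  by rewrite !mulr0 normr0 powR0 ?gt_eqF// mulr0 mule0.
rewrite -[X in _ * X = _ -> _]/(\int[lebesgue_cV m]_x f (sqnorm x)).
set I := \int[_]_x f _ => E.
have -> : I = ((Gamma (m%:R / 2))^-1)%:E * ((Gamma (m%:R / 2))%:E * I).
  by rewrite muleA -EFinM mulVf ?gt_eqF// mul1e.
by rewrite E !muleA -!EFinM; congr (_%:E * _); rewrite /radial_constant; ring.
Qed.

Lemma dual_transform_cut_power (a l : R) (x : 'cV[R]_n) : (a < d%:R)%R ->
  (sqnorm x <= 1)%R -> (0 <= l)%R ->
  dual_transform dg (fun tau : affine_plane R k => cut_power l (- a / 2) (foot_sqnorm tau)) x =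
  (l * mc a * sqnorm x `^ (- a / 2))%R.
Proof.
move=> ad x1 l0; rewrite /dual_transform /Rintegral.
have mf : measurable_fun setT (fun g => (foot_sqnorm (plane g x) `^ (- a / 2))%:E).
  apply/measurable_EFinP; apply: (measurableT_comp (measurable_powR _)).
  exact: (measurableT_comp measurable_foot_sqnorm (measurable_plane_of x)).
have -> : \int[dg]_g (cut_power l (- a / 2) (foot_sqnorm (plane g x)))%:E =
    \int[dg]_g (l%:E * (foot_sqnorm (plane g x) `^ (- a / 2))%:E).
  apply: eq_integral => g _; rewrite /cut_power (_ : foot_sqnorm _ <= 1)%R ?mulr1//.
  rewrite foot_sqnorm_plane (le_trans (sqnorm_tail_le _ _))// sqnorm_isometry//.
  by rewrite trmxK orthogonalC.
rewrite (ge0_integralZl _ measurableT mf); last 2 first.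
- by move=> g _; rewrite lee_fin powR_ge0.
- by rewrite lee_fin.
by rewrite (haar_mean_foot_power hdg hdxi x ad) -EFinM /= mulrA.
Qed.

Lemma operator_norm_ge_fin (p mu : R) : (1 <= p)%R -> (mu + d%:R / p < d%:R)%R ->
  (mc (mu + d%:R / p) * (radial_constant n / radial_constant d) `^ p^-1)%:E <=
  operator_norm
    (weighted_Lp dtau (@plane_dist R n k) mu p%:E)
    (weighted_norm dtau (@plane_dist R n k) mu p%:E)
    (weighted_norm dx (@enorm R n) (mu - k%:R / p) p%:E)
    (dual_transform dg).
Proof.
move=> p1; set a := (mu + _)%R => ad.
have p0 : (0 < p)%R by exact: lt_le_trans p1.
set op := operator_norm _ _ _ _.
have An := radial_constant_gt0 n0; have Ad := radial_constant_gt0 d0.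
have q0 : (0 < (radial_constant n / radial_constant d) `^ p^-1)%R.
  by rewrite powR_gt0// divr_gt0.
suff H (e : R) : (0 < e)%R ->
    (mc (a - e) * (radial_constant n / radial_constant d) `^ p^-1)%:E <= op.
  (* One instance of H excludes -oo, and +oo needs no proof; for a real norm, e tends to 0 through
     [mean_constant_le]. *)
  have := H 1%R ltr01; case: op H => [r|_ _|]; last 2 first.
  - by rewrite leey.
  - by move=> _; rewrite leNgt ltNyr.
  move=> H _; rewrite lee_fin -ler_pdivlMr//; apply: mean_constant_le => // e e0.
  by rewrite ler_pdivlMr// -lee_fin; exact: H.
move=> e0; have aed : (a - e < d%:R)%R by rewrite (lt_trans _ ad)// gtrBl.
have mc0 := mean_constant_gt0 aed.
pose s := (e * p / 2)%R; have s0 : (0 < s)%R by rewrite divr_gt0// mulr_gt0.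
have /andP[M0 Moo] := integral_powR_01 s0.
set M := \int[_]_(_ in _) _ in M0 Moo.
have [r [r0 Mr]] : exists r, (0 < r)%R /\ M = r%:E.
  by case: M M0 Moo => // r r0 _; exists r.
(* Normalisation: the p-th power of the norm of phi is [radial_constant d] times l^p r. *)
pose l := ((radial_constant d * r) `^ (- p^-1))%R.
have Ar : (0 < radial_constant d * r)%R by rewrite mulr_gt0.
have l0 : (0 < l)%R by exact: powR_gt0.
have lp : (radial_constant d * l `^ p * r = 1)%R.
  rewrite /l -powRrM mulNr mulVf ?gt_eqF// powRN powRr1 ?(ltW Ar)//.
  by field; rewrite !gt_eqF.
pose phi (tau : affine_plane R k) := cut_power l (- (a - e) / 2) (foot_sqnorm tau).
have mphi : measurable_fun setT phi.
  exact: (measurableT_comp (measurable_cut_power _ _) measurable_foot_sqnorm).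
have NX : weighted_norm dtau (@plane_dist R n k) mu p%:E phi = 1.
  rewrite (weighted_norm_fin dtau (s := @foot_sqnorm R n k)); last first.
    by move=> tau; exact: sqnorm_ge0.
  pose f (t : mR R) := (t `^ (mu * p / 2) * `|cut_power l (- (a - e) / 2) t| `^ p)%:E : \bar R.
  have mf : measurable_fun setT f.
    apply/measurable_EFinP; apply: measurable_funM; first exact: measurable_powR.
    apply: (measurableT_comp (measurable_powR p)).
    by apply: measurableT_comp => //; exact: measurable_cut_power.
  have f0 t : 0 <= f t by rewrite lee_fin mulr_ge0 ?powR_ge0.
  rewrite [X in X `^ _](integral_foot_sqnorm hdg hdxi mf f0).
  rewrite (@integral_cut_power _ _ _ _ _ s)//; last 2 first.
  - exact: ltW.
  - by rewrite /s /a; field; rewrite gt_eqF.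
  by rewrite -/M Mr -EFinM lp poweR1r.
apply: le_trans (_ : weighted_norm dx (@enorm R n) (mu - k%:R / p) p%:E (dual_transform dg phi) <= _).
  rewrite (weighted_norm_fin dx (s := @sqnorm R n)); last first.
    by move=> x; exact: sqnorm_ge0.
  pose nu := (mu - k%:R / p)%R.
  have E : \int[dx]_x (sqnorm x `^ (nu * p / 2) *
      `|cut_power (l * mc (a - e)) (- (a - e) / 2) (sqnorm x)| `^ p)%:E =
      ((mc (a - e)) `^ p * (radial_constant n / radial_constant d))%:E.
    rewrite (@integral_cut_power _ _ _ _ _ s)//; last 2 first.
    - by rewrite mulr_ge0// ltW.
    - by rewrite /s /nu /a (nat_dimE (k := k)); field; rewrite gt_eqF.
    rewrite -/M Mr -EFinM; congr EFin; rewrite powRM ?(ltW l0) ?(ltW mc0)//.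
    rewrite [LHS](_ : _ = mc (a - e) `^ p * (radial_constant n / radial_constant d) *
      (radial_constant d * l `^ p * r))%R; first by rewrite lp mulr1.
    by field; rewrite gt_eqF.
  rewrite [leLHS](_ : _ = (\int[dx]_x (sqnorm x `^ (nu * p / 2) *
      `|cut_power (l * mc (a - e)) (- (a - e) / 2) (sqnorm x)| `^ p)%:E) `^ p^-1); last first.
    rewrite E poweR_EFin; congr EFin.
    have AA : (0 <= radial_constant n / radial_constant d)%R.
      by rewrite ltW// divr_gt0.
    rewrite [RHS]powRM ?powR_ge0//.
    by rewrite -powRrM divff ?gt_eqF// powRr1// ltW.
  have mN (b : R) : measurable_fun setT (fun x : 'cV[R]_n => sqnorm x `^ b)%R.
    by apply: (measurableT_comp (measurable_powR _)); exact: measurable_sqnormT.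
  apply: gt0_ler_poweR; rewrite ?invr_ge0 ?(ltW p0)//.
  - by rewrite in_itv/= leey andbT integral_ge0// => x _; rewrite lee_fin mulr_ge0 ?powR_ge0.
  - by rewrite in_itv/= leey andbT integral_ge0// => x _; rewrite lee_fin mulr_ge0 ?powR_ge0.
  apply: ge0_le_integral => //.
  - by move=> x _; rewrite lee_fin mulr_ge0 ?powR_ge0.
  - apply/measurable_EFinP; apply: measurable_funM => //.
    apply: (measurableT_comp (measurable_powR _)); apply: measurableT_comp => //.
    exact: (measurableT_comp (measurable_cut_power _ _) (@measurable_sqnormT R n)).
  - apply/measurable_EFinP; apply: measurable_funM => //.
    apply: (measurableT_comp (measurable_powR _)); apply: measurableT_comp => //.
    exact: measurable_dual_transform.
  move=> x _; rewrite lee_fin ler_wpM2l ?powR_ge0//.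
  (* The image is known exactly on the unit ball; elsewhere the comparison function vanishes and the
     image is bounded below by 0. *)
  have [x1|x1] := leP (sqnorm x) 1%R.
    by rewrite /cut_power x1 mulr1 dual_transform_cut_power// ltW.
  by rewrite /cut_power (lt_geF x1) !mulr0 normr0 powR0 ?gt_eqF// powR_ge0.
apply: ereal_sup_ubound; exists phi => //; split; last by rewrite NX.
by split=> //; rewrite NX ltry.
Qed.

Lemma operator_norm_ge_oo (mu : R) : (mu < d%:R)%R ->
  (mc mu)%:E <= operator_norm
    (weighted_Lp dtau (@plane_dist R n k) mu +oo)
    (weighted_norm dtau (@plane_dist R n k) mu +oo)
    (weighted_norm dx (@enorm R n) mu +oo)
    (dual_transform dg).
Proof.
move=> mud; have mc0 := mean_constant_gt0 mud.
pose phi (tau : affine_plane R k) := (foot_sqnorm tau `^ (- mu / 2))%R.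
have mphi : measurable_fun setT phi.
  exact: (measurableT_comp (measurable_powR _) measurable_foot_sqnorm).
have NX : weighted_norm dtau (@plane_dist R n k) mu +oo phi <= 1.
  rewrite /weighted_norm unlock /Lnorm; case: ifPn => // _.
  apply/ess_supP; apply: nearW => tau /=; rewrite lee_fin.
  rewrite -[plane_dist tau]/(Num.sqrt (foot_sqnorm tau)) powR_sqrt ?sqnorm_ge0//.
  rewrite ger0_norm ?mulr_ge0 ?powR_ge0// /phi.
  (* For a plane through the origin the two powers of 0 are each 0 or 1, so the bound by 1
     persists. *)
  have [t0|t0] := eqVneq (foot_sqnorm tau) 0%R.
    by rewrite t0 /powR eqxx; case: (_ == _); case: (_ == _); rewrite /= ?mulr0 ?mulr1.
  rewrite -gt0_powRD; first by rewrite mulNr subrr powRr0.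
  by rewrite lt_neqAle eq_sym t0 sqnorm_ge0.
apply: le_trans (_ : weighted_norm dx (@enorm R n) mu +oo (dual_transform dg phi) <= _).
  rewrite /weighted_norm unlock /Lnorm lebesgue_cV_setT_gt0.
  apply: ess_sup_gee; first exact: lebesgue_cV_setT_gt0.
  apply: filterS (lebesgue_cV_sqnorm0 n0) => x x0 /=; rewrite lee_fin.
  have {}x0 : (0 < sqnorm x)%R by rewrite lt_neqAle eq_sym x0 sqnorm_ge0.
  rewrite -[enorm x]/(Num.sqrt (sqnorm x)) powR_sqrt ?sqnorm_ge0//.
  rewrite /dual_transform /Rintegral (haar_mean_foot_power hdg hdxi x mud) /=.
  rewrite mulrCA -gt0_powRD// mulNr subrr powRr0 mulr1.
  exact: ler_norm.
apply: ereal_sup_ubound; exists phi => //; split=> //.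
by split=> //; apply: le_lt_trans NX _; rewrite ltry.
Qed.

End sharpness.

(** * Agreement of the bounds and the operator statement *)

Section operator.
Context {R : realType} {n : nat} {k : 'I_n}.
Variables (dg : probability (orthogonal_group R n) R).
Variable dxi : probability (grassmannian R k) R.
Hypothesis hdg : haar_measure dg.
Hypothesis hdxi : orthogonal_invariant dxi.
Notation plane g x := (translate (grass_act g (coord_plane k)) x).
Local Notation d := (n - k)%N.
Local Notation dtau := (plane_measure dxi).
Local Notation dx := (lebesgue_cV n).

Lemma mean_constantE (a : R) :
  @mean_constant R n k a = @fiber_constant R n k a *
    (@radial_constant R d / @radial_constant R n).
Proof.
have d0 : (0 < d)%N by rewrite subn_gt0.
have n0 : (0 < n)%N by exact: leq_trans (ltn_ord k).
rewrite /mean_constant /fiber_constant /radial_constant.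
have -> : pi `^ (n%:R / 2) = pi `^ (k%:R / 2) * pi `^ (d%:R / 2) :> R.
  by rewrite -gt0_powRD ?pi_gt0// -mulrDl -nat_dimE.
have Gn : 0 < Gamma (n%:R / 2 : R) by rewrite Gamma_gt0// divr_gt0// ltr0n.
have Gd : 0 < Gamma (d%:R / 2 : R) by rewrite Gamma_gt0// divr_gt0// ltr0n.
have pk : 0 < pi `^ (k%:R / 2) :> R by rewrite powR_gt0// pi_gt0.
have pd : 0 < pi `^ (d%:R / 2) :> R by rewrite powR_gt0// pi_gt0.
rewrite (invfM (Gamma (d%:R / 2))).
move: (Gamma ((n%:R - a) / 2))^-1 (Gamma ((d%:R - a) / 2)) => u v.
move: (Gamma (n%:R / 2)) (Gamma (d%:R / 2)) Gn Gd => gn gd.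
move: (pi `^ (k%:R / 2)) (pi `^ (d%:R / 2)) pk pd => pk pd pk0 pd0 gn0 gd0.
by clear -pk0 pd0 gn0 gd0; field; rewrite !gt_eqF.
Qed.

(** The upper bound takes the form of the lower one: inserting c' = c A_n / A_d turns (c^(p - 1)
    c')^(1 / p) into c (A_n / A_d)^(1 / p). *)
Lemma schur_constantE (p mu : R) : 1 <= p -> mu + d%:R / p < d%:R ->
  @schur_constant R n k p mu = @mean_constant R n k (mu + d%:R / p) *
    (@radial_constant R n / @radial_constant R d) `^ p^-1.
Proof.
move=> p1 ad; have p0 : 0 < p by exact: lt_le_trans p1.
have d0 : (0 < d)%N by rewrite subn_gt0.
have n0 : (0 < n)%N by exact: leq_trans (ltn_ord k).
have mc0 := mean_constant_gt0 ad.
have An := @radial_constant_gt0 R _ n0; have Ad := @radial_constant_gt0 R _ d0.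
have AA : 0 <= @radial_constant R n / @radial_constant R d by exact/ltW/(divr_gt0 An Ad).
rewrite /schur_constant; set a := mu + _ in mc0 *.
have -> : @fiber_constant R n k a =
    @mean_constant R n k a * (@radial_constant R n / @radial_constant R d).
  rewrite mean_constantE; move: (fiber_constant _) (@radial_constant R n)
    (@radial_constant R d) An Ad => f u v u0 v0.
  by field; rewrite !gt_eqF.
rewrite mulrA -{2}[@mean_constant R n k a]powRr1 ?(ltW mc0)// -gt0_powRD// subrK.
by rewrite powRM ?powR_ge0// -powRrM divff ?gt_eqF// powRr1// ltW.
Qed.

(** Common to finite and infinite p. Independence of the representative comes from [ae_plane];
    linearity needs integrability at almost every x, because the real-valued integral is additive
    only on integrable functions. *)
Lemma bounded_operator_norm (p : \bar R) (mu nu C : R) : 0 <= C ->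
  (forall phi, weighted_Lp dtau (@plane_dist R n k) mu p phi ->
    {ae dx, forall x, dg.-integrable setT (fun g => (phi (plane g x))%:E)}) ->
  (forall phi, weighted_Lp dtau (@plane_dist R n k) mu p phi ->
    (weighted_norm dx (@enorm R n) nu p (dual_transform dg phi) <=
     C%:E * weighted_norm dtau (@plane_dist R n k) mu p phi)%E) ->
  (C%:E <= operator_norm (weighted_Lp dtau (@plane_dist R n k) mu p)
    (weighted_norm dtau (@plane_dist R n k) mu p)
    (weighted_norm dx (@enorm R n) nu p) (dual_transform dg))%E ->
  linear_bounded_operator dtau dx (weighted_Lp dtau (@plane_dist R n k) mu p)
    (weighted_norm dtau (@plane_dist R n k) mu p)
    (weighted_Lp dx (@enorm R n) nu p) (weighted_norm dx (@enorm R n) nu p)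
    (dual_transform dg) /\
  operator_norm (weighted_Lp dtau (@plane_dist R n k) mu p)
    (weighted_norm dtau (@plane_dist R n k) mu p)
    (weighted_norm dx (@enorm R n) nu p) (dual_transform dg) = C%:E.
Proof.
move=> C0 Hint Hbound Hge; split; last first.
  apply/eqP; rewrite eq_le Hge andbT.
  apply: ge_ereal_sup => _ [phi [Xphi N1] <-].
  apply: (le_trans (Hbound _ Xphi)).
  by rewrite -[leRHS]mule1 lee_wpmul2l// lee_fin.
split.
- move=> phi Xphi; split; first by apply: measurable_dual_transform; case: Xphi.
  apply: (le_lt_trans (Hbound _ Xphi)).
  by apply: lte_mul_pinfty => //; case: Xphi.
- move=> f g [mf _] [mg _] fg.
  have {}fg : {ae dtau, forall tau, f tau = g tau}.
    by apply: filterS fg => tau /(_ I).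
  apply: filterS (ae_plane hdg hdxi fg) => x fgx _.
  rewrite /dual_transform /Rintegral; congr fine.
  apply: ae_eq_integral => //; try exact: measurable_phi_plane.
  by apply: filterS fgx => h fgh _ /=; rewrite fgh.
- move=> a b f g Xf Xg.
  apply: filterS2 (Hint _ Xf) (Hint _ Xg) => x fx gx _.
  rewrite /dual_transform RintegralD//; last 2 first.
  - have := integrableZl measurableT a fx.
    by under eq_fun do rewrite -EFinM.
  - have := integrableZl measurableT b gx.
    by under eq_fun do rewrite -EFinM.
  by rewrite !RintegralZl.
- by exists C.
Qed.

End operator.

(** With q = 1/p this trades the exponent 1/p' of the announced formula for the exponent 1/p of the
    bounds. *)
Lemma powR_ratio (R : realType) (u v q : R) : 0 < u -> 0 < v ->
  (u / v) `^ (1 - q) = u / v * (v / u) `^ q.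
Proof.
move=> u0 v0; have uv0 : 0 < u / v by rewrite divr_gt0.
rewrite gt0_powRD// powRr1 ?(ltW uv0)//; congr (_ * _).
by rewrite -[v / u]invf_div -[(u / v)^-1]powR_inv1 ?(ltW uv0)// -powRrM mulN1r.
Qed.

Lemma sphere_area_ratio (R : realType) (m n : nat) : (0 < m)%N -> (0 < n)%N ->
  sphere_area (m - 1) / sphere_area (n - 1) =
  @radial_constant R m / @radial_constant R n.
Proof.
have E l : (0 < l)%N -> sphere_area (l - 1) = 2 * @radial_constant R l.
  by move=> l0; rewrite /sphere_area subn1 prednK// /radial_constant mulrA.
by move=> m0 n0; rewrite !E// invfM mulrACA divff ?mul1r// pnatr_eq0.
Qed.
Unset Implicit Arguments.

(* fine p^-1 is 1/p, with 1/oo = 0. *)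
Theorem theorem3p8 (R : realType) (n : nat) (k : 'I_n) (p p' : \bar R)
    (mu nu : R)
    (dgamma : probability (orthogonal_group R n) R)
    (dxi : probability (grassmannian R k) R)
    (hn : (2 <= n)%N) (hk : (1 <= k)%N)
    (hp : (1 <= p)%E) (hpp' : (p^-1 + p'^-1 = 1)%E)
    (hmu : mu < (n - k)%:R * fine (p'^-1)%E)
    (hnu : nu = mu - k%:R * fine (p^-1)%E)
    (hdgamma : haar_measure dgamma)
    (hdxi : orthogonal_invariant dxi) :
  let dtau := plane_measure dxi in
  let dx := lebesgue_cV n in
  let Lp_mu := weighted_Lp dtau (@plane_dist R n k) mu p in
  let norm_mu := weighted_norm dtau (@plane_dist R n k) mu p in
  let Lp_nu := weighted_Lp dx (@enorm R n) nu p in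
  let norm_nu := weighted_norm dx (@enorm R n) nu p in
  [/\ forall phi, Lp_mu phi -> {ae dx, forall x, dgamma.-integrable setT
        (fun g => (phi (translate (grass_act g (coord_plane k)) x))%:E)},
      linear_bounded_operator dtau dx Lp_mu norm_mu Lp_nu norm_nu
        (dual_transform dgamma)
    & operator_norm Lp_mu norm_mu norm_nu (dual_transform dgamma) =
      (pi `^ (k%:R / 2) *
       (sphere_area (n - k - 1) / sphere_area (n - 1)) `^ fine (p'^-1)%E *
       (Gamma (((n - k)%:R * fine (p'^-1)%E - mu) / 2) /
        Gamma ((n%:R * fine (p'^-1)%E + k%:R * fine (p^-1)%E - mu) / 2)))%:E].
Proof.
have n0 : (0 < n)%N by exact: leq_trans hn.
have d0 : (0 < n - k)%N by rewrite subn_gt0.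
have An := @radial_constant_gt0 R _ n0; have Ad := @radial_constant_gt0 R _ d0.
(* The announced constant in terms of c, for q = 1/p and q' = 1/p' in both cases: d q' - mu = d - a
   and n q' + k q - mu = n - a. *)
have GE (a : R) : a < (n - k)%:R -> forall q q' : R, q + q' = 1 ->
    a = mu + (n - k)%:R * q ->
    pi `^ (k%:R / 2) * (@radial_constant R (n - k) / @radial_constant R n) `^ q' *
      (Gamma (((n - k)%:R * q' - mu) / 2) / Gamma ((n%:R * q' + k%:R * q - mu) / 2)) =
    @mean_constant R n k a * (@radial_constant R n / @radial_constant R (n - k)) `^ q.
  move=> ad q q' qq' aE.
  have -> : (n - k)%:R * q' - mu = (n - k)%:R - a by rewrite aE -[q'](addKr q) qq'; ring.
  have -> : n%:R * q' + k%:R * q - mu = n%:R - a.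
    by rewrite aE -[q'](addKr q) qq' (@nat_dimE R n k); ring.
  have -> : q' = 1 - q by rewrite -qq' addrC addKr.
  rewrite (powR_ratio q Ad An) mean_constantE /fiber_constant.
  by move: (_ `^ q) => w; ring.
case: p hp hpp' hnu => [r|_|//].
- rewrite lee_fin => r1; have r0 : 0 < r by exact: lt_le_trans r1.
  rewrite inver gt_eqF//= => hpp' hnu.
  have q'E : (p'^-1)%E = (1 - r^-1)%:E.
    move: hpp'; case: (p'^-1)%E => [s|//|//]; rewrite -EFinD => -[<-].
    by rewrite addrC addKr.
  rewrite q'E /= in hmu hnu *.
  (* The hypothesis mu < d / p' says exactly that the borderline exponent a is below d. *)
  have ad : mu + (n - k)%:R / r < (n - k)%:R by rewrite -ltrBrDr -[X in X - _]mulr1 -mulrBr.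
  rewrite sphere_area_ratio// (GE _ ad)//; last by rewrite addrC subrK.
  rewrite -schur_constantE//.
  have C0 : 0 <= @schur_constant R n k r mu by rewrite powR_ge0.
  subst nu.
  have [|||H1 H2] := @bounded_operator_norm R n k dgamma dxi hdgamma hdxi r%:E mu
      (mu - k%:R / r) (@schur_constant R n k r mu) C0.
  + exact: ae_integrable_fin.
  + by move=> phi [mphi _]; exact: dual_transform_bound_fin.
  + by rewrite schur_constantE//; exact: operator_norm_ge_fin.
  by split=> //; exact: ae_integrable_fin.
- rewrite invey add0e => q'E hnu; rewrite q'E /= in hmu hnu *.
  have mud : mu < (n - k)%:R by rewrite mulr1 in hmu.
  rewrite sphere_area_ratio// (GE mu)//; last 2 first.
  + by rewrite add0r.
  + by rewrite mulr0 addr0.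
  rewrite powRr0 mulr1.
  have -> : nu = mu by rewrite hnu mulr0 subr0.
  have C0 : 0 <= @mean_constant R n k mu by rewrite ltW// mean_constant_gt0.
  have [|||H1 H2] := @bounded_operator_norm R n k dgamma dxi hdgamma hdxi +oo%E mu mu
      (@mean_constant R n k mu) C0.
  + by move=> phi X; have [] := dual_transform_bound_oo hdgamma hdxi mud X.
  + by move=> phi X; have [] := dual_transform_bound_oo hdgamma hdxi mud X.
  + exact: operator_norm_ge_oo.
  split=> //; move=> phi X.
  by have [] := dual_transform_bound_oo hdgamma hdxi mud X.
Qed.
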